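(* Let $f=f(x^1,x^3)$ be a smooth function of two variables with $f_3\neq0$, let $[g_{\mathcal D_f}]$ be Bryant's conformal structure represented by $g_{\mathcal D_f}=2\theta^1\theta^4+2\theta^2\theta^5+2\theta^3\theta^6$, and let $$\tilde g_{f,Q}=2\,d(\varrho t)\,dt+t^2\big(g_{\mathcal D_f}+2\varrho P+\varrho^3Q\big)$$ be one of its ambient metrics, where $P$ is the Schouten tensor of $g_{\mathcal D_f}$ and $Q\in\mathrm{span}_{\mathcal A}\{\theta^i\theta^j\mid i,j\in\{2,4,6\}\}$. Then: (i) If $\kappa=(f_3)^{-1/3}\theta^2\wedge\theta^4\wedge\theta^6$, then the $4$-form $$\widetilde\kappa=-\frac{2t^3}{9}\,dt\wedge\kappa=-\frac{2t^3}{9(f_3)^{1/3}}\,dt\wedge\theta^2\wedge\theta^4\wedge\theta^6$$ is parallel, i.e., $\widetilde\nabla\widetilde\kappa=0$. (ii) The totally null distribution $\widetilde{\mathcal V}$ of tangent vectors $X$ with $X\lrcorner\,\widetilde\kappa=0$, which is spanned by $\frac{\partial}{\partial x^2},\frac{\partial}{\partial y^1},\frac{\partial}{\partial y^3}$ and $\partial_\varrho$, is parallel. (iii) The holonomy algebra of $\tilde g_{f,Q}$ is contained in the stabilizer of $\widetilde\kappa$, $$\mathfrak{hol}(\tilde g_{f,Q})\subset\mathfrak{sl}_4\mathbb R\ltimes\Lambda_4\mathbb R=\left\{\begin{pmatrix}X&Z\\ 0&-X^\top\end{pmatrix}\ \Big|\ X\in\mathfrak{sl}_4\mathbb R,\ Z+Z^\top=0\right\}\subset\mathfrak{so}(4,4),$$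 where $\Lambda_4\mathbb R$ denotes the skew symmetric $4\times4$ matrices. The representation of $\mathfrak{sl}_4\mathbb R$ on the Abelian ideal $\Lambda_4\mathbb R$ is given by $X\cdot Z=XZ-(XZ)^\top$.
   Context: $\mathcal A$ is the algebra of smooth functions depending only on $x^1,x^3$. Coordinates on an open set of $\mathbb R^6$ near the origin are $(x^1,x^2,x^3,y^1,y^2,y^3)$, with additional coordinates $t>0$ and $\varrho$ near $0$ for $\tilde g_{f,Q}$; $f_i=\partial f/\partial x^i$ etc. For $f=f(x^1,x^3)$ the co-frame is $\theta^1=dy^1+x^2dx^3$, $\theta^2=dy^2+f\,dx^1$, $\theta^3=dy^3+x^1dx^2$, $\theta^4=\tfrac32f_3^2dx^1$, $\theta^5=\tfrac32f_3dx^2-\tfrac12f_{33}\theta^1$, $\theta^6=\tfrac32f_3^2dx^3+\tfrac12f_{13}\theta^2$. The Schouten tensor in dimension 6 is $P=\frac14\big(Ric-\frac{Scal}{10}g\big)$. $\widetilde\nabla$ is the Levi-Civita connection of $\tilde g_{f,Q}$; a distribution is parallel if it is $\widetilde\nabla$-invariant. Holonomy algebras are considered up to conjugation in $\mathfrak{so}(4,4)$; the matrices are with respect to a basis of the tangent space at a point in which the metric is $\begin{pmatrix} 0 & I_4 \\ I_4 & 0 \end{pmatrix}$ and whose first four vectors span $\widetilde{\mathcal V}$. *)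

(* Defs.v *)
From mathcomp Require Import all_boot all_order all_algebra.
From mathcomp Require Import all_classical all_reals all_analysis.
Import Order.TTheory GRing.Theory Num.Theory.
Import numFieldNormedType.Exports.

Set Implicit Arguments.
Unset Strict Implicit.
Unset Printing Implicit Defensive.

Local Open Scope classical_set_scope.
Local Open Scope ring_scope.

(* Points and tangent vectors of an open set of R^n are columns 'cV_n, and
   covectors are rows 'rV_n. An endomorphism A acts by v |-> A *m v. *)

Definition dvec {R : realType} {n : nat} (i : 'I_n) : 'cV[R]_n := delta_mx i 0.

Definition dcov {R : realType} {n : nat} (i : 'I_n) : 'rV[R]_n := delta_mx 0 i.

Definition partial {R : realType} {n : nat} (i : 'I_n) (f : 'cV[R]_n -> R)
  (p : 'cV[R]_n) : R := 'D_(dvec i) f p.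

Definition dfun {R : realType} {n : nat} (f : 'cV[R]_n -> R) (p : 'cV[R]_n) :
  'rV[R]_n := \row_i partial i f p.

Fixpoint Ck_on {R : realType} {n : nat} (k : nat) (U : set 'cV[R]_n)
    (f : 'cV[R]_n -> R) : Prop :=
  match k with
  | 0 => forall p, U p -> {for p, continuous f}
  | k'.+1 => (forall p, U p -> differentiable f p) /\
             (forall i, Ck_on k' U (partial i f))
  end.

Definition smooth_on {R : realType} {n : nat} (U : set 'cV[R]_n)
  (f : 'cV[R]_n -> R) : Prop := forall k, Ck_on k U f.

Definition smooth_field {R : realType} {n : nat} (U : set 'cV[R]_n)
  (Y : 'cV[R]_n -> 'cV[R]_n) : Prop := forall i, smooth_on U (fun p => Y p i 0).

(* The real cube root, also for negative arguments. *)
Definition cbrt {R : realType} (x : R) : R := Num.sg x * (`|x| `^ (3%:R^-1)).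

(* The symmetric product ab = (a (x) b + b (x) a) / 2, as a Gram matrix. *)
Definition sprod {R : realType} {n : nat} (a b : 'rV[R]_n) : 'M[R]_n :=
  2%:R^-1 *: (a^T *m b + b^T *m a).

Definition kform (R : realType) (n k : nat) : Type := ('I_k -> 'cV[R]_n) -> R.

(* a /\ w with the convention (a /\ b)(u, v) = a(u) b(v) - a(v) b(u). *)
Definition wedge1 {R : realType} {n k : nat} (a : 'rV[R]_n) (w : kform R n k) :
  kform R n k.+1 :=
  fun v => \sum_(i < k.+1)
    (-1) ^+ i * (a *m v i) 0 0 * w (fun j => v (lift i j)).

Fixpoint wedges {R : realType} {n : nat} (s : seq 'rV[R]_n) :
    kform R n (size s) :=
  match s return kform R n (size s) with
  | [::] => fun _ => 1
  | a :: s' => wedge1 a (@wedges R n s')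
  end.
Arguments wedges {R n} s.

Definition scale_form {R : realType} {n k : nat} (c : R) (w : kform R n k) :
  kform R n k := fun v => c * w v.

Definition interior {R : realType} {n k : nat} (X : 'cV[R]_n)
  (w : kform R n k.+1) : kform R n k :=
  fun v => w (fun i => if unlift ord0 i is Some j then v j else X).

Definition subst_arg {R : realType} {n k : nat} (v : 'I_k -> 'cV[R]_n)
  (i : 'I_k) (u : 'cV[R]_n) : 'I_k -> 'cV[R]_n :=
  fun j => if j == i then u else v j.

Definition lie {R : realType} {n : nat} (A B : 'M[R]_n) : 'M[R]_n :=
  A *m B - B *m A.

Definition so_of {R : realType} {n : nat} (G : 'M[R]_n) : set 'M[R]_n :=
  [set A | A^T *m G + G *m A = 0].

(* The annihilator of w under the natural action of gl_n on forms. *)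
Definition stab_of {R : realType} {n k : nat} (w : kform R n k) :
  set 'M[R]_n :=
  [set A | forall v, \sum_(i < k) w (subst_arg v i (A *m v i)) = 0].

(* A metric is given by its Gram matrix in the coordinate frame. *)

(* christoffel g k i j is Gamma^k_{ij} of the Levi-Civita connection. *)
Definition christoffel {R : realType} {n : nat} (g : 'cV[R]_n -> 'M[R]_n)
  (k i j : 'I_n) (p : 'cV[R]_n) : R :=
  2%:R^-1 * \sum_(l < n) invmx (g p) k l *
    (partial i (fun q => g q l j) p + partial j (fun q => g q l i) p
     - partial l (fun q => g q i j) p).

(* The endomorphism v |-> Gamma(X, v) at p. *)
Definition conn_mx {R : realType} {n : nat} (g : 'cV[R]_n -> 'M[R]_n)
  (p X : 'cV[R]_n) : 'M[R]_n :=
  \matrix_(k, j) \sum_(i < n) X i 0 * christoffel g k i j p.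

(* dx^l (R(d_i, d_j) d_k), where
   R(X, Y) = [nabla_X, nabla_Y] - nabla_[X, Y]. *)
Definition riemann {R : realType} {n : nat} (g : 'cV[R]_n -> 'M[R]_n)
  (l k i j : 'I_n) (p : 'cV[R]_n) : R :=
  partial i (christoffel g l j k) p - partial j (christoffel g l i k) p
  + \sum_(m < n) (christoffel g l i m p * christoffel g m j k p
                  - christoffel g l j m p * christoffel g m i k p).

Definition ricci {R : realType} {n : nat} (g : 'cV[R]_n -> 'M[R]_n)
  (p : 'cV[R]_n) : 'M[R]_n := \matrix_(k, j) \sum_(i < n) riemann g i k i j p.

Definition scal {R : realType} {n : nat} (g : 'cV[R]_n -> 'M[R]_n)
  (p : 'cV[R]_n) : R := \tr (invmx (g p) *m ricci g p).

Definition schouten6 {R : realType} (g : 'cV[R]_6 -> 'M[R]_6) (p : 'cV[R]_6) :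
  'M[R]_6 := 4%:R^-1 *: (ricci g p - (scal g p / 10%:R) *: g p).

Definition nabla_field {R : realType} {n : nat} (g : 'cV[R]_n -> 'M[R]_n)
  (Y : 'cV[R]_n -> 'cV[R]_n) (p X : 'cV[R]_n) : 'cV[R]_n :=
  'D_X Y p + conn_mx g p X *m Y p.

(* (nabla_X w)(v_1, ..., v_k), where the v_i are extended to constant
   coordinate vector fields, so that nabla_X v_i = Gamma(X, v_i). *)
Definition nabla_form {R : realType} {n k : nat} (g : 'cV[R]_n -> 'M[R]_n)
  (w : 'cV[R]_n -> kform R n k) (p X : 'cV[R]_n) : kform R n k :=
  fun v => 'D_X (fun q => w q v) p
    - \sum_(i < k) w p (subst_arg v i (conn_mx g p X *m v i)).

Definition parallel_form {R : realType} {n k : nat} (g : 'cV[R]_n -> 'M[R]_n)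
  (U : set 'cV[R]_n) (w : 'cV[R]_n -> kform R n k) : Prop :=
  forall p X v, U p -> nabla_form g w p X v = 0.

Definition parallel_distribution {R : realType} {n : nat}
  (g : 'cV[R]_n -> 'M[R]_n) (U : set 'cV[R]_n)
  (V : 'cV[R]_n -> set 'cV[R]_n) : Prop :=
  forall (O : set 'cV[R]_n) (Y : 'cV[R]_n -> 'cV[R]_n),
    open O -> O `<=` U -> smooth_field O Y -> (forall p, O p -> V p (Y p)) ->
    forall p X, O p -> V p (nabla_field g Y p X).

(* Derivatives at the end points 0 and 1 are two-sided; this is no restriction,
   because C^1 arcs on [0, 1] extend beyond the end points. *)
Definition C1_arc {R : realType} {n : nat} (U : set 'cV[R]_n)
  (c : R -> 'cV[R]_n) : Prop :=
  (forall s : R, 0 <= s <= 1 -> U (c s) /\ derivable c s 1) /\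
  {within `[0, 1]%classic, continuous (derive1 c)}.

(* F s is the parallel transport along c from c 0 to c s. *)
Definition transport_along {R : realType} {n : nat} (g : 'cV[R]_n -> 'M[R]_n)
  (c : R -> 'cV[R]_n) (F : R -> 'M[R]_n) : Prop :=
  F 0 = 1%:M /\
  forall s : R, 0 <= s <= 1 ->
    is_derive s 1 F (- (conn_mx g (c s) (derive1 c s) *m F s)).

(* transport g U p q T: T is the parallel transport from p to q along some
   piecewise C^1 curve in U. *)
Inductive transport {R : realType} {n : nat} (g : 'cV[R]_n -> 'M[R]_n)
    (U : set 'cV[R]_n) : 'cV[R]_n -> 'cV[R]_n -> 'M[R]_n -> Prop :=
| transport_refl p : U p -> transport g U p p 1%:M
| transport_step p (c : R -> 'cV[R]_n) (F : R -> 'M[R]_n) (T : 'M[R]_n) :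
    transport g U p (c 0) T -> C1_arc U c -> transport_along g c F ->
    transport g U p (c 1) (F 1 *m T).

Definition holonomy_group {R : realType} {n : nat} (g : 'cV[R]_n -> 'M[R]_n)
  (U : set 'cV[R]_n) (p : 'cV[R]_n) : set 'M[R]_n :=
  [set T | transport g U p p T].

(* The Lie algebra of the holonomy group, a Lie subgroup of GL_n: all
   generators of its one-parameter subgroups s |-> exp(sA). *)
Definition holonomy_algebra {R : realType} {n : nat} (g : 'cV[R]_n -> 'M[R]_n)
  (U : set 'cV[R]_n) (p : 'cV[R]_n) : set 'M[R]_n :=
  [set A | exists Phi : R -> 'M[R]_n,
     [/\ forall s, holonomy_group g U p (Phi s),
         forall s r, Phi (s + r) = Phi s *m Phi r
       & is_derive (0 : R) 1 Phi A]].

(* Coordinates on R^6 are (x^1, x^2, x^3, y^1, y^2, y^3). *)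

Definition ix1 : 'I_6 := @Ordinal 6 0 isT.
Definition ix2 : 'I_6 := @Ordinal 6 1 isT.
Definition ix3 : 'I_6 := @Ordinal 6 2 isT.
Definition iy1 : 'I_6 := @Ordinal 6 3 isT.
Definition iy2 : 'I_6 := @Ordinal 6 4 isT.
Definition iy3 : 'I_6 := @Ordinal 6 5 isT.

Definition x13 {R : realType} (p : 'cV[R]_6) : 'cV[R]_2 :=
  \col_(i < 2) (if i == ord0 then p ix1 0 else p ix3 0).

(* The two variables of f : 'cV_2 -> R are x^1 and x^3, in this order. *)
Definition pd1 {R : realType} (f : 'cV[R]_2 -> R) : 'cV[R]_2 -> R :=
  partial (ord0 : 'I_2) f.
Definition pd3 {R : realType} (f : 'cV[R]_2 -> R) : 'cV[R]_2 -> R :=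
  partial (ord_max : 'I_2) f.

Definition theta1 {R : realType} (p : 'cV[R]_6) : 'rV[R]_6 :=
  dcov iy1 + p ix2 0 *: dcov ix3.
Definition theta2 {R : realType} (f : 'cV[R]_2 -> R) (p : 'cV[R]_6) :
  'rV[R]_6 := dcov iy2 + f (x13 p) *: dcov ix1.
Definition theta3 {R : realType} (p : 'cV[R]_6) : 'rV[R]_6 :=
  dcov iy3 + p ix1 0 *: dcov ix2.
Definition theta4 {R : realType} (f : 'cV[R]_2 -> R) (p : 'cV[R]_6) :
  'rV[R]_6 := (3%:R / 2%:R * pd3 f (x13 p) ^+ 2) *: dcov ix1.
Definition theta5 {R : realType} (f : 'cV[R]_2 -> R) (p : 'cV[R]_6) :
  'rV[R]_6 := (3%:R / 2%:R * pd3 f (x13 p)) *: dcov ix2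
              - (2%:R^-1 * pd3 (pd3 f) (x13 p)) *: theta1 p.
Definition theta6 {R : realType} (f : 'cV[R]_2 -> R) (p : 'cV[R]_6) :
  'rV[R]_6 := (3%:R / 2%:R * pd3 f (x13 p) ^+ 2) *: dcov ix3
              + (2%:R^-1 * pd3 (pd1 f) (x13 p)) *: theta2 f p.

Definition g_bryant {R : realType} (f : 'cV[R]_2 -> R) (p : 'cV[R]_6) :
  'M[R]_6 :=
  2%:R *: sprod (theta1 p) (theta4 f p)
  + 2%:R *: sprod (theta2 f p) (theta5 f p)
  + 2%:R *: sprod (theta3 p) (theta6 f p).

Definition theta246 {R : realType} (f : 'cV[R]_2 -> R) (a : 'I_3)
  (p : 'cV[R]_6) : 'rV[R]_6 :=
  nth 0 [:: theta2 f p; theta4 f p; theta6 f p] a.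

(* Q is in span_A {theta^i theta^j | i, j in {2, 4, 6}}, where A consists of
   the smooth functions of (x^1, x^3) in W. *)
Definition in_spanA {R : realType} (W : set 'cV[R]_2) (f : 'cV[R]_2 -> R)
  (Q : 'cV[R]_6 -> 'M[R]_6) : Prop :=
  exists q : 'I_3 -> 'I_3 -> 'cV[R]_2 -> R,
    (forall a b, smooth_on W (q a b)) /\
    forall p, W (x13 p) ->
      Q p = \sum_(a < 3) \sum_(b < 3)
              q a b (x13 p) *: sprod (theta246 f a p) (theta246 f b p).

(* Coordinates on R^8 are (x^1, x^2, x^3, y^1, y^2, y^3, t, rho). *)

Definition pr6 {R : realType} (p : 'cV[R]_(6 + 2)) : 'cV[R]_6 := usubmx p.

Definition base (i : 'I_6) : 'I_(6 + 2) := lshift 2 i.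
Definition it : 'I_(6 + 2) := rshift 6 (ord0 : 'I_2).
Definition irho : 'I_(6 + 2) := rshift 6 (ord_max : 'I_2).

Definition tc {R : realType} (p : 'cV[R]_(6 + 2)) : R := p it 0.
Definition rhoc {R : realType} (p : 'cV[R]_(6 + 2)) : R := p irho 0.

Definition pull_cov {R : realType} (a : 'rV[R]_6) : 'rV[R]_(6 + 2) :=
  row_mx a 0.
Definition pull_sym {R : realType} (h : 'M[R]_6) : 'M[R]_(6 + 2) :=
  block_mx h 0 0 0.
Definition pull_form {R : realType} {k : nat} (w : kform R 6 k) :
  kform R (6 + 2) k := fun v => w (fun i => pr6 (v i)).

Definition g_ambient {R : realType} (f : 'cV[R]_2 -> R)
  (Q : 'cV[R]_6 -> 'M[R]_6) (p : 'cV[R]_(6 + 2)) : 'M[R]_(6 + 2) :=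
  2%:R *: sprod (dfun (fun q => rhoc q * tc q) p) (dcov it)
  + tc p ^+ 2 *: pull_sym (g_bryant f (pr6 p)
                           + (2%:R * rhoc p) *: schouten6 (g_bryant f) (pr6 p)
                           + rhoc p ^+ 3 *: Q (pr6 p)).

Definition kappa {R : realType} (f : 'cV[R]_2 -> R) (p : 'cV[R]_6) :
  kform R 6 3 :=
  scale_form (cbrt (pd3 f (x13 p)))^-1
    (wedges [:: theta2 f p; theta4 f p; theta6 f p]).

Definition kappa_tilde {R : realType} (f : 'cV[R]_2 -> R)
  (p : 'cV[R]_(6 + 2)) : kform R (6 + 2) 4 :=
  scale_form (- (2%:R * tc p ^+ 3 / 9%:R))
    (wedge1 (dcov it) (pull_form (kappa f (pr6 p)))).

Definition V_tilde {R : realType} (f : 'cV[R]_2 -> R) (p : 'cV[R]_(6 + 2)) :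
  set 'cV[R]_(6 + 2) :=
  [set X | forall v, interior X (kappa_tilde f p) v = 0].

Definition J44 {R : realType} : 'M[R]_(4 + 4) := block_mx 0 1%:M 1%:M 0.

Definition sl4 {R : realType} : set 'M[R]_4 := [set X | \tr X = 0].

Definition Lambda4 {R : realType} : set 'M[R]_4 := [set Z | Z + Z^T = 0].

Definition emb_sl {R : realType} (X : 'M[R]_4) : 'M[R]_(4 + 4) :=
  block_mx X 0 0 (- X^T).

Definition emb_Lambda {R : realType} (Z : 'M[R]_4) : 'M[R]_(4 + 4) :=
  block_mx 0 Z 0 0.

Definition sl4_Lambda4 {R : realType} : set 'M[R]_(4 + 4) :=
  [set M | exists X Z, [/\ sl4 X, Lambda4 Z & M = block_mx X Z 0 (- X^T)]].

(* The columns of B form a basis of R^8 in which G has Gram matrix J44, and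
   whose first four vectors span V. *)
Definition adapted_basis {R : realType} (G : 'M[R]_(6 + 2))
  (V : set 'cV[R]_(6 + 2)) (B : 'M[R]_(6 + 2, 4 + 4)) : Prop :=
  B^T *m G *m B = J44 /\
  forall X, V X <-> exists c : 'cV[R]_4, X = lsubmx B *m c.

(* The matrices in the basis B of the endomorphisms in S. *)
Definition in_basis {R : realType} (B : 'M[R]_(6 + 2, 4 + 4))
  (S : set 'M[R]_(6 + 2)) : set 'M[R]_(4 + 4) :=
  [set M | exists2 A, S A & A *m B = B *m M].

(* Main.v *)
(* Let V be spanned by the odd directions d/dx^2, d/dy^1, d/dy^3, d/drho and let n
   be the projection to the even coordinates (x^1, x^3, y^2, t), so that V is the
   kernel of n and kappa_tilde is a function times det(n v_1, ..., n v_4).  The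
   ambient metric vanishes on V, its block pairing V with the even directions
   depends on (x^1, x^3, t) only, and hence the even-odd block of the connection
   vanishes: V is parallel.  The form kappa_tilde is then parallel as soon as the
   logarithmic derivative of its coefficient, which is proportional to
   t^3 f_3^(11/3), is the trace of the even-even block of the connection.  That
   trace only sees the Schouten tensor P through the facts that P has no odd
   components and does not depend on x^2, y^1, y^3.

   To obtain them without computing P, give each even direction degree 1 and each
   odd direction degree 0.  Then g_ij, g^ij, Gamma^k_ij and Ric_ij are polynomials in
   x^2 over the functions of (x^1, x^3), of degrees at most d_i + d_j - 1,
   1 - d_i - d_j, d_i + d_j - d_k - 1 and d_i + d_j - 2, and scal of degree at most
   -1: negative degrees mean zero.  P is symmetric because the trace of the
   connection of g is the gradient of 5 log |f_3|.

   Holonomy: along a curve, F^T g F and kappa_tilde (F v_1, ..., F v_4) are constant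
   for a parallel transport F, by Jacobi's formula for the determinant. *)
Require Import Defs.
From mathcomp Require Import all_boot all_order all_algebra.
From mathcomp Require Import all_classical all_reals all_analysis.
From mathcomp Require Import perm ring.
Import Order.TTheory GRing.Theory Num.Theory.
Import numFieldNormedType.Exports.
Local Open Scope classical_set_scope.
Local Open Scope ring_scope.

(** All three parts rest on the single relation of [conn_mx_even]: n intertwines the connection with
    a matrix A', and the coefficient w of the form satisfies D_X w = w tr A'. Here A' is the
    connection induced on the quotient of the tangent bundle by V, and w times the determinant is a
    parallel section of the dual of its determinant line. The obstacle is [ricci]. Expanding it for
    a 6x6 metric in f and its derivatives is hopeless, yet the symmetry of the ambient metric, on
    which the compatibility of its connection depends, involves P, and the symmetry of a Ricci
    matrix is not part of its definition. Since the odd directions are null, the only matrix to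
    invert is the 3x3 mixed block, whose inverse is polynomial in 1/f_3; this keeps the degree count
    closed under inversion. P does occur in the connection, through the rho-derivative t^2 (2P + 3
    rho^2 Q) of the even-even block, but only in entries pairing rho with x^1, x^3, y^2. The trace
    against the block-diagonal inverse does not meet them. *)

(** * Calculus: chain rules, Jacobi's formula, symmetry of second derivatives *)

(** The two difference quotients are the same function of h, so derivability transfers as an
    equality of propositions, without differentiability of F. *)
Lemma derive_comp_affine {R : realType} {V V' : normedModType R}
    (L : V -> V') (F : V' -> R) (p v : V) (w : V') :
  (forall h : R, L (h *: v + p) = h *: w + L p) ->
  ('D_v (fun q => F (L q)) p = 'D_w F (L p)) *
  (derivable (fun q => F (L q)) p v = derivable F (L p) w).
Proof.
move=> Llin; rewrite /derive /derivable.
suff -> : (fun h : R => h^-1 *: (((fun q => F (L q)) \o shift p) (h *: v) - F (L p)))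
  = (fun h : R => h^-1 *: ((F \o shift (L p)) (h *: w) - F (L p))) by [].
by apply: funext => h /=; rewrite Llin.
Qed.

Lemma derive_partial {R : realType} {n : nat} (F : 'cV[R]_n -> R) (p X : 'cV[R]_n) :
  differentiable F p -> 'D_X F p = \sum_i X i 0 * partial i F p.
Proof.
move=> dF; rewrite deriveE//.
have -> : X = \sum_i X i 0 *: dvec i.
  apply/matrixP => i j; rewrite (ord1 j) summxE (bigD1 i)//= big1 ?addr0.
    by rewrite !mxE !eqxx mulr1.
  by move=> k ki; rewrite !mxE eq_sym (negbTE ki) mulr0.
rewrite linear_sum; apply: eq_bigr => i _.
rewrite linearZ/= /partial deriveE//; congr (_ * _).
rewrite summxE (bigD1 i)//= big1 ?addr0 ?mxE ?eqxx ?mulr1//.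
by move=> k ki; rewrite !mxE eq_sym (negbTE ki) mulr0.
Qed.

Lemma is_derive_curve {R : realType} {n : nat} (F : 'cV[R]_n -> R)
    (c : R -> 'cV[R]_n) (s : R) :
  derivable c s 1 -> differentiable F (c s) ->
  is_derive s 1 (fun r => F (c r)) ('D_(derive1 c s) F (c s)).
Proof.
move=> dc dF; have dc' : differentiable c s by exact/derivable1_diffP.
have dFc : differentiable (F \o c) s by exact: differentiable_comp.
apply: DeriveDef; first exact: diff_derivable.
rewrite (_ : (fun r => F (c r)) = F \o c)// deriveE// diff_comp//= derive1E'//.
by rewrite deriveE.
Qed.

Lemma is_derive_mx {R : realType} {V : normedModType R} {m n : nat}
    (M : V -> 'M[R]_(m, n)) (x v : V) (dM : 'M[R]_(m, n)) (i : 'I_m) (j : 'I_n) :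
  is_derive x v M dM -> is_derive x v (fun y => M y i j) (dM i j).
Proof.
move=> [dMx <-]; apply: DeriveDef; first exact: (derivable_mxP _ _ _).1.
by rewrite derive_mx// mxE.
Qed.

Lemma eq_of_derive0 {R : realType} (h : R -> R) :
  (forall s : R, 0 <= s <= 1 -> is_derive s 1 h 0) -> h 1 = h 0.
Proof.
move=> h0; have dh (x : R) : x \in `]0, 1[%R -> is_derive x 1 h 0.
  by rewrite in_itv/= => /andP[x0 x1]; apply: h0; rewrite !ltW.
have ch : {within `[0 : R, 1 : R], continuous h}.
  apply: derivable_within_continuous => x; rewrite in_itv/= => x01.
  by have [] := h0 _ x01.
have [c _ /eqP] := MVT (@ltr01 R) dh ch.
by rewrite mul0r subr_eq0 => /eqP.
Qed.

(** The omitted factor is selected by its index, [j != i], which is the product rule only when no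
    index is repeated. *)
Lemma is_derive_prod {R : realType} {V : normedModType R} {I : eqType} (r : seq I)
    (F : I -> V -> R) (dF : I -> R) (x v : V) :
  uniq r -> (forall i, is_derive x v (F i) (dF i)) ->
  is_derive x v (fun y => \prod_(i <- r) F i y)
    (\sum_(i <- r) dF i * \prod_(j <- r | j != i) F j x).
Proof.
move=> + dFi; elim: r => [|i r IH] /=.
  move=> _; rewrite big_nil (_ : (fun _ => _) = cst 1).
    exact: is_derive_cst.
  by apply: funext => y; rewrite big_nil.
move=> /andP[ir /IH {}IH].
rewrite (_ : (fun _ => _) = F i * (fun y => \prod_(i <- r) F i y)); last first.
  by apply: funext => y; rewrite big_cons.
apply: is_derive_eq; rewrite big_cons big_cons eqxx/= addrC; congr (_ + _).
  rewrite [LHS]mulrC; congr (_ * _); rewrite big_seq [RHS]big_seq_cond.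
  apply: eq_bigl => j; case jr : (j \in r) => //=.
  by apply/esym; apply: contraNneq ir => <-.
rewrite [LHS]big_distrr/= big_seq [RHS]big_seq.
apply: eq_bigr => j jr; rewrite big_cons ifT; first by rewrite [LHS]mulrCA.
by apply: contraNneq ir => ->.
Qed.

(** The i-th diagonal entry of the product is the Laplace expansion along row i of B with that row
    replaced by the row of A. *)
Lemma tr_mul_adj {R : comPzRingType} {n : nat} (A B : 'M[R]_n) :
  \tr (A *m \adj B) =
  \sum_i \det (\matrix_(k, l) if k == i then A k l else B k l).
Proof.
apply: eq_bigr => i _; rewrite mxE (expand_det_row _ i).
apply: eq_bigr => j _; rewrite !mxE eqxx; congr (_ * (_ * \det _)).
by apply/matrixP => k l; rewrite !mxE eq_sym (negbTE (neq_lift _ _)).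
Qed.

Lemma is_derive_bigsum {R : realType} {V W : normedModType R} {I : Type} (r : seq I)
    (P : pred I) (F : I -> V -> W) (dF : I -> W) (x v : V) :
  (forall i, is_derive x v (F i) (dF i)) ->
  is_derive x v (fun y => \sum_(i <- r | P i) F i y) (\sum_(i <- r | P i) dF i).
Proof.
move=> dFi; elim: r => [|i r IH].
  rewrite big_nil (_ : (fun _ => _) = cst 0); first exact: is_derive_cst.
  by apply: funext => y; rewrite big_nil.
rewrite big_cons; case: ifP => Pi.
  rewrite (_ : (fun _ => _) = F i + (fun y => \sum_(i <- r | P i) F i y)).
    exact: is_deriveD.
  by apply: funext => y; rewrite big_cons Pi.
rewrite (_ : (fun _ => _) = (fun y => \sum_(i <- r | P i) F i y))//.
by apply: funext => y; rewrite big_cons Pi.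
Qed.

(** Jacobi's formula: the product rule in the Leibniz expansion replaces one row at a time by its
    derivative, and [tr_mul_adj] collects the resulting determinants. *)
Lemma is_derive_det {R : realType} {V : normedModType R} {n : nat}
    (M : V -> 'M[R]_n) (dM : 'M[R]_n) (x v : V) :
  (forall i j, is_derive x v (fun y => M y i j) (dM i j)) ->
  is_derive x v (fun y => \det (M y)) (\tr (dM *m \adj (M x))).
Proof.
move=> dMij; rewrite tr_mul_adj /determinant exchange_big/=.
apply: is_derive_bigsum => s; rewrite -big_distrr/=.
have : is_derive x v (fun y => \prod_i M y i (s i))
    (\sum_i dM i (s i) * \prod_(j | j != i) M x j (s j)).
  have dMs i : is_derive x v (fun y => M y i (s i)) (dM i (s i)) by exact: dMij.
  exact: is_derive_prod (index_enum_uniq 'I_n) dMs.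
move=> /(is_deriveZ ((-1) ^+ s)) dprod; apply: is_derive_eq; congr (_ *: _).
apply: eq_bigr => i _; rewrite [RHS](bigD1 i)//= mxE eqxx; congr (_ * _).
by apply: eq_bigr => j ji; rewrite mxE (negbTE ji).
Qed.

(** The mean value theorem is applied twice: along u to the increment of F in the direction hv, then
    along v to the derivative ['D_u F]. *)
Lemma second_difference {R : realType} {V : normedModType R} (F : V -> R)
    (p u v : V) (h : R) :
  0 < h ->
  (forall s r : R, 0 <= s <= h -> 0 <= r <= h ->
     derivable F (p + s *: u + r *: v) u /\
     derivable ('D_u F) (p + s *: u + r *: v) v) ->
  exists s r : R, [/\ 0 <= s <= h, 0 <= r <= h &
    F (p + h *: u + h *: v) - F (p + h *: u) - F (p + h *: v) + F p
      = h ^+ 2 * 'D_v ('D_u F) (p + s *: u + r *: v)].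
Proof.
move=> h0 dF.
have hh : 0 <= h <= h by rewrite lexx ltW.
have h00 : 0 <= (0 : R) <= h by rewrite lexx ltW.
have line (G : V -> R) (q w : V) (s : R) : derivable G (q + s *: w) w ->
    is_derive s 1 (fun t : R => G (q + t *: w)) ('D_w G (q + s *: w)).
  move=> dG; have aff (t : R) : q + (t *: 1 + s) *: w = t *: w + (q + s *: w).
    by rewrite scalerDl -[t *: 1]/(t * 1) mulr1 addrCA.
  have [e1 e2] := derive_comp_affine (fun t : R => q + t *: w) G _ _ _ aff.
  by apply: DeriveDef; rewrite ?e1 ?e2.
pose phi (t : R) := F (p + h *: v + t *: u) - F (p + t *: u).
pose dphi (t : R) := 'D_u F (p + h *: v + t *: u) - 'D_u F (p + t *: u).
have phiE (t : R) : 0 <= t <= h -> is_derive t 1 phi (dphi t).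
  move=> th; apply: is_deriveB; apply: line.
    by rewrite addrAC; exact: (dF _ _ th hh).1.
  by have := (dF _ _ th h00).1; rewrite scale0r addr0.
have [s s_in phis] : exists2 s, s \in `]0, h[%R & phi h - phi 0 = dphi s * (h - 0).
  have dphi' (x : R) : x \in `]0, h[%R -> is_derive x 1 phi (dphi x).
    by rewrite in_itv/= => /andP[x0 xh]; apply: phiE; rewrite !ltW.
  have cphi : {within `[0 : R, h], continuous phi}.
    apply: derivable_within_continuous => x; rewrite in_itv/= => x0h.
    by have [] := phiE _ x0h.
  exact: (MVT h0 dphi' cphi).
have sh : 0 <= s <= h by move: s_in; rewrite in_itv/= => /andP[? ?]; rewrite !ltW.
pose psi (t : R) := 'D_u F (p + s *: u + t *: v).
pose dpsi (t : R) := 'D_v ('D_u F) (p + s *: u + t *: v).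
have psiE (t : R) : 0 <= t <= h -> is_derive t 1 psi (dpsi t).
  by move=> th; apply: (line ('D_u F)); exact: (dF _ _ sh th).2.
have [r r_in psir] : exists2 r, r \in `]0, h[%R & psi h - psi 0 = dpsi r * (h - 0).
  have dpsi' (x : R) : x \in `]0, h[%R -> is_derive x 1 psi (dpsi x).
    by rewrite in_itv/= => /andP[x0 xh]; apply: psiE; rewrite !ltW.
  have cpsi : {within `[0 : R, h], continuous psi}.
    apply: derivable_within_continuous => x; rewrite in_itv/= => x0h.
    by have [] := psiE _ x0h.
  exact: (MVT h0 dpsi' cpsi).
have rh : 0 <= r <= h by move: r_in; rewrite in_itv/= => /andP[? ?]; rewrite !ltW.
exists s, r; split => //.
have -> : F (p + h *: u + h *: v) - F (p + h *: u) - F (p + h *: v) + F p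
    = phi h - phi 0.
  by rewrite /phi !scale0r !addr0 (addrAC p) opprB addrA addrAC (addrAC _ (F p)).
rewrite phis subr0 -/(dpsi r).
have -> : dphi s = psi h - psi 0.
  by rewrite /dphi /psi scale0r addr0 (addrAC p).
by rewrite psir subr0 expr2 mulrC mulrA mulrAC -mulrA.
Qed.

(** The second difference is symmetric in u and v, so the two mixed derivatives take a common value
    at two points arbitrarily close to p; continuity brings both to p. *)
Lemma schwarz {R : realType} {V : normedModType R} (F : V -> R) (p u v : V) :
  (\forall q \near p, derivable F q u) -> (\forall q \near p, derivable F q v) ->
  (\forall q \near p, derivable ('D_u F) q v) ->
  (\forall q \near p, derivable ('D_v F) q u) ->
  {for p, continuous ('D_v ('D_u F))} -> {for p, continuous ('D_u ('D_v F))} ->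
  'D_v ('D_u F) p = 'D_u ('D_v F) p.
Proof.
have dist (e a b c : R) : `|a - c| <= e / 2 -> `|b - c| <= e / 2 -> `|a - b| <= e.
  move=> ac bc; rewrite (splitr e) (le_trans (ler_distD c a b))// lerD//.
  by rewrite distrC.
move=> du dv duv dvu cuv cvu; apply/eqP; rewrite -subr_eq0 -normr_le0.
apply/ler_addgt0Pl => e e0; rewrite addr0.
have e2 : 0 < e / 2 by rewrite divr_gt0.
have near_uv : \forall q \near p, `|'D_v ('D_u F) p - 'D_v ('D_u F) q| <= e / 2.
  by move/cvgrPdist_le : cuv => /(_ _ e2).
have near_vu : \forall q \near p, `|'D_u ('D_v F) p - 'D_u ('D_v F) q| <= e / 2.
  by move/cvgrPdist_le : cvu => /(_ _ e2).
have H : nbhs p ((derivable F ^~ u `&` derivable F ^~ v)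
     `&` (derivable ('D_u F) ^~ v `&` derivable ('D_v F) ^~ u)
     `&` ((fun q : V => `|'D_v ('D_u F) p - 'D_v ('D_u F) q| <= e / 2)
          `&` (fun q : V => `|'D_u ('D_v F) p - 'D_u ('D_v F) q| <= e / 2))).
  exact (filterI (filterI (filterI du dv) (filterI duv dvu)) (filterI near_uv near_vu)).
have [/= d d0 Hd] := (nbhs_ballP _ _).1 H.
(* With this h every p + su + rv with s, r in [0, h] lies at distance less than d from p; the
   summand 1 keeps the denominator positive when u and v vanish. *)
pose h := d / (2 * (1 + `|u| + `|v|)).
have k0 : 0 < 1 + `|u| + `|v| by rewrite -addrA ltr_pwDl ?addr_ge0.
have h0 : 0 < h by rewrite divr_gt0 ?mulr_gt0.
have small (s r : R) : 0 <= s <= h -> 0 <= r <= h -> ball p d (p + s *: u + r *: v).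
  move=> /andP[s0 sh] /andP[r0 rh].
  rewrite -ball_normE/= -addrA opprD addNKr normrN.
  apply: (le_lt_trans (ler_normD _ _)); rewrite !normrZ !ger0_norm//.
  apply: (@le_lt_trans _ _ (h * (1 + `|u| + `|v|))).
    rewrite mulrDr mulrDr mulr1 -addrA; apply: ler_wpDl; first exact: ltW.
    by apply: lerD; apply: ler_wpM2r.
  rewrite /h invfM mulrA -mulrA mulVf ?gt_eqF// mulr1 ltr_pdivrMr// mulr_natr mulr2n.
  by rewrite ltrDl.
have [s [r [sh rh E1]]] : exists s r : R, [/\ 0 <= s <= h, 0 <= r <= h &
    F (p + h *: u + h *: v) - F (p + h *: u) - F (p + h *: v) + F p
      = h ^+ 2 * 'D_v ('D_u F) (p + s *: u + r *: v)].
  apply: (second_difference F p u v h h0) => s r sh rh.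
  by have [[[Hu _] [Huv _]] _] := Hd _ (small _ _ sh rh); split.
have [s' [r' [sh' rh' E2]]] : exists s r : R, [/\ 0 <= s <= h, 0 <= r <= h &
    F (p + h *: v + h *: u) - F (p + h *: v) - F (p + h *: u) + F p
      = h ^+ 2 * 'D_u ('D_v F) (p + s *: v + r *: u)].
  apply: (second_difference F p v u h h0) => s' r' sh' rh'.
  by have [[[_ Hv] [_ Hvu]] _] := Hd _ (small _ _ rh' sh'); rewrite addrAC; split.
have E : 'D_v ('D_u F) (p + s *: u + r *: v) = 'D_u ('D_v F) (p + s' *: v + r' *: u).
  have h2 : h ^+ 2 != 0 by rewrite expf_neq0// gt_eqF.
  rewrite (addrAC p (h *: v)) (addrAC _ (- F (p + h *: v))) E1 in E2.
  exact: (mulfI h2 E2).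
have [_ [b1 _]] := Hd _ (small _ _ sh rh).
have [_ [_ b2]] := Hd _ (small _ _ rh' sh').
rewrite (addrAC p) -E in b2.
exact: (dist _ _ _ _ b1 b2).
Qed.

(** * Determinantal forms and null splittings *)

Lemma tr_mul_adj_col {R : comPzRingType} {n : nat} (A B : 'M[R]_n) :
  \tr (A *m \adj B) =
  \sum_j \det (\matrix_(k, l) if l == j then A k l else B k l).
Proof.
rewrite -mxtrace_tr trmx_mul trmx_adj mxtrace_mulC tr_mul_adj.
by apply: eq_bigr => j _; rewrite -det_tr; congr (\det _); apply/matrixP => k l; rewrite !mxE.
Qed.

Definition cols {R : realType} {m k : nat} (v : 'I_k -> 'cV[R]_m) : 'M[R]_(m, k) :=
  \matrix_(i, j) v j i 0.

Definition det_form {R : realType} {m k : nat} (n : 'M[R]_(k, m)) : kform R m k :=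
  fun v => \det (n *m cols v).

Lemma mul_cols {R : realType} {m k l : nat} (A : 'M[R]_(l, m)) (v : 'I_k -> 'cV[R]_m) :
  A *m cols v = cols (fun j => A *m v j).
Proof.
by apply/matrixP => i j; rewrite !mxE; apply: eq_bigr => l' _; rewrite mxE.
Qed.

(** With the chosen convention, [wedge1] is the Laplace expansion along the first row of the matrix
    of values of the covectors. *)
Lemma wedges_det {R : realType} {m : nat} (s : seq 'rV[R]_m)
    (v : 'I_(size s) -> 'cV[R]_m) :
  wedges s v = det_form (\matrix_(i < size s) nth 0 s i) v.
Proof.
rewrite /det_form; elim: s v => [|a s IH] v; first by rewrite det_mx00.
rewrite -[LHS]/(wedge1 a (wedges s) v) /wedge1 (expand_det_row _ ord0).
apply: eq_bigr => i _.
rewrite /cofactor add0n IH [RHS]mulrCA [RHS]mulrA; congr (_ * _).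
  by congr (_ * _); rewrite !mxE; apply: eq_bigr => l _; rewrite !mxE.
congr (\det _); apply/matrixP => k l; rewrite !mxE; apply: eq_bigr => j _.
by rewrite !mxE.
Qed.

Lemma det_form_mull {R : realType} {m k : nat} (T : 'M[R]_k) (n : 'M[R]_(k, m)) v :
  det_form (T *m n) v = \det T * det_form n v.
Proof. by rewrite /det_form -mulmxA det_mulmx. Qed.

Lemma sum_det_form_subst {R : realType} {m k : nat} (n : 'M[R]_(k, m)) (A : 'M[R]_m) v :
  \sum_i det_form n (subst_arg v i (A *m v i)) =
  \tr (n *m A *m cols v *m \adj (n *m cols v)).
Proof.
rewrite tr_mul_adj_col; apply: eq_bigr => j _; congr (\det _).
apply/matrixP => k' l; rewrite -(mulmxA n A) (mul_cols A) !(mul_cols n) !mxE /subst_arg.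
by case: (l =P j) => [->|]; rewrite ?mxE.
Qed.

(** Stacked, [n] and [v] form an orthogonal matrix. For coordinate projections, [n^T] and [v^T] are
    the inclusions of the even and the odd directions, and inserting the last identity cuts a matrix
    into blocks. *)
Definition splitting {R : realType} {k m : nat} (n v : 'M[R]_(k, m)) :=
  [/\ n *m n^T = 1%:M, v *m v^T = 1%:M, n *m v^T = 0 & n^T *m n + v^T *m v = 1%:M].

(** An endomorphism that descends through n acts on the determinant of the quotient by its trace
    there. *)
Lemma sum_det_form_scalar {R : realType} {m k : nat} (n : 'M[R]_(k, m)) (A : 'M[R]_m)
    (A' : 'M[R]_k) v :
  n *m A = A' *m n ->
  \sum_i det_form n (subst_arg v i (A *m v i)) = \tr A' * det_form n v.
Proof.
move=> nA; rewrite sum_det_form_subst nA -(mulmxA A') -mulmxA mul_mx_adj.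
by rewrite mul_mx_scalar mxtraceZ mulrC.
Qed.

(* Evaluate the hypothesis on the columns of [n^T + v^T Y], on which [n] is the
   identity, so that the adjugate disappears. *)
Lemma stab_det_form {R : realType} {m k : nat} (n v : 'M[R]_(k, m)) (A : 'M[R]_m) :
  splitting n v ->
  stab_of (det_form n) A <-> exists2 A', n *m A = A' *m n & \tr A' = 0.
Proof.
move=> [nn vv nv nvE]; split; last first.
  move=> [A' nA trA'] w; rewrite (sum_det_form_scalar _ _ _ _ nA) trA' mul0r //.
move=> stabA.
have trY (Y : 'M[R]_k) : \tr (n *m A *m n^T) + \tr (n *m A *m v^T *m Y) = 0.
  have := stabA (fun j => col j (n^T + v^T *m Y)).
  rewrite sum_det_form_subst.
  have -> : cols (fun j => col j (n^T + v^T *m Y)) = n^T + v^T *m Y.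
    by apply/matrixP => i j; rewrite !mxE.
  rewrite [n *m (_ + _)]mulmxDr nn mulmxA nv mul0mx addr0.
  rewrite (_ : \adj 1%:M = 1%:M) ?mulmx1 ?mulmxDr ?mxtraceD ?mulmxA//.
  by rewrite -[LHS]mul1mx mul_mx_adj det1.
have tr0 : \tr (n *m A *m n^T) = 0 by rewrite -[RHS](trY 0) mulmx0 mxtrace0 addr0.
have nAv : n *m A *m v^T = 0.
  move: trY; rewrite tr0; move: (n *m A *m v^T) => Z trZ.
  apply/matrixP => i j; rewrite [RHS]mxE -(trZ (delta_mx j i)) add0r.
  rewrite /mxtrace (bigD1 i)//= big1 ?addr0 => [|l li].
    rewrite mxE (bigD1 j)//= big1 ?addr0 => [|l lj]; rewrite mxE ?eqxx ?mulr1//.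
    by rewrite (negbTE lj) mulr0.
  by rewrite mxE big1// => l' _; rewrite mxE (negbTE li) andbF mulr0.
exists (n *m A *m n^T) => //.
by rewrite -[LHS]mulmx1 -nvE mulmxDr !mulmxA nAv mul0mx addr0.
Qed.

(** This is Cramer's rule: with the arguments after X lifted from the columns of a matrix B, the
    value is the first entry of adj B applied to nX. *)
Lemma interior_det_form {R : realType} {m k : nat} (n : 'M[R]_(k.+1, m)) (X : 'cV[R]_m) :
  n *m n^T = 1%:M ->
  (forall v, Defs.interior X (det_form n) v = 0) <-> n *m X = 0.
Proof.
move=> nn; have intE v B : (forall j, n *m v j = col (lift ord0 j) B) ->
    Defs.interior X (det_form n) v = (\adj B *m (n *m X)) ord0 0.
  move=> nv; rewrite /Defs.interior /det_form mul_cols (expand_det_col _ ord0) [RHS]mxE.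
  apply: eq_bigr => i _; rewrite !mxE unlift_none mulrC; congr (_ * \det _ * _).
    apply/matrixP => i' j'; rewrite !mxE liftK; have := nv j'.
    by move=> /(congr1 (fun u : 'cV[R]_k.+1 => u (lift i i') 0)); rewrite !mxE.
split=> [intX|nX v]; last first.
  by rewrite (intE v (cols (fun i => if unlift ord0 i is Some j then n *m v j else 0)))
    ?nX ?mulmx0 ?mxE// => j; apply/matrixP => a b; rewrite !mxE liftK (ord1 b) mxE.
apply/matrixP => i j; rewrite (ord1 j) [RHS]mxE.
(* The transposition matrix is its own inverse, so its adjugate is plus or minus itself, and the
   first entry of its product with nX is the i-th entry of nX. *)
pose B : 'M[R]_k.+1 := tperm_mx i ord0.
have := intX (fun j => n^T *m col (lift ord0 j) B).
rewrite (intE _ B) => [|j']; last by rewrite mulmxA nn mul1mx.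
have -> : \adj B = \det B *: B.
  have BB : B *m B = 1%:M by rewrite -perm_mxM tperm2 perm_mx1.
  by rewrite -[\adj B]mulmx1 -BB mulmxA mul_adj_mx mul_scalar_mx.
rewrite -scalemxAl mxE => /eqP; rewrite mulf_eq0 det_perm signr_eq0/=.
by rewrite /B -xrowE mxE tpermR => /eqP.
Qed.

(** In blocks (even, odd), G is (S, M^T; M, 0) and its inverse is (0, Mi; Mi^T, -Mi^T S Mi). Only
    the mixed block M has to be inverted. *)
Lemma null_splitting_inverse {R : realType} {m k : nat} (n v : 'M[R]_(k, m))
    (G : 'M[R]_m) (Mi : 'M[R]_k) :
  splitting n v -> G^T = G -> v *m G *m v^T = 0 -> v *m G *m n^T *m Mi = 1%:M ->
  (G \in unitmx) * (invmx G = n^T *m Mi *m v + v^T *m Mi^T *m n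
    - v^T *m Mi^T *m (n *m G *m n^T) *m Mi *m v).
Proof.
move=> [nn vv nv nvE] Gsym vGv MMi.
have MiM := mulmx1C MMi.
have MtMit : n *m G *m v^T *m Mi^T = 1%:M.
  by rewrite -[RHS]trmx1 -MiM !trmx_mul !trmxK Gsym !mulmxA.
have Gn : G *m n^T = n^T *m (n *m G *m n^T) + v^T *m (v *m G *m n^T).
  by rewrite -[LHS]mul1mx -nvE mulmxDl !mulmxA.
have Gv : G *m v^T = n^T *m (n *m G *m v^T).
  by rewrite -[LHS]mul1mx -nvE mulmxDl -!mulmxA (mulmxA v) vGv mulmx0 addr0.
have GH : G *m (n^T *m Mi *m v + v^T *m Mi^T *m n
    - v^T *m Mi^T *m (n *m G *m n^T) *m Mi *m v) = 1%:M.
  rewrite mulmxBr mulmxDr !(mulmxA G) Gn Gv.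
  move: (n *m G *m n^T) (v *m G *m n^T) (n *m G *m v^T) MMi MtMit => S M M' MMi MtMit.
  rewrite -!(mulmxA n^T M') !MtMit mulmx1.
  rewrite !mulmxDl -!(mulmxA v^T) MMi mul1mx addrAC -[RHS]nvE addrC -!mulmxA.
  by congr (_ + _); rewrite addrC addKr.
have [Gu _] := mulmx1_unit GH; split=> //.
by rewrite -[LHS]mulmx1 -GH mulKmx.
Qed.

(** The even-even block of the inverse vanishes, so raising an index to an even one uses odd lower
    indices only. *)
Lemma null_splitting_mul_inv {R : realType} {m k : nat} (n v : 'M[R]_(k, m))
    (G : 'M[R]_m) (Mi : 'M[R]_k) :
  splitting n v -> G^T = G -> v *m G *m v^T = 0 -> v *m G *m n^T *m Mi = 1%:M ->
  n *m invmx G = Mi *m v.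
Proof.
move=> nvs Gsym vGv MMi; rewrite (null_splitting_inverse _ _ _ _ nvs Gsym vGv MMi).
have [nn vv nv _] := nvs.
by rewrite mulmxBr mulmxDr !mulmxA nn nv !mul0mx subr0 addr0 mul1mx.
Qed.

(** The odd directions are completed by the vectors [n^T *m Mi], which are dual to them under G, and
    then corrected inside the odd space. *)
Lemma adapted_basis_exists {R : realType} (n v : 'M[R]_(4, 6 + 2))
    (G : 'M[R]_(6 + 2)) (Mi : 'M[R]_4) (V : set 'cV[R]_(6 + 2)) :
  splitting n v -> G^T = G -> v *m G *m v^T = 0 -> v *m G *m n^T *m Mi = 1%:M ->
  (forall X, V X <-> n *m X = 0) ->
  exists B, adapted_basis G V B.
Proof.
move=> [nn vv nv nvE] Gsym vGv MMi VE.
(* The vectors [n^T *m Mi] have Gram matrix Mi^T S Mi. Adding [v^T *m Y] adds Y + Y^T = 2Y to it,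
   hence the factor -1/2 that makes the second half null. *)
pose S := n *m G *m n^T; pose Y := - (2%:R^-1 *: (Mi^T *m S *m Mi)).
exists (row_mx v^T (n^T *m Mi + v^T *m Y)); split; last first.
  move=> X; rewrite VE row_mxKl; split=> [nX|[c ->]].
    by exists (v *m X); rewrite mulmxA -[LHS]mul1mx -nvE mulmxDl -!mulmxA nX mulmx0 add0r.
  by rewrite mulmxA nv mul0mx.
have Yt : Y^T = Y.
  by rewrite /Y linearN linearZ/= /S !trmx_mul !trmxK Gsym !mulmxA.
have vGF : v *m G *m (n^T *m Mi + v^T *m Y) = 1%:M.
  by rewrite mulmxDr !mulmxA vGv mul0mx addr0.
have FGv : (n^T *m Mi + v^T *m Y)^T *m G *m v^T = 1%:M.
  rewrite -[RHS]trmx1 -vGF; move: (n^T *m Mi + v^T *m Y) => F.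
  by rewrite !trmx_mul Gsym mulmxA.
rewrite tr_row_mx mul_col_mx mul_col_row trmxK vGv vGF FGv /J44; congr block_mx.
rewrite mulmxDr (mulmxA _ v^T) FGv mul1mx linearD/= !trmx_mul !trmxK Yt.
have -> : (Mi^T *m n + Y *m v) *m G *m (n^T *m Mi) = Mi^T *m S *m Mi + Y.
  rewrite !mulmxDl /S !mulmxA; congr (_ + _).
  by rewrite -[RHS]mulmx1 -MMi !mulmxA.
rewrite -addrA -mulr2n /Y mulNrn -scaler_nat scalerA mulfV ?pnatr_eq0// scale1r.
exact: subrr.
Qed.

(** Here n B = (0 | K) with K invertible. An endomorphism that descends through n is therefore block
    upper triangular, and its quotient A' is conjugate to the lower right block, which is -X^T by
    skewness for G; so tr A' = 0 means tr X = 0. *)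
Lemma in_adapted_basis {R : realType} (n v : 'M[R]_(4, 6 + 2)) (G : 'M[R]_(6 + 2))
    (V : set 'cV[R]_(6 + 2)) (B : 'M[R]_(6 + 2, 4 + 4)) :
  splitting n v -> (forall X, V X <-> n *m X = 0) -> adapted_basis G V B ->
  in_basis B (so_of G `&` stab_of (det_form n)) = sl4_Lambda4.
Proof.
move=> nvs VE [BGB VB]; have [nn vv nv nvE] := nvs.
have JJ : (J44 : 'M[R]_(4 + 4)) *m J44 = 1%:M.
  by rewrite /J44 mulmx_block !mul0mx !mulmx0 !mulmx1 !addr0 !add0r -scalar_mx_block.
have [Bi BiB] : exists Bi : 'M[R]_(4 + 4, 6 + 2), Bi *m B = 1%:M.
  by exists (J44 *m B^T *m G); rewrite -(mulmxA _ B^T) -mulmxA BGB.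
(* Both 6 + 2 and 4 + 4 compute to 8, so B is square up to conversion and its left inverse is a
   right inverse. *)
have BBi : B *m Bi = 1%:M by exact: (@mulmx1C R 8 Bi B BiB).
pose K := n *m rsubmx B.
have nB : n *m B = row_mx 0 K.
  rewrite -[B in LHS]hsubmxK mul_mx_row; congr row_mx.
  apply/matrixP => i j; rewrite [RHS]mxE.
  have nBj : n *m lsubmx B *m (delta_mx j 0 : 'cV_4) = 0.
    by rewrite -mulmxA; apply/VE/VB; exists (delta_mx j 0).
  by have := congr1 (fun u : 'cV_4 => u i 0) nBj; rewrite -colE mxE [RHS]mxE.
pose L := dsubmx (Bi *m n^T).
have KL : K *m L = 1%:M.
  transitivity (n *m B *m Bi *m n^T); last by rewrite -(mulmxA n) BBi mulmx1.
  by rewrite nB -mulmxA -[Bi *m _]vsubmxK mul_row_col mul0mx add0r.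
have LK := mulmx1C KL.
have soE A M : A *m B = B *m M -> so_of G A <-> so_of J44 M.
  move=> AB; have eB : B^T *m (A^T *m G + G *m A) *m B = M^T *m J44 + J44 *m M.
    rewrite mulmxDr mulmxDl !mulmxA -trmx_mul AB trmx_mul -(mulmxA _ A) AB.
    by rewrite -(mulmxA M^T) -(mulmxA M^T) BGB mulmxA BGB.
  rewrite /so_of/= -eB; split=> [->|H]; first by rewrite mulmx0 mul0mx.
  have BiBt : Bi^T *m B^T = 1%:M by rewrite -trmx_mul BBi trmx1.
  move: H; move: (A^T *m G + G *m A) => N BNB.
  transitivity (Bi^T *m (B^T *m N *m B) *m Bi); last by rewrite BNB mulmx0 mul0mx.
  by rewrite !mulmxA BiBt mul1mx -mulmxA BBi mulmx1.
have soJ X Z Y T : so_of J44 (block_mx X Z Y T : 'M[R]_(4 + 4)) <->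
    [/\ Y + Y^T = 0, T = - X^T & Z + Z^T = 0].
  rewrite /so_of/J44/= tr_block_mx !mulmx_block !mul0mx !mulmx0 !mulmx1 !mul1mx.
  rewrite !addr0 !add0r add_block_mx -[0]block_mx0.
  split=> [/eq_block_mx[e1 e2 _ e4]|[e1 -> e4]].
    by split; [rewrite addrC|apply/eqP; rewrite -subr_eq0 opprK addrC; apply/eqP|rewrite addrC].
  by rewrite [Y^T + _]addrC e1 subrr [Z^T + _]addrC e4 [(- X^T)^T]linearN/= trmxK addNr.
rewrite eqEsubset; split=> M.
  move=> [A [soA stA] AB]; move: (soE _ _ AB).1 => /(_ soA).
  rewrite -[M]submxK => /soJ[Y0 T0 Z0].
  have [A' nA trA'] := (stab_det_form _ _ _ nvs).1 stA.
  have := congr1 (fun N => n *m N) AB; rewrite mulmxA nA -mulmxA nB mulmxA nB.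
  rewrite -[M]submxK mul_mx_row mul_row_block mulmx0 !mul0mx !add0r => /eq_row_mx[KY KT].
  exists (ulsubmx M), (ursubmx M); split => //.
    have trT : \tr (drsubmx M) = - \tr (ulsubmx M) by rewrite T0 linearN/= mxtrace_tr.
    apply/eqP; rewrite /sl4/= -oppr_eq0 -trT -[drsubmx M]mul1mx -LK -mulmxA -KT.
    by rewrite mxtrace_mulC -mulmxA KL mulmx1 trA'.
  have dl0 : dlsubmx M = 0 by rewrite -[dlsubmx M]mul1mx -LK -mulmxA -KY mulmx0.
  by rewrite -T0 -dl0 submxK.
move=> [X [Z [trX ZZ ->]]].
have AB : B *m block_mx X Z 0 (- X^T) *m Bi *m B = B *m block_mx X Z 0 (- X^T).
  by rewrite -mulmxA BiB mulmx1.
exists (B *m block_mx X Z 0 (- X^T) *m Bi) => //; split.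
  by apply/(soE _ _ AB)/soJ; split => //; rewrite trmx0 addr0.
apply/(stab_det_form _ _ _ nvs); exists (K *m (- X^T) *m L).
  rewrite !mulmxA nB -[RHS]mulmx1 -BBi [RHS]mulmxA -(mulmxA (_ *m L)) nB.
  rewrite mul_row_block mul_mx_row !mul0mx !mulmx0 !add0r; congr (row_mx _ _ *m _).
  by rewrite -mulmxA LK mulmx1.
by rewrite mxtrace_mulC mulmxA LK mul1mx linearN/= mxtrace_tr trX oppr0.
Qed.

(** * The Levi-Civita connection and holonomy *)

(** The Christoffel symbols of the first kind, contracted with X: the lower index l is the row, so
    that lifting it by the inverse metric gives [conn_mx]. *)
Definition first_kind {R : realType} {m : nat} (g : 'cV[R]_m -> 'M[R]_m)
    (p X : 'cV[R]_m) : 'M[R]_m :=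
  \matrix_(l, j) (2%:R^-1 * \sum_i X i 0 *
    (partial i (fun q => g q l j) p + partial j (fun q => g q l i) p
     - partial l (fun q => g q i j) p)).

Lemma conn_mxE {R : realType} {m : nat} (g : 'cV[R]_m -> 'M[R]_m) (p X : 'cV[R]_m) :
  conn_mx g p X = invmx (g p) *m first_kind g p X.
Proof.
apply/matrixP => k j; rewrite !mxE; under eq_bigr do rewrite /christoffel mulrCA.
rewrite -big_distrr/=; under [RHS]eq_bigr do rewrite mxE mulrCA.
rewrite -big_distrr/=; congr (_ * _).
under eq_bigr do rewrite big_distrr/=.
rewrite exchange_big/=; apply: eq_bigr => l _; rewrite big_distrr/=.
by apply: eq_bigr => i _; rewrite mulrCA.
Qed.

(** Metric compatibility with the index lowered: in the sum of the two symbols all derivatives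
    cancel except the one along X. *)
Lemma first_kind_sym {R : realType} {m : nat} (g : 'cV[R]_m -> 'M[R]_m) (p X : 'cV[R]_m) :
  (\forall q \near p, (g q)^T = g q) ->
  (first_kind g p X)^T + first_kind g p X =
  \matrix_(i, j) \sum_k X k 0 * partial k (fun q => g q i j) p.
Proof.
move=> gsym; have psym k i j : partial k (fun q => g q i j) p = partial k (fun q => g q j i) p.
  rewrite /partial; apply: near_eq_derive; move: gsym; apply: filterS => q gq.
  by rewrite -[in LHS]gq mxE.
apply/matrixP => i j; rewrite !mxE -mulrDr -big_split/= big_distrr/=.
apply: eq_bigr => k _; rewrite -mulrDr mulrCA; congr (_ * _).
rewrite (psym k j i) (psym i j k) (psym i k j) (psym j i k) (psym j k i).
by field.
Qed.

Lemma conn_mx_compat {R : realType} {m : nat} (g : 'cV[R]_m -> 'M[R]_m) (p X : 'cV[R]_m) :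
  (\forall q \near p, (g q)^T = g q) -> g p \in unitmx ->
  (forall i j, differentiable (fun q => g q i j) p) ->
  (conn_mx g p X)^T *m g p + g p *m conn_mx g p X =
  \matrix_(i, j) 'D_X (fun q => g q i j) p.
Proof.
move=> gsym gu dg.
have gp : (g p)^T = g p by exact: (nbhs_singleton gsym).
rewrite conn_mxE trmx_mul trmx_inv gp mulmxKV// mulKVmx// first_kind_sym//.
by apply/matrixP => i j; rewrite !mxE derive_partial.
Qed.

Lemma is_derive_mulmx {R : realType} {V : normedModType R} {a b c : nat}
    (A : V -> 'M[R]_(a, b)) (B : V -> 'M[R]_(b, c)) (dA : 'M[R]_(a, b))
    (dB : 'M[R]_(b, c)) (x v : V) :
  (forall i j, is_derive x v (fun y => A y i j) (dA i j)) ->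
  (forall i j, is_derive x v (fun y => B y i j) (dB i j)) ->
  forall i j, is_derive x v (fun y => (A y *m B y) i j) ((dA *m B x + A x *m dB) i j).
Proof.
move=> dAx dBx i j.
have -> : (fun y => (A y *m B y) i j) = (fun y => \sum_k A y i k * B y k j).
  by apply: funext => y; rewrite mxE.
rewrite !mxE -big_split/=; apply: is_derive_bigsum => k.
apply: is_derive_eq (is_deriveM (dAx i k) (dBx k j)) _.
by rewrite addrC; congr (_ + _); exact: mulrC.
Qed.

Lemma is_derive_trmx {R : realType} {V : normedModType R} {a b : nat}
    (A : V -> 'M[R]_(a, b)) (dA : 'M[R]_(a, b)) (x v : V) :
  (forall i j, is_derive x v (fun y => A y i j) (dA i j)) ->
  forall i j, is_derive x v (fun y => (A y)^T i j) (dA^T i j).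
Proof.
move=> dAx i j; rewrite mxE.
by have -> : (fun y => (A y)^T i j) = (fun y => A y j i) by apply: funext => y; rewrite mxE.
Qed.

(** The first quantity is constant because the connection is metric. In the second, Jacobi's formula
    differentiates the determinant to -tr A' times itself, which the derivative of w compensates.
    The free factor C lets the invariant compose along broken curves and accept arbitrary vectors as
    columns. *)
Lemma transport_along_invariant {R : realType} {m k : nat} (g : 'cV[R]_m -> 'M[R]_m)
    (U : set 'cV[R]_m) (n : 'M[R]_(k, m)) (w : 'cV[R]_m -> R)
    (c : R -> 'cV[R]_m) (F : R -> 'M[R]_m) :
  open U -> (forall p, U p -> (g p)^T = g p) -> (forall p, U p -> g p \in unitmx) ->
  (forall p i j, U p -> differentiable (fun q => g q i j) p) ->
  (forall p, U p -> differentiable w p) ->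
  (forall p X, U p -> exists2 A', n *m conn_mx g p X = A' *m n & 'D_X w p = w p * \tr A') ->
  C1_arc U c -> transport_along g c F ->
  (F 1)^T *m g (c 1) *m F 1 = g (c 0) /\
  forall C, w (c 1) * \det (n *m F 1 *m C) = w (c 0) * \det (n *m C).
Proof.
move=> Uo gsym gu dg dw nconn [cU _] [F0 dF].
have dFij (s : R) : 0 <= s <= 1 -> forall i j, is_derive s 1 (fun r => F r i j)
    ((- (conn_mx g (c s) (derive1 c s) *m F s)) i j).
  by move=> s01 i j; apply: is_derive_mx; exact: dF.
split.
  apply/matrixP => i j.
  have -> : g (c 0) i j = ((F 0)^T *m g (c 0) *m F 0) i j.
    by rewrite F0 trmx1 mul1mx mulmx1.
  apply: (eq_of_derive0 (fun s => ((F s)^T *m g (c s) *m F s) i j)) => s s01.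
  have [Ucs dcs] := cU _ s01.
  have dG i' j' : is_derive s 1 (fun r => g (c r) i' j')
      ((\matrix_(i, j) 'D_(derive1 c s) (fun q => g q i j) (c s)) i' j').
    by rewrite mxE; apply: (is_derive_curve (fun q => g q i' j')) => //; exact: dg.
  have := is_derive_mulmx _ _ _ _ _ _
    (is_derive_mulmx _ _ _ _ _ _ (is_derive_trmx _ _ _ _ (dFij _ s01)) dG) (dFij _ s01) i j.
  rewrite -conn_mx_compat; first last.
  - by move=> i' j'; exact: dg.
  - exact: gu.
  - by apply: filterS (open_nbhs_nbhs (conj Uo Ucs)) => q; exact: gsym.
  move=> H; apply: is_derive_eq H _.
  move: (conn_mx _ _ _) (g (c s)) (F s) => Gam G Fs.
  rewrite linearN/= trmx_mul mulmxN mulNmx mulmxDl !mulmxDr !mulmxA.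
  by rewrite !mulmxDl mulNmx addrA addNr add0r subrr mxE.
move=> C.
have -> : w (c 0) * \det (n *m C) = w (c 0) * \det (n *m F 0 *m C) by rewrite F0 mulmx1.
apply: (eq_of_derive0 (fun s => w (c s) * \det (n *m F s *m C))) => s s01.
have [Ucs dcs] := cU _ s01.
have dnFC : forall i j, is_derive s 1 (fun r => (n *m F r *m C) i j)
    ((n *m (- (conn_mx g (c s) (derive1 c s) *m F s)) *m C) i j).
  have dcst (a b : nat) (M : 'M[R]_(a, b)) i j :
      is_derive s 1 (fun r => M i j) ((0 : 'M[R]_(a, b)) i j).
    by rewrite mxE; exact: is_derive_cst.
  move=> i j; have := is_derive_mulmx (fun=> n *m _) (fun=> C) _ _ _ _
    (is_derive_mulmx (fun=> n) F _ _ _ _ (dcst _ _ n) (dFij _ s01)) (dcst _ _ C) i j.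
  by rewrite mul0mx add0r mulmx0 addr0.
have [A' nA' dwA'] := nconn _ (derive1 c s) Ucs.
have dws := is_derive_curve w c s dcs (dw _ Ucs).
apply: is_derive_eq (is_deriveM dws (is_derive_det _ _ _ _ dnFC)) _.
rewrite mulmxN !mulNmx (mulmxA n) nA' -!(mulmxA A') mul_mx_adj.
rewrite mul_mx_scalar dwA' linearN/= mxtraceZ.
rewrite -[_ *: _]/(_ * _) -[X in _ + X]/(_ * _).
by ring.
Qed.

(** The invariants of parallel transport hold for every Phi s; their derivatives at s = 0 are the
    two linear conditions on the generator A. *)
Lemma holonomy_algebra_sub {R : realType} {m k : nat} (g : 'cV[R]_m -> 'M[R]_m)
    (U : set 'cV[R]_m) (n : 'M[R]_(k, m)) (w : 'cV[R]_m -> R) (p : 'cV[R]_m) :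
  open U -> (forall p, U p -> (g p)^T = g p) -> (forall p, U p -> g p \in unitmx) ->
  (forall p i j, U p -> differentiable (fun q => g q i j) p) ->
  (forall p, U p -> differentiable w p) ->
  (forall p X, U p -> exists2 A', n *m conn_mx g p X = A' *m n & 'D_X w p = w p * \tr A') ->
  U p -> w p != 0 ->
  holonomy_algebra g U p `<=` so_of (g p) `&` stab_of (det_form n).
Proof.
move=> Uo gsym gu dg dw nconn Up wp0 A [Phi [hPhi PhiD [dPhi PhiA]]].
have inv q q' T : transport g U q q' T -> T^T *m g q' *m T = g q /\
    forall C, w q' * \det (n *m T *m C) = w q * \det (n *m C).
  elim=> [q1 Uq1|q1 c F T' _ [IHg IHw] cU tF].
    by split=> [|C]; rewrite ?trmx1 ?mul1mx ?mulmx1.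
  have [Fg Fw] := transport_along_invariant g U n w c F Uo gsym gu dg dw nconn cU tF.
  split=> [|C]; last by rewrite -IHw -(mulmxA n T' C) -Fw !mulmxA.
  by rewrite trmx_mul -IHg -Fg !mulmxA.
(* [Phi 0] is idempotent by additivity, and invertible because it preserves the nondegenerate
   metric. *)
have Phi0 : Phi 0 = 1%:M.
  have [Phig _] := inv _ _ _ (hPhi 0).
  have [_ Phiu] : invmx (g p) *m (Phi 0)^T *m g p \in unitmx /\ Phi 0 \in unitmx.
    by apply: mulmx1_unit; rewrite -!mulmxA (mulmxA _ (g p)) Phig mulVmx// gu.
  have := PhiD 0 0; rewrite addr0 => PhiPhi.
  by rewrite -[LHS](mulKmx Phiu) -PhiPhi mulVmx.
have dPhiij i j : is_derive (0 : R) 1 (fun s => Phi s i j) (A i j).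
  by apply: is_derive_mx; exact: DeriveDef.
have dcst (a b : nat) (M : 'M[R]_(a, b)) i j :
    is_derive (0 : R) 1 (fun r => M i j) ((0 : 'M[R]_(a, b)) i j).
  by rewrite mxE; exact: is_derive_cst.
have const0 (h : R -> R) (a b : R) : is_derive (0 : R) 1 h a -> (forall s, h s = b) -> a = 0.
  move=> [_ <-] hb; rewrite (_ : h = cst b) ?derive_cst//.
  exact: funext.
split.
  rewrite /so_of/=; apply/matrixP => i j; rewrite [RHS]mxE.
  have := is_derive_mulmx _ _ _ _ _ _ (is_derive_mulmx _ (fun=> g p) _ _ _ _
    (is_derive_trmx _ _ _ _ dPhiij) (dcst _ _ (g p))) dPhiij i j.
  rewrite Phi0 trmx1 mul1mx !mulmx1 mul1mx addr0 => /const0; apply => s.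
  by rewrite (inv _ _ _ (hPhi s)).1.
move=> v; rewrite sum_det_form_subst.
have dnPhiC : forall i j, is_derive (0 : R) 1 (fun r => (n *m Phi r *m cols v) i j)
    ((n *m A *m cols v) i j).
  move=> i j; have := is_derive_mulmx _ (fun=> cols v) _ _ _ _
    (is_derive_mulmx (fun=> n) _ _ _ _ _ (dcst _ _ n) dPhiij) (dcst _ _ (cols v)) i j.
  by rewrite mul0mx add0r mulmx0 addr0.
have := is_derive_det _ _ _ _ dnPhiC; rewrite Phi0 mulmx1 => /const0; apply => s.
apply: (mulfI wp0); exact: (inv _ _ _ (hPhi s)).2.
Qed.

Lemma parallel_det_form {R : realType} {m k : nat} (g : 'cV[R]_m -> 'M[R]_m)
    (U : set 'cV[R]_m) (n : 'M[R]_(k, m)) (w : 'cV[R]_m -> R)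
    (kap : 'cV[R]_m -> kform R m k) :
  open U -> (forall p, U p -> differentiable w p) ->
  (forall p, U p -> kap p = scale_form (w p) (det_form n)) ->
  (forall p X, U p -> exists2 A', n *m conn_mx g p X = A' *m n & 'D_X w p = w p * \tr A') ->
  parallel_form g U kap.
Proof.
move=> Uo dw kapE nconn p X v Up; rewrite /nabla_form kapE//.
have -> : 'D_X (fun q => kap q v) p = 'D_X w p * det_form n v.
  have -> : 'D_X (fun q => kap q v) p = 'D_X (fun q => w q * det_form n v) p.
    apply: near_eq_derive; apply: filterS (open_nbhs_nbhs (conj Uo Up)) => q Uq.
    by rewrite kapE.
  by rewrite deriveMr; [exact: mulrC|exact/diff_derivable/dw].
have [A' nA' ->] := nconn _ X Up.
rewrite /scale_form -big_distrr/= (sum_det_form_scalar _ _ _ _ nA').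
by rewrite mulrA subrr.
Qed.

(** The flat derivative of a field in ker n stays in ker n because n is constant, and the connection
    term factors through n. *)
Lemma parallel_kernel {R : realType} {m k : nat} (g : 'cV[R]_m -> 'M[R]_m)
    (U : set 'cV[R]_m) (n : 'M[R]_(k, m)) (V : 'cV[R]_m -> set 'cV[R]_m) :
  (forall p X, U p -> V p X <-> n *m X = 0) ->
  (forall p X, U p -> exists A', n *m conn_mx g p X = A' *m n) ->
  parallel_distribution g U V.
Proof.
move=> VE nconn O Y Oo OU Ys VY p X Op; apply/VE; first exact: OU.
have [A' nA'] := nconn _ X (OU _ Op).
have nY q : O q -> n *m Y q = 0 by move=> Oq; apply/(VE q); [exact: OU|exact: VY].
have dYi i j : derivable (fun q => Y q i j) p X.
  by rewrite (ord1 j); apply: diff_derivable; have [+ _] := Ys i 1%N; exact.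
have dY : derivable Y p X by apply/derivable_mxP => i j; exact: dYi.
rewrite /nabla_field mulmxDr mulmxA nA' -mulmxA nY// mulmx0 addr0.
apply/matrixP => i j; rewrite [RHS]mxE derive_mx// mxE.
have dsum : is_derive p X (fun q => \sum_l n i l * Y q l j)
    (\sum_l n i l * 'D_X (fun q => Y q l j) p).
  apply: is_derive_bigsum => l.
  by apply: is_derive_eq (is_deriveM (is_derive_cst (n i l) p X) (derivableP (dYi l j))) _;
    rewrite scaler0 addr0.
under eq_bigr do rewrite mxE.
rewrite -(@derive_val _ _ _ _ _ _ _ dsum).
rewrite (@near_eq_derive _ _ _ _ (cst 0)) ?derive_cst//.
apply: filterS (open_nbhs_nbhs (conj Oo Op)) => q Oq.
by have /matrixP/(_ i j) := nY _ Oq; rewrite !mxE.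
Qed.

Lemma differentiable_cV {R : realType} {V : normedModType R} {n : nat}
    (F : V -> 'cV[R]_n) (p : V) :
  (forall i, differentiable (fun q => F q i 0) p) -> differentiable F p.
Proof.
move=> dF; rewrite (_ : F = \sum_i (fun q => F q i 0 *: dvec i)).
  by apply: differentiable_sum => i; exact: differentiableZl.
apply: funext => q; rewrite fct_sumE; apply/matrixP => i j; rewrite (ord1 j) summxE.
rewrite (bigD1 i)//= big1 => [|k ki]; rewrite !mxE ?eqxx ?mulr1 ?addr0//.
by rewrite eq_sym (negbTE ki) mulr0.
Qed.

Lemma differentiable_coord_fun {R : realType} {n : nat} (i : 'I_n) (p : 'cV[R]_n) :
  differentiable (fun q : 'cV[R]_n => q i 0) p.
Proof. exact: differentiable_coord. Qed.

Lemma partial_coord {R : realType} {n : nat} (i j : 'I_n) (p : 'cV[R]_n) :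
  partial i (fun q : 'cV[R]_n => q j 0) p = (j == i)%:R.
Proof.
rewrite /partial.
have := @is_derive_mx R _ _ _ id p (dvec i) (dvec i) j 0 (is_derive_id _ _).
by move=> /@derive_val ->; rewrite mxE eqxx andbT.
Qed.

Lemma differentiable_x13 {R : realType} (p : 'cV[R]_6) : differentiable (@x13 R) p.
Proof.
apply: differentiable_cV => i; case: (eqVneq i ord0) => [->|/negbTE i0].
  rewrite (_ : (fun q => _) = (fun q : 'cV[R]_6 => q ix1 0)).
    exact: differentiable_coord_fun.
  by apply: funext => q; rewrite mxE eqxx.
rewrite (_ : (fun q => _) = (fun q : 'cV[R]_6 => q ix3 0)).
  exact: differentiable_coord_fun.
by apply: funext => q; rewrite mxE i0.
Qed.

Lemma x13_affine {R : realType} (p v : 'cV[R]_6) (h : R) :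
  x13 (h *: v + p) = h *: x13 v + x13 p.
Proof. by apply/matrixP => i j; rewrite !mxE; case: ifP. Qed.

Lemma open_x13 {R : realType} (W : set 'cV[R]_2) : open W -> open [set p | W (x13 p)].
Proof.
apply: (open_comp (f := @x13 R)) => p _.
exact/differentiable_continuous/differentiable_x13.
Qed.

Lemma partial_x13 {R : realType} (a : 'cV[R]_2 -> R) (p : 'cV[R]_6) (i : 'I_6) :
  partial i (fun q => a (x13 q)) p =
    if i == ix1 then pd1 a (x13 p) else if i == ix3 then pd3 a (x13 p) else 0.
Proof.
rewrite /partial (derive_comp_affine (@x13 R) a p (dvec i) (x13 (dvec i))); last first.
  by move=> h; exact: x13_affine.
have -> : x13 (dvec i : 'cV[R]_6) =
    if i == ix1 then dvec ord0 else if i == ix3 then dvec ord_max else 0.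
  apply/matrixP => j k; rewrite (ord1 k) !mxE.
  by case: i => [[|[|[|[|[|[|]]]]]] // ?]; case: j => [[|[|]] // ?]; rewrite !mxE.
case: ifP => _ //; case: ifP => _ //.
by rewrite derive0.
Qed.

Lemma partial_near {R : realType} {n : nat} (D : set 'cV[R]_n) (F F' : 'cV[R]_n -> R) (i : 'I_n) p :
  open D -> D p -> (forall q, D q -> F q = F' q) -> partial i F p = partial i F' p.
Proof.
move=> Do Dp FF'; apply: near_eq_derive.
by apply: filterS (open_nbhs_nbhs (conj Do Dp)) => q; exact: FF'.
Qed.

(** Functions that agree near p have the same first-order expansion there. Many formulas for the
    metric hold only over [W], so they have to be transferred this way. *)
Lemma differentiable_near {R : realType} {n : nat} (D : set 'cV[R]_n)
    (F F' : 'cV[R]_n -> R) p :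
  open D -> D p -> (forall q, D q -> F q = F' q) ->
  differentiable F p -> differentiable F' p.
Proof.
move=> Do Dp FF' /diff_locallyP[dFc FE].
have F'E : F' \o shift p = cst (F' p) + ('d F p : 'cV[R]_n -> R) +o_ (0 : 'cV[R]_n) id.
  apply/eqaddoP => _/posnumP[e]; move/eqaddoP: FE => /(_ e%:num (gt0 e)) FEe.
  have nD : \forall h \near (0 : 'cV[R]_n), D (h + p).
    by have /nbhs0P := open_nbhs_nbhs (conj Do Dp); apply: filterS => h; rewrite addrC.
  apply: filterS2 nD FEe => h Dh; rewrite /= -[(_ - _ : _ -> _) h]/(_ - _).
  by rewrite -![(_ + _ : _ -> _) h]/(_ + _) /cst/= -!FF'.
apply/diff_locallyP; rewrite (diff_unique dFc F'E).
by split.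
Qed.

(** * The filtration by the degree in x^2 *)

(* With indices counted from 0, the even coordinates are x^1, x^3, y^2 (and t)
   and the odd ones x^2, y^1, y^3 (and rho). *)
Definition wdeg (i : nat) : int := (~~ odd i : nat)%:Z.

(* [wt W d F]: over W, F is a polynomial of degree at most d in x^2 whose
   coefficients are smooth functions of (x^1, x^3); for [d < 0] it vanishes. *)
Inductive wt {R : realType} (W : set 'cV[R]_2) : int -> ('cV[R]_6 -> R) -> Prop :=
| wt_zero d : wt W d (fun=> 0)
| wt_coef d a : (0 <= d) -> smooth_on W a -> wt W d (fun p => a (x13 p))
| wt_coefV d a : (0 <= d) -> smooth_on W a -> (forall w, W w -> a w != 0) ->
    wt W d (fun p => (a (x13 p))^-1)
| wt_x2 d : (1 <= d) -> wt W d (fun p => p ix2 0)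
| wt_add d F F' : wt W d F -> wt W d F' -> wt W d (fun p => F p + F' p)
| wt_mul d e F F' : wt W d F -> wt W e F' -> wt W (d + e) (fun p => F p * F' p)
| wt_ext d F F' : wt W d F -> (forall p, W (x13 p) -> F p = F' p) -> wt W d F'.

Lemma wt_neg {R : realType} (W : set 'cV[R]_2) d (F : 'cV[R]_6 -> R) :
  wt W d F -> d < 0 -> forall p, W (x13 p) -> F p = 0.
Proof.
elim=> {d F} [//|d a d0 _ dn|d a d0 _ _ dn|d d1 dn|d F F' _ IH _ IH' dn p Wp|
  d e F F' _ IH _ IH' den p Wp|d F F' _ IH FF' dn p Wp].
- by move: (le_lt_trans d0 dn); rewrite ltxx.
- by move: (le_lt_trans d0 dn); rewrite ltxx.
- by move: (le_lt_trans d1 dn); rewrite ltr10.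
- by rewrite IH// IH'// addr0.
(* A product of negative total degree has a factor of negative degree. *)
- have [dn|d0] := ltP d 0; first by rewrite IH// mul0r.
  rewrite IH' ?mulr0//; apply: le_lt_trans den.
  by rewrite lerDr.
- by rewrite -FF'//; exact: IH.
Qed.

Lemma smooth_on_partial {R : realType} {n : nat} (U : set 'cV[R]_n) a i :
  smooth_on U a -> smooth_on U (partial i a).
Proof. by move=> sa k; have [_] := sa k.+1; exact. Qed.

Lemma smooth_on_differentiable {R : realType} {n : nat} (U : set 'cV[R]_n) a p :
  smooth_on U a -> U p -> differentiable a p.
Proof. by move=> sa Up; have [+ _] := sa 1%N; exact. Qed.

Lemma differentiable_comp_x13 {R : realType} (W : set 'cV[R]_2) a (p : 'cV[R]_6) :
  smooth_on W a -> W (x13 p) -> differentiable (fun q => a (x13 q)) p.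
Proof.
move=> sa Wp; apply: (differentiable_comp (f := @x13 R)).
  exact: differentiable_x13.
exact: smooth_on_differentiable sa Wp.
Qed.

Lemma wt_differentiable {R : realType} (W : set 'cV[R]_2) d (F : 'cV[R]_6 -> R) :
  open W -> wt W d F -> forall p, W (x13 p) -> differentiable F p.
Proof.
move=> Wo; elim=> {d F} [d|d a _ sa|d a _ sa a0|d _|d F F' _ IH _ IH'|
  d e F F' _ IH _ IH'|d F F' _ IH FF'] p Wp.
- exact: (differentiable_cst (0 : R)).
- exact: differentiable_comp_x13 sa Wp.
- by apply: differentiableV; [exact: differentiable_comp_x13 sa Wp|exact: a0].
- exact: differentiable_coord_fun.
- by apply: (differentiableD (f := F) (g := F')); [exact: IH|exact: IH'].
- by apply: (differentiableM (f := F) (g := F')); [exact: IH|exact: IH'].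
- exact: (differentiable_near _ _ _ _ (open_x13 _ Wo) Wp FF' (IH _ Wp)).
Qed.

Lemma partialD {R : realType} {n : nat} (F F' : 'cV[R]_n -> R) i p :
  differentiable F p -> differentiable F' p ->
  partial i (fun q => F q + F' q) p = partial i F p + partial i F' p.
Proof. by move=> dF dF'; rewrite /partial deriveD//; exact: diff_derivable. Qed.

Lemma partialM {R : realType} {n : nat} (F F' : 'cV[R]_n -> R) i p :
  differentiable F p -> differentiable F' p ->
  partial i (fun q => F q * F' q) p = partial i F p * F' p + F p * partial i F' p.
Proof.
move=> dF dF'; rewrite /partial deriveM; [|exact: diff_derivable..].
by rewrite addrC; congr (_ + _); exact: mulrC.
Qed.

Lemma partialV {R : realType} {n : nat} (F : 'cV[R]_n -> R) i p :
  differentiable F p -> F p != 0 ->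
  partial i (fun q => (F q)^-1) p = - (partial i F p * ((F p)^-1 * (F p)^-1)).
Proof.
move=> dF F0; rewrite /partial deriveV//; last exact: diff_derivable.
by rewrite -[LHS]/(_ * _) mulNr mulrC expr2 invfM.
Qed.

Lemma partial_cst {R : realType} {n : nat} (c : R) i (p : 'cV[R]_n) :
  partial i (fun=> c) p = 0.
Proof. exact: derive_cst. Qed.

Lemma smooth_on_cst {R : realType} {n : nat} (U : set 'cV[R]_n) (c : R) :
  smooth_on U (fun=> c).
Proof.
move=> k; elim: k c => [|k IH] c /=; first by move=> p _; exact: cst_continuous.
split=> [p _|i]; first exact: differentiable_cst.
rewrite (_ : partial i _ = (fun=> 0)); first exact: IH.
by apply: funext => p; exact: partial_cst.
Qed.

Lemma wt_cst {R : realType} (W : set 'cV[R]_2) d c : 0 <= d -> wt W d (fun=> c).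
Proof. by move=> d0; exact: (wt_coef W d (fun=> c) d0 (smooth_on_cst _ _)). Qed.

Lemma wt_scale {R : realType} (W : set 'cV[R]_2) d F c :
  wt W d F -> wt W d (fun p => c * F p).
Proof. by move=> wF; rewrite -[d]add0r; apply: wt_mul => //; exact: wt_cst. Qed.

Lemma wt_opp {R : realType} (W : set 'cV[R]_2) d F :
  wt W d F -> wt W d (fun p => - F p).
Proof.
move=> wF; apply: (wt_ext _ _ _ _ (wt_scale _ _ _ (-1) wF)) => p _.
by rewrite mulN1r.
Qed.

Lemma wt_sub {R : realType} (W : set 'cV[R]_2) d F F' :
  wt W d F -> wt W d F' -> wt W d (fun p => F p - F' p).
Proof. by move=> wF wF'; apply: wt_add => //; exact: wt_opp. Qed.

Lemma wt_sum {R : realType} (W : set 'cV[R]_2) d {I : Type} (r : seq I) (F : I -> 'cV[R]_6 -> R) :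
  (forall i, wt W d (F i)) -> wt W d (fun p => \sum_(i <- r) F i p).
Proof.
move=> wF; elim: r => [|i r IH].
  by apply: (wt_ext _ _ _ _ (wt_zero W d)) => p _; rewrite big_nil.
by apply: (wt_ext _ _ _ _ (wt_add _ _ _ _ (wF i) IH)) => p _; rewrite big_cons.
Qed.

Lemma wt_deg {R : realType} (W : set 'cV[R]_2) d e F : wt W d F -> d = e -> wt W e F.
Proof. by move=> + <-. Qed.

(** Differentiation along x^2 lowers the degree by 1 and along x^1, x^3 keeps it; along every y^i
    the derivative is 0, which has any degree, so y^2 can be counted as even. *)
Lemma wt_partial {R : realType} (W : set 'cV[R]_2) d (F : 'cV[R]_6 -> R) (i : 'I_6) :
  open W -> wt W d F -> wt W (d - 1 + wdeg i) (partial i F).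
Proof.
move=> Wo; have Wx := open_x13 _ Wo.
have coef e a : 0 <= e -> smooth_on W a ->
    wt W (e - 1 + wdeg i) (partial i (fun p => a (x13 p))).
  move=> e0 sa; have -> : partial i (fun p => a (x13 p)) = fun p =>
      if i == ix1 then pd1 a (x13 p) else if i == ix3 then pd3 a (x13 p) else 0.
    by apply: funext => p; exact: partial_x13.
  case: eqVneq => [->|_].
    by apply: (wt_coef _ _ (pd1 a)); rewrite ?subrK//; exact: smooth_on_partial.
  case: eqVneq => [->|_]; last exact: wt_zero.
  by apply: (wt_coef _ _ (pd3 a)); rewrite ?subrK//; exact: smooth_on_partial.
elim=> {d F} [d|d a d0 sa|d a d0 sa a0|d d1|d F F' wF IH wF' IH'|
  d e F F' wF IH wF' IH'|d F F' _ IH FF'].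
- apply: (wt_ext _ _ _ _ (wt_zero _ _)) => p _.
  by rewrite partial_cst.
- exact: coef.
- apply: (@wt_ext _ _ _ (fun p => - (partial i (fun p => a (x13 p)) p *
    ((a (x13 p))^-1 * (a (x13 p))^-1)))).
    rewrite -[_ + wdeg i]addr0 -[X in _ + X](addr0 0).
    by apply/wt_opp/wt_mul; [exact: coef|apply: wt_mul; apply: (wt_coefV _ _ a)].
  move=> p Wp; rewrite partialV//; last exact: a0.
  exact: differentiable_comp_x13 sa Wp.
- rewrite (_ : partial i _ = fun=> (ix2 == i)%:R); last first.
    by apply: funext => p; exact: partial_coord.
  case: eqVneq => _ /=; last exact: wt_zero.
  by apply: wt_cst; rewrite addr_ge0// subr_ge0.
- apply: (wt_ext _ _ _ _ (wt_add _ _ _ _ IH IH')) => p Wp.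
  by rewrite partialD//; [exact: wt_differentiable wF _ Wp|exact: wt_differentiable wF' _ Wp].
- apply: (@wt_ext _ _ _ (fun p => partial i F p * F' p + F p * partial i F' p)).
    apply: wt_add; first by apply: wt_deg (wt_mul _ _ _ _ _ IH wF') _; ring.
    by apply: wt_deg (wt_mul _ _ _ _ _ wF IH') _; ring.
  move=> p Wp; rewrite partialM//.
    exact: wt_differentiable wF _ Wp.
  exact: wt_differentiable wF' _ Wp.
- by apply: (wt_ext _ _ _ _ IH) => p Wp; apply: (partial_near _ _ _ _ _ Wx Wp FF').
Qed.

Lemma wt_schwarz {R : realType} (W : set 'cV[R]_2) d (F : 'cV[R]_6 -> R) (i j : 'I_6) p :
  open W -> wt W d F -> W (x13 p) ->
  partial i (partial j F) p = partial j (partial i F) p.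
Proof.
move=> Wo wF Wp; have Wx := open_nbhs_nbhs (conj (open_x13 _ Wo) Wp).
have nd (e : int) G (v : 'cV[R]_6) : wt W e G -> \forall q \near p, derivable G q v.
  move=> wG; apply: filterS Wx => q Wq.
  by apply: diff_derivable; exact: wt_differentiable wG _ Wq.
have nc (e : int) G : wt W e G -> {for p, continuous G}.
  by move=> wG; apply: differentiable_continuous; exact: wt_differentiable wG _ Wp.
have w1 k := wt_partial _ _ _ k Wo wF.
apply: (schwarz F p (dvec j) (dvec i)).
- exact: nd wF.
- exact: nd wF.
- exact: nd (w1 j).
- exact: nd (w1 i).
- exact: nc (wt_partial _ _ _ i Wo (w1 j)).
- exact: nc (wt_partial _ _ _ j Wo (w1 i)).
Qed.

Lemma splitting_rowsub {R : realType} {k m : nat} (ev od : 'I_k -> 'I_m) :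
  injective ev -> injective od -> (forall a b, ev a != od b) ->
  (forall i, (exists a, i = ev a) \/ (exists b, i = od b)) ->
  splitting (rowsub ev 1%:M : 'M[R]_(k, m)) (rowsub od 1%:M).
Proof.
move=> evI odI evod cover.
have prod (s r : 'I_k -> 'I_m) i j :
    ((rowsub s 1%:M : 'M[R]_(k, m)) *m (rowsub r 1%:M)^T) i j = (s i == r j)%:R.
  rewrite mxE (bigD1 (s i))//= big1 => [|l ls].
    by rewrite !mxE eqxx mul1r addr0 eq_sym.
  by rewrite !mxE [s i == l]eq_sym (negbTE ls) mul0r.
have proj (s : 'I_k -> 'I_m) i j :
    ((rowsub s 1%:M : 'M[R]_(k, m))^T *m rowsub s 1%:M) i j =
    \sum_a ((s a == i) && (s a == j))%:R.
  by rewrite mxE; apply: eq_bigr => a _; rewrite !mxE -natrM mulnb.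
split; apply/matrixP => i j.
- by rewrite prod !mxE (inj_eq evI).
- by rewrite prod !mxE (inj_eq odI).
- by rewrite prod !mxE (negbTE (evod _ _)).
rewrite [LHS]mxE !proj [RHS]mxE; case: (cover i) => -[a ->].
- rewrite [X in _ + X]big1 ?addr0 => [|b _]; last by rewrite eq_sym (negbTE (evod _ _)).
  rewrite (bigD1 a)//= eqxx big1 ?addr0 => [//|b ba].
  by rewrite (inj_eq evI) (negbTE ba).
- rewrite big1 ?add0r => [|b _]; last by rewrite (negbTE (evod _ _)).
  rewrite (bigD1 a)//= eqxx big1 ?addr0 => [//|b ba].
  by rewrite (inj_eq odI) (negbTE ba).
Qed.

Lemma rowsub_sandwich {R : realType} {k m : nat} (s r : 'I_k -> 'I_m) (G : 'M[R]_m) :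
  rowsub s 1%:M *m G *m (rowsub r 1%:M)^T = mxsub s r G.
Proof.
apply/matrixP => i j; rewrite mul_rowsub_mx mul1mx mxE (bigD1 (r j))//= big1.
  by rewrite !mxE eqxx mulr1 addr0.
by move=> l lr; rewrite !mxE eq_sym (negbTE lr) mulr0.
Qed.

(** * Bryant's metric *)

Definition o3_0 : 'I_3 := @Ordinal 3 0 isT.
Definition o3_1 : 'I_3 := @Ordinal 3 1 isT.
Definition o3_2 : 'I_3 := @Ordinal 3 2 isT.

Lemma big_ord3 {R : realType} (F : 'I_3 -> R) : \sum_i F i = F o3_0 + F o3_1 + F o3_2.
Proof.
by rewrite !big_ord_recl big_ord0 addr0 addrA; congr (F _ + F _ + F _); exact: val_inj.
Qed.

Lemma ord3_ind (P : 'I_3 -> Prop) : P o3_0 -> P o3_1 -> P o3_2 -> forall i, P i.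
Proof.
move=> P0 P1 P2 [[|[|[|//]]] i3].
- by rewrite (_ : Ordinal i3 = o3_0)//; exact: val_inj.
- by rewrite (_ : Ordinal i3 = o3_1)//; exact: val_inj.
- by rewrite (_ : Ordinal i3 = o3_2)//; exact: val_inj.
Qed.

Definition ev6 (a : 'I_3) : 'I_6 := nth ix1 [:: ix1; ix3; iy2] a.
Definition od6 (b : 'I_3) : 'I_6 := nth ix2 [:: ix2; iy1; iy3] b.

Lemma ev6_deg a : wdeg (ev6 a) = 1.
Proof. by elim/ord3_ind: a. Qed.

Lemma od6_deg b : wdeg (od6 b) = 0.
Proof. by elim/ord3_ind: b. Qed.

Lemma cover6 (i : 'I_6) : (exists a, i = ev6 a) \/ (exists b, i = od6 b).
Proof.
case: i => [[|[|[|[|[|[|//]]]]]] i6]; [left; exists o3_0|right; exists o3_0|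
  left; exists o3_1|right; exists o3_1|left; exists o3_2|right; exists o3_2]; exact: val_inj.
Qed.

Lemma splitting6 {R : realType} :
  splitting (rowsub ev6 1%:M : 'M[R]_(3, 6)) (rowsub od6 1%:M).
Proof.
apply: splitting_rowsub; last exact: cover6.
- by elim/ord3_ind; elim/ord3_ind.
- by elim/ord3_ind; elim/ord3_ind.
- by elim/ord3_ind; elim/ord3_ind.
Qed.

Lemma is_deriveM_fun {R : realType} {V : normedModType R} (F G : V -> R) dF dG x v :
  is_derive x v F dF -> is_derive x v G dG ->
  is_derive x v (fun y => F y * G y) (dF * G x + F x * dG).
Proof.
move=> hF hG; apply: is_derive_eq (is_deriveM hF hG) _.
by rewrite addrC; congr (_ + _); exact: mulrC.
Qed.

Lemma is_deriveD_fun {R : realType} {V : normedModType R} (F G : V -> R) dF dG x v :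
  is_derive x v F dF -> is_derive x v G dG ->
  is_derive x v (fun y => F y + G y) (dF + dG).
Proof. by move=> hF hG; exact: is_deriveD. Qed.

Lemma is_deriveN_fun {R : realType} {V : normedModType R} (F : V -> R) dF x v :
  is_derive x v F dF -> is_derive x v (fun y => - F y) (- dF).
Proof. by move=> hF; exact: is_deriveN. Qed.

Lemma is_derive_cst_fun {R : realType} {V : normedModType R} (c : R) (x v : V) :
  is_derive x v (fun=> c) 0.
Proof. exact: is_derive_cst. Qed.

Lemma wt_mulmx {R : realType} (W : set 'cV[R]_2) {a b c : nat}
    (A : 'cV[R]_6 -> 'M[R]_(a, b)) (B : 'cV[R]_6 -> 'M[R]_(b, c)) dA dB :
  (forall i j, wt W (dA i) (fun p => A p i j)) ->
  (forall i j, wt W (dB j) (fun p => B p i j)) ->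
  forall i j, wt W (dA i + dB j) (fun p => (A p *m B p) i j).
Proof.
move=> wA wB i j; apply: (@wt_ext _ _ _ (fun p => \sum_l A p i l * B p l j)).
  by apply: wt_sum => l; exact: wt_mul.
by move=> p _; rewrite mxE.
Qed.

(* The block of Bryant's metric pairing the odd with the even coordinate
   directions: rows d/dx^2, d/dy^1, d/dy^3, columns dx^1, dx^3, dy^2, with
   [x = x^1], [a = f], [b = f_3], [b1 = f_13] and [b3 = f_33]. *)
Definition mixed_mx {R : realType} (x a b b1 b3 : R) : 'M[R]_3 :=
  \matrix_(i, j) nth 0 (nth [::]
    [:: [:: (3%:R / 2%:R * b + 2%:R^-1 * (x * b1)) * a; 3%:R / 2%:R * (x * (b * b));
            3%:R / 2%:R * b + 2%:R^-1 * (x * b1)];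
        [:: 3%:R / 2%:R * (b * b) - 2%:R^-1 * (b3 * a); 0; - (2%:R^-1 * b3)];
        [:: 2%:R^-1 * (b1 * a); 3%:R / 2%:R * (b * b); 2%:R^-1 * b1]] i) j.

(** Entries are polynomials in [iv], so that degree rules apply to them directly. The first column
    of [mixed_mx] contains a times the third, because theta^2 = dy^2 + f dx^1; accordingly a times
    the first row is subtracted from the third row here. *)
Definition mixed_inv_mx {R : realType} (x a b b1 b3 : R) : 'M[R]_3 :=
  let iv := b^-1 in
  let e1 := 2%:R / 9%:R * (b3 * (iv * (iv * iv))) in
  let e2 := 2%:R / 3%:R * (iv * iv) in
  let e3 := - (2%:R / 9%:R * (x * (b3 * (iv * (iv * iv))))) in
  \matrix_(i, j) nth 0 (nth [::]
    [:: [:: e1; e2; e3];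
        [:: - (2%:R / 9%:R * (b1 * (iv * (iv * iv)))); 0;
            2%:R / 3%:R * (iv * iv) + 2%:R / 9%:R * (x * (b1 * (iv * (iv * iv))))];
        [:: 2%:R / 3%:R * iv - a * e1; - (a * e2); - (2%:R / 3%:R * (x * iv)) - a * e3]] i) j.

(* The total differential of [mixed_mx] at (x, a, b, b1, b3) applied to
   (dx, da, db, db1, db3). *)
Definition dmixed_mx {R : realType} (x a b b1 b3 dx da db db1 db3 : R) : 'M[R]_3 :=
  \matrix_(i, j) nth 0 (nth [::]
    [:: [:: (3%:R / 2%:R * db + 2%:R^-1 * (dx * b1 + x * db1)) * a
              + (3%:R / 2%:R * b + 2%:R^-1 * (x * b1)) * da;
            3%:R / 2%:R * (dx * (b * b) + x * (2%:R * b * db));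
            3%:R / 2%:R * db + 2%:R^-1 * (dx * b1 + x * db1)];
        [:: 3%:R / 2%:R * (2%:R * b * db) - 2%:R^-1 * (db3 * a + b3 * da); 0;
            - (2%:R^-1 * db3)];
        [:: 2%:R^-1 * (db1 * a + b1 * da); 3%:R / 2%:R * (2%:R * b * db);
            2%:R^-1 * db1]] i) j.

Lemma mixed_mx_inv {R : realType} (x a b b1 b3 : R) :
  b != 0 -> mixed_mx x a b b1 b3 *m mixed_inv_mx x a b b1 b3 = 1%:M.
Proof.
move=> b0; apply/matrixP; apply: ord3_ind; apply: ord3_ind;
  rewrite mxE big_ord3 !mxE/=; by field.
Qed.

(** The left-hand side is the logarithmic derivative of the determinant of [mixed_mx], which is 27/8
    b^5. *)
Lemma tr_mixed_inv_dmixed {R : realType} (x a b b1 b3 dx da db db1 db3 : R) :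
  b != 0 ->
  \tr (mixed_inv_mx x a b b1 b3 *m dmixed_mx x a b b1 b3 dx da db db1 db3) =
  5%:R * db * b^-1.
Proof.
move=> b0; rewrite /mxtrace big_ord3 !mxE !big_ord3 !mxE/=; by field.
Qed.

Lemma is_derive_mixed {R : realType} {V : normedModType R} (X A B B1 B3 : V -> R)
    (dx da db db1 db3 : R) (p v : V) :
  is_derive p v X dx -> is_derive p v A da -> is_derive p v B db ->
  is_derive p v B1 db1 -> is_derive p v B3 db3 ->
  forall i j, is_derive p v (fun q => mixed_mx (X q) (A q) (B q) (B1 q) (B3 q) i j)
    (dmixed_mx (X p) (A p) (B p) (B1 p) (B3 p) dx da db db1 db3 i j).
Proof.
move=> hX hA hB hB1 hB3.
(* For each entry the rules build a derivative in an existential variable, and [ring] identifies it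
   with the entry of [dmixed_mx]. *)
apply: ord3_ind; apply: ord3_ind; under eq_fun do rewrite mxE/=; rewrite mxE/=;
  (eapply is_derive_eq; [repeat first [eassumption | apply: is_deriveD_fun
    | apply: is_deriveN_fun | apply: is_deriveM_fun | apply: is_derive_cst_fun]|]);
  by rewrite /GRing.scale/=; ring.
Qed.

(** Bryant's metric with the coordinates and the values of f and its derivatives replaced by real
    variables, so that statements about its entries become field identities. *)
Definition bryant_mx {R : realType} (x1 x2 a b b1 b3 : R) : 'M[R]_6 :=
  let t1 := dcov iy1 + x2 *: dcov ix3 in
  let t2 := dcov iy2 + a *: dcov ix1 in
  let t3 := dcov iy3 + x1 *: dcov ix2 in
  let t4 := (3%:R / 2%:R * b ^+ 2) *: dcov ix1 in
  let t5 := (3%:R / 2%:R * b) *: dcov ix2 - (2%:R^-1 * b3) *: t1 in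
  let t6 := (3%:R / 2%:R * b ^+ 2) *: dcov ix3 + (2%:R^-1 * b1) *: t2 in
  2%:R *: sprod t1 t4 + 2%:R *: sprod t2 t5 + 2%:R *: sprod t3 t6.

Lemma bryant_mx_mixed {R : realType} (x1 x2 a b b1 b3 : R) i j :
  bryant_mx x1 x2 a b b1 b3 (od6 i) (ev6 j) = mixed_mx x1 a b b1 b3 i j.
Proof.
by move: i j; apply: ord3_ind; apply: ord3_ind;
  rewrite /bryant_mx /sprod !mxE !big_ord1 !mxE/=; field.
Qed.

(** The even-even block of Bryant's metric divided by x^2: that coordinate enters the block only
    through theta^1 = dy^1 + x^2 dx^3. *)
Definition even_mx {R : realType} (a b b3 : R) : 'M[R]_3 :=
  \matrix_(i, j) nth 0 (nth [::]
    [:: [:: 0; 3%:R / 2%:R * (b * b) - 2%:R^-1 * (b3 * a); 0];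
        [:: 3%:R / 2%:R * (b * b) - 2%:R^-1 * (b3 * a); 0; - (2%:R^-1 * b3)];
        [:: 0; - (2%:R^-1 * b3); 0]] i) j.

Lemma bryant_mx_even {R : realType} (x1 x2 a b b1 b3 : R) i j :
  bryant_mx x1 x2 a b b1 b3 (ev6 i) (ev6 j) = x2 * even_mx a b b3 i j.
Proof.
by move: i j; apply: ord3_ind; apply: ord3_ind;
  rewrite /bryant_mx /sprod !mxE !big_ord1 !mxE/=; field.
Qed.

(* The derivatives of [mixed_mx] along x^1, x^3 and y^2, with [a1 = f_1],
   [c1 = f_113], [c2 = f_133] and [c3 = f_333]. *)
Definition mixed_partial {R : realType} (x a b b1 b3 a1 c1 c2 c3 : R) (m : 'I_3) : 'M[R]_3 :=
  nth 0 [:: dmixed_mx x a b b1 b3 1 a1 b1 c1 c2; dmixed_mx x a b b1 b3 0 b b3 c2 c3; 0] m.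

(** The matrix is the odd-even block of the Christoffel symbols of the first kind along the m-th
    even direction; the last term has [i == o3_0] because x^2 is the only odd coordinate on which
    the even-even block depends. The result is the logarithmic derivative of b^(11/3): f_1 and the
    third derivatives of f cancel. *)
Lemma tr_mixed_inv_first_kind {R : realType} (x a b b1 b3 a1 c1 c2 c3 : R) (m : 'I_3) :
  b != 0 ->
  let D := mixed_partial x a b b1 b3 a1 c1 c2 c3 in
  \tr (mixed_inv_mx x a b b1 b3 *m
    \matrix_(i, j) (2%:R^-1 * (D m i j + D j i m - (i == o3_0)%:R * even_mx a b b3 m j))) =
  11%:R / 3%:R * [:: b1; b3; 0]`_m * b^-1.
Proof.
move=> b0 D; rewrite /D /mixed_partial.
by elim/ord3_ind: m; rewrite /mxtrace big_ord3 !mxE !big_ord3 !mxE/= ?mxE/=; field.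
Qed.

(** * The real cube root and the power 11/3 *)

Lemma is_derive_comp1 {R : realType} {V : normedModType R} (phi : R -> R) (G : V -> R)
    (p v : V) (d : R) :
  is_derive (G p) 1 phi d -> differentiable G p ->
  is_derive p v (fun q => phi (G q)) (d * 'D_v G p) /\ differentiable (fun q => phi (G q)) p.
Proof.
move=> [dphi <-] dG.
have dphi' : differentiable phi (G p) by exact/derivable1_diffP.
have dc : differentiable (phi \o G) p by exact: differentiable_comp.
split; last exact: dc.
apply: DeriveDef; first by apply: diff_derivable; exact: dc.
rewrite (_ : (fun q => phi (G q)) = phi \o G)// deriveE// diff_comp//= [in RHS]deriveE//.
by rewrite deriveE// -[in LHS](mulr1 ('d G p v)) [LHS]linearZ mulrC.
Qed.

(** The case of negative x, which occurs since f_3 may be negative, is reduced to the positive one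
    by oddness. *)
Lemma is_derive_cbrt {R : realType} (x : R) :
  x != 0 -> is_derive x 1 (@cbrt R) (3%:R^-1 * cbrt x / x).
Proof.
have pos (y : R) : 0 < y -> is_derive y 1 (@cbrt R) (3%:R^-1 * cbrt y / y).
  move=> y0; apply: (@near_eq_is_derive _ _ _ (fun z : R => z `^ 3%:R^-1)).
    near=> z; rewrite /cbrt; have z0 : 0 < z by near: z; exact: lt_nbhsr.
    by rewrite gtr0_sg// mul1r gtr0_norm.
  apply: is_derive_eq (is_derive1_powR 3%:R^-1 y0) _.
  rewrite /cbrt gtr0_sg// mul1r gtr0_norm// -mulrA; congr (_ * _).
  by rewrite powRB ?powRr1 ?ltW// (gt_eqF y0) implybT.
have odd (y : R) : cbrt (- y) = - cbrt y by rewrite /cbrt sgrN normrN mulNr.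
move=> x0; case: (ltgtP x 0) x0 => // [xn|xp] _; last exact: pos.
have xp : 0 < - x by rewrite oppr_gt0.
have dopp : differentiable (fun y : R => - y) x.
  by apply/derivable1_diffP; exact: derivable_opp.
have [dneg _] := is_derive_comp1 (@cbrt R) (fun y : R => - y) x 1 _ (pos _ xp) dopp.
rewrite (_ : cbrt = (fun y => - cbrt (- y))); last by apply: funext => y; rewrite odd opprK.
apply: is_derive_eq (is_deriveN_fun _ _ _ _ dneg) _.
have -> : 'D_1 (fun y : R => - y) x = - 1 by exact: derive_val.
by rewrite !odd invrN; ring.
Unshelve. all: by end_near. Qed.

(** For either sign of y the function is a branch of y^(11/3), with 11/3 = 4 - 1/3. *)
Lemma is_derive_quartic_cbrt {R : realType} (x : R) : x != 0 ->
  is_derive x 1 (fun y : R => y ^+ 4 * (cbrt y)^-1)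
    (11%:R / 3%:R * (x ^+ 4 * (cbrt x)^-1) / x).
Proof.
move=> x0; have dcb := is_derive_cbrt x x0.
have cb0 : cbrt x != 0.
  by rewrite /cbrt mulf_neq0 ?sgr_eq0// gt_eqF// powR_gt0// normr_gt0.
have dinv : is_derive x 1 (fun y => (cbrt y)^-1) (- (cbrt x) ^- 2 *: (3%:R^-1 * cbrt x / x)).
  have [dv <-] := dcb; apply: DeriveDef; first exact: derivableV.
  exact: deriveV.
have dX : is_derive x 1 (fun y : R => y ^+ 4) (4%:R * x ^+ 3).
  apply: DeriveDef; first exact: exprn_derivable.
  by rewrite exp_derive -[_ *: 1]/(_ * 1) mulr1.
apply: is_derive_eq (is_deriveM_fun _ _ _ _ _ _ dX dinv) _.
rewrite -[_ *: _]/(_ * _); move: (cbrt x) cb0 => c c0.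
by field; rewrite x0.
Qed.

Lemma smooth_schwarz {R : realType} {n : nat} (U : set 'cV[R]_n) (a : 'cV[R]_n -> R) p i j :
  open U -> smooth_on U a -> U p ->
  partial i (partial j a) p = partial j (partial i a) p.
Proof.
move=> Uo sa Up; have Un := open_nbhs_nbhs (conj Uo Up).
have nd b (v : 'cV[R]_n) : smooth_on U b -> \forall q \near p, derivable b q v.
  move=> sb; apply: filterS Un => q Uq.
  by apply: diff_derivable; exact: smooth_on_differentiable sb Uq.
have nc b : smooth_on U b -> {for p, continuous b} by move=> sb; exact: (sb 0%N).
have s1 k := smooth_on_partial U a k sa.
apply: (schwarz a p (dvec j) (dvec i)).
- exact: nd.
- exact: nd.
- exact: nd (s1 j).
- exact: nd (s1 i).
- exact: nc (smooth_on_partial _ _ i (s1 j)).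
- exact: nc (smooth_on_partial _ _ j (s1 i)).
Qed.

(** * Degrees of the coframe, the metric, the connection and the curvature *)

(** Where the symbol is not 0 the two degrees agree. This form lets the component of dx^j carry the
    degree of the free index i. *)
Lemma wt_delta {R : realType} (W : set 'cV[R]_2) (i j : 'I_6) :
  wt W (wdeg i - wdeg j) (fun=> (i == j)%:R).
Proof.
case: eqVneq => [->|_]; last exact: wt_zero.
by rewrite subrr; exact: wt_cst.
Qed.

Lemma wt_mul_delta {R : realType} (W : set 'cV[R]_2) d (i j : 'I_6) F :
  wt W d F -> wt W (d + (wdeg i - wdeg j)) (fun p => F p * (i == j)%:R).
Proof. by move=> wF; apply: wt_mul => //; exact: wt_delta. Qed.

Lemma smooth_on_coord {R : realType} {n : nat} (U : set 'cV[R]_n) i :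
  smooth_on U (fun w => w i 0).
Proof.
case=> [|k] /=; first by move=> p _; exact/differentiable_continuous/differentiable_coord_fun.
split=> [p _|j]; first exact: differentiable_coord_fun.
rewrite (_ : partial j _ = (fun=> (i == j)%:R)); first exact: smooth_on_cst.
by apply: funext => p; exact: partial_coord.
Qed.

Lemma wt_theta1 {R : realType} (W : set 'cV[R]_2) (i : 'I_6) :
  wt W (wdeg i) (fun p => theta1 p 0 i).
Proof.
apply: (@wt_ext _ _ _ (fun p => (i == iy1)%:R + p ix2 0 * (i == ix3)%:R)) => [|p _].
  apply: wt_add; first by apply: wt_deg (wt_delta _ _ _) _; rewrite subr0.
  apply: wt_deg (wt_mul_delta W 1 _ _ _ _) _; first exact: wt_x2.
  by rewrite addrC subrK.
by rewrite !mxE.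
Qed.

Lemma wt_theta3 {R : realType} (W : set 'cV[R]_2) (i : 'I_6) :
  wt W (wdeg i) (fun p => theta3 p 0 i).
Proof.
apply: (@wt_ext _ _ _ (fun p => (i == iy3)%:R + x13 p ord0 0 * (i == ix2)%:R)) => [|p _].
  apply: wt_add; first by apply: wt_deg (wt_delta _ _ _) _; rewrite subr0.
  apply: wt_deg (wt_mul_delta W 0 _ _ _ _) _; last by rewrite subr0 add0r.
  exact: (wt_coef _ _ (fun w => w ord0 0) _ (smooth_on_coord _ _)).
by rewrite !mxE.
Qed.

Section bryant.
Context {R : realType} (W : set 'cV[R]_2) (f : 'cV[R]_2 -> R).
Hypotheses (W_open : open W) (f_smooth : smooth_on W f)
  (f3_neq0 : forall w, W w -> pd3 f w != 0).

Let coef0 a : smooth_on W a -> wt W 0 (fun p => a (x13 p)).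
Proof. exact: wt_coef. Qed.

Let f1_smooth : smooth_on W (pd1 f). Proof. exact: smooth_on_partial. Qed.
Let f3_smooth : smooth_on W (pd3 f). Proof. exact: smooth_on_partial. Qed.
Let f33_smooth : smooth_on W (pd3 (pd3 f)). Proof. exact: smooth_on_partial. Qed.
Let f13_smooth : smooth_on W (pd3 (pd1 f)). Proof. exact: smooth_on_partial. Qed.

Let wt0M F F' : wt W 0 F -> wt W 0 F' -> wt W 0 (fun p => F p * F' p).
Proof. by move=> wF wF'; rewrite -[0]addr0; exact: wt_mul. Qed.

Lemma wt_theta2 (i : 'I_6) : wt W (wdeg i - 1) (fun p => theta2 f p 0 i).
Proof.
apply: (@wt_ext _ _ _ (fun p => (i == iy2)%:R + f (x13 p) * (i == ix1)%:R)) => [|p _].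
  apply: wt_add; first by apply: wt_deg (wt_delta _ _ _) _.
  by apply: wt_deg (wt_mul_delta W 0 _ _ _ (coef0 _ f_smooth)) _; rewrite add0r.
by rewrite !mxE.
Qed.

Lemma wt_theta4 (i : 'I_6) : wt W (wdeg i - 1) (fun p => theta4 f p 0 i).
Proof.
apply: (@wt_ext _ _ _ (fun p =>
    (3%:R / 2%:R * (pd3 f (x13 p) * pd3 f (x13 p))) * (i == ix1)%:R)) => [|p _].
  apply: wt_deg (wt_mul_delta W 0 _ _ _ _) _; last by rewrite add0r.
  by apply/wt_scale/wt0M; exact: coef0.
by rewrite !mxE.
Qed.

Lemma wt_theta5 (i : 'I_6) : wt W (wdeg i) (fun p => theta5 f p 0 i).
Proof.
apply: (@wt_ext _ _ _ (fun p => (3%:R / 2%:R * pd3 f (x13 p)) * (i == ix2)%:R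
    - (2%:R^-1 * pd3 (pd3 f) (x13 p)) * theta1 p 0 i)) => [|p _].
  apply: wt_sub.
    apply: wt_deg (wt_mul_delta W 0 _ _ _ _) _; last by rewrite add0r subr0.
    exact/wt_scale/coef0.
  rewrite -[wdeg i]add0r; apply: wt_mul; last exact: wt_theta1.
  exact/wt_scale/coef0.
by rewrite /theta5 !mxE.
Qed.

Lemma wt_theta6 (i : 'I_6) : wt W (wdeg i - 1) (fun p => theta6 f p 0 i).
Proof.
apply: (@wt_ext _ _ _ (fun p =>
    (3%:R / 2%:R * (pd3 f (x13 p) * pd3 f (x13 p))) * (i == ix3)%:R
    + (2%:R^-1 * pd3 (pd1 f) (x13 p)) * theta2 f p 0 i)) => [|p _].
  apply: wt_add.
    apply: wt_deg (wt_mul_delta W 0 _ _ _ _) _; last by rewrite add0r.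
    by apply/wt_scale/wt0M; exact: coef0.
  rewrite -[_ - 1]add0r; apply: wt_mul; last exact: wt_theta2.
  exact/wt_scale/coef0.
by rewrite /theta6 !mxE.
Qed.

(** The forms theta^2, theta^4, theta^6 have defect 1, that is, no odd components; theta^1, theta^3,
    theta^5 have defect 0. Each product in Bryant's metric pairs the two kinds, while each product
    in Q has total defect 2, like the Ricci tensor. *)
Lemma wt_sprod d e (a b : 'cV[R]_6 -> 'rV[R]_6) :
  (forall i : 'I_6, wt W (wdeg i - d) (fun p => a p 0 i)) ->
  (forall i : 'I_6, wt W (wdeg i - e) (fun p => b p 0 i)) ->
  forall i j : 'I_6, wt W (wdeg i + wdeg j - (d + e)) (fun p => sprod (a p) (b p) i j).
Proof.
move=> wa wb i j; apply: (@wt_ext _ _ _ (fun p =>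
    2%:R^-1 * (a p 0 i * b p 0 j + b p 0 i * a p 0 j))) => [|p _].
  apply/wt_scale/wt_add.
    by apply: wt_deg (wt_mul _ _ _ _ _ (wa i) (wb j)) _; ring.
  by apply: wt_deg (wt_mul _ _ _ _ _ (wb i) (wa j)) _; ring.
by rewrite /sprod !mxE !big_ord1 !mxE.
Qed.

Lemma wt_g_bryant (i j : 'I_6) :
  wt W (wdeg i + wdeg j - 1) (fun p => g_bryant f p i j).
Proof.
have wt0 F k : wt W (wdeg k) F -> wt W (wdeg k - 0) F by rewrite subr0.
apply: (@wt_ext _ _ _ (fun p => 2%:R * sprod (theta1 p) (theta4 f p) i j
  + 2%:R * sprod (theta2 f p) (theta5 f p) i j
  + 2%:R * sprod (theta3 p) (theta6 f p) i j)) => [|p _].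
  apply: wt_add; [apply: wt_add|]; apply: wt_scale.
  - rewrite -[1]add0r; apply: wt_sprod => k; [exact/wt0/wt_theta1|exact: wt_theta4].
  - rewrite -[1]addr0; apply: wt_sprod => k; [exact: wt_theta2|exact/wt0/wt_theta5].
  - rewrite -[1]add0r; apply: wt_sprod => k; [exact/wt0/wt_theta3|exact: wt_theta6].
by rewrite /g_bryant [RHS]mxE [X in _ = X + _]mxE; congr (_ + _ + _); rewrite [RHS]mxE.
Qed.

Lemma sprod_sym {n : nat} (a b : 'rV[R]_n) : (sprod a b)^T = sprod a b.
Proof. by rewrite /sprod linearZ/= linearD/= !trmx_mul !trmxK addrC. Qed.

Lemma g_bryant_sym p : (g_bryant f p)^T = g_bryant f p.
Proof.
by rewrite /g_bryant !linearD/=; congr (_ + _ + _); rewrite linearZ/= sprod_sym.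
Qed.

Definition mixed (w : 'cV[R]_2) : 'M[R]_3 :=
  mixed_mx (w ord0 0) (f w) (pd3 f w) (pd3 (pd1 f) w) (pd3 (pd3 f) w).

Definition mixed_inv (w : 'cV[R]_2) : 'M[R]_3 :=
  mixed_inv_mx (w ord0 0) (f w) (pd3 f w) (pd3 (pd1 f) w) (pd3 (pd3 f) w).

Lemma g_bryant_mixed p i j : g_bryant f p (od6 i) (ev6 j) = mixed (x13 p) i j.
Proof.
rewrite /mixed (_ : x13 p ord0 0 = p ix1 0); last by rewrite mxE.
exact: (bryant_mx_mixed (p ix1 0) (p ix2 0) (f (x13 p)) (pd3 f (x13 p))
  (pd3 (pd1 f) (x13 p)) (pd3 (pd3 f) (x13 p))).
Qed.

Lemma g_bryant_even p i j : g_bryant f p (ev6 i) (ev6 j) =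
  p ix2 0 * even_mx (f (x13 p)) (pd3 f (x13 p)) (pd3 (pd3 f) (x13 p)) i j.
Proof.
exact: (bryant_mx_even (p ix1 0) (p ix2 0) (f (x13 p)) (pd3 f (x13 p)) (pd3 (pd1 f) (x13 p))).
Qed.

Lemma wt_mixed_inv i j : wt W 0 (fun p => mixed_inv (x13 p) i j).
Proof.
(* With the coefficients abstracted, each entry is a polynomial in X, A, B1, B3 and the inverse of
   [Iv], and the degree rules apply by its syntax. *)
have wt0 (X A B3 B1 Iv : 'cV[R]_6 -> R) : wt W 0 X -> wt W 0 A -> wt W 0 B3 ->
    wt W 0 B1 -> wt W 0 (fun p => (Iv p)^-1) ->
    wt W 0 (fun p => mixed_inv_mx (X p) (A p) (Iv p) (B1 p) (B3 p) i j).
  move=> wX wA wB3 wB1 wIv; move: i j; apply: ord3_ind; apply: ord3_ind;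
    under eq_fun do rewrite mxE/=;
    repeat first [assumption | apply: wt_sub | apply: wt_add | apply: wt_opp
    | apply: wt_scale | apply: wt0M | exact: wt_zero].
refine (wt0 (fun p => x13 p ord0 0) (fun p => f (x13 p)) (fun p => pd3 (pd3 f) (x13 p))
  (fun p => pd3 (pd1 f) (x13 p)) (fun p => pd3 f (x13 p)) _ _ _ _ _).
- exact: (coef0 _ (smooth_on_coord _ _)).
- exact: coef0.
- exact: coef0.
- exact: coef0.
- exact: (wt_coefV _ _ (pd3 f)).
Qed.

Lemma odd_g_bryant p : W (x13 p) ->
  rowsub od6 1%:M *m g_bryant f p *m (rowsub od6 1%:M)^T = 0.
Proof.
move=> Wp; rewrite rowsub_sandwich; apply/matrixP => i j; rewrite mxE [RHS]mxE.
apply: (wt_neg W _ (fun p => g_bryant f p (od6 i) (od6 j))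
  (wt_g_bryant (od6 i) (od6 j)) _ p Wp).
by rewrite !od6_deg.
Qed.

Lemma g_bryant_mixed_inv p : W (x13 p) ->
  rowsub od6 1%:M *m g_bryant f p *m (rowsub ev6 1%:M)^T *m mixed_inv (x13 p) = 1%:M.
Proof.
move=> Wp; rewrite rowsub_sandwich (_ : mxsub _ _ _ = mixed (x13 p)).
  by apply: mixed_mx_inv; exact: f3_neq0.
by apply/matrixP => i j; rewrite [LHS]mxE g_bryant_mixed.
Qed.

(** In the block form of the inverse the even-even part is 0, the mixed part is free of x^2, and the
    odd-odd part contains the even-even block of g once, hence x^2 at most linearly. *)
Lemma wt_invmx (i j : 'I_6) : wt W (1 - wdeg i - wdeg j) (fun p => invmx (g_bryant f p) i j).
Proof.
pose n : 'M[R]_(3, 6) := rowsub ev6 1%:M; pose v : 'M[R]_(3, 6) := rowsub od6 1%:M.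
have wn (a : 'I_3) (k : 'I_6) : wt W (1 - wdeg k) (fun=> n a k).
  rewrite mxE [_%:M _ _]mxE; case: eqVneq => [<-|_]; last exact: wt_zero.
  by rewrite ev6_deg subrr; exact: wt_cst.
have wv (a : 'I_3) (k : 'I_6) : wt W (- wdeg k) (fun=> v a k).
  rewrite mxE [_%:M _ _]mxE; case: eqVneq => [<-|_]; last exact: wt_zero.
  by rewrite od6_deg oppr0; exact: wt_cst.
have wMi a b : wt W (0 + 0) (fun p => mixed_inv (x13 p) a b) by exact: wt_mixed_inv.
have wMit a b : wt W (0 + 0) (fun p => (mixed_inv (x13 p))^T a b).
  by apply: (wt_ext _ _ _ _ (wt_mixed_inv b a)) => p _; rewrite [RHS]mxE.
have wnt (k : 'I_6) (a : 'I_3) : wt W (1 - wdeg k) (fun=> n^T k a) by rewrite mxE; exact: wn.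
have wvt (k : 'I_6) (a : 'I_3) : wt W (- wdeg k) (fun=> v^T k a) by rewrite mxE; exact: wv.
have wS a b : wt W (1 + 0) (fun p => (n *m g_bryant f p *m n^T) a b).
  apply: (wt_ext _ _ _ _ (wt_deg _ _ _ _ (wt_g_bryant (ev6 a) (ev6 b)) _)); last first.
    by move=> p _; rewrite rowsub_sandwich [RHS]mxE.
  by rewrite !ev6_deg.
apply: (@wt_ext _ _ _ (fun p => (n^T *m mixed_inv (x13 p) *m v) i j
    + (v^T *m (mixed_inv (x13 p))^T *m n) i j
    - (v^T *m (mixed_inv (x13 p))^T *m (n *m g_bryant f p *m n^T)
         *m mixed_inv (x13 p) *m v) i j)) => [|p Wp]; last first.
  rewrite [in RHS](null_splitting_inverse n v _ _ splitting6 (g_bryant_sym _)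
    (odd_g_bryant _ Wp) (g_bryant_mixed_inv _ Wp)).
  by rewrite [RHS]mxE [X in _ = X + _]mxE; congr (_ + _); rewrite [RHS]mxE.
apply: wt_sub; [apply: wt_add|].
- apply: wt_deg (wt_mulmx W _ (fun=> v) (fun k : 'I_6 => 1 - wdeg k + 0) (fun k : 'I_6 => - wdeg k)
    (wt_mulmx W (fun=> n^T) _ (fun k : 'I_6 => 1 - wdeg k) (fun=> 0) wnt wMi) wv i j) _.
  by rewrite addr0.
- apply: wt_deg (wt_mulmx W _ (fun=> n) (fun k : 'I_6 => - wdeg k + 0) (fun k : 'I_6 => 1 - wdeg k)
    (wt_mulmx W (fun=> v^T) _ (fun k : 'I_6 => - wdeg k) (fun=> 0) wvt wMit) wn i j) _.
  by ring.
- apply: wt_deg (wt_mulmx W _ (fun=> v) (fun k : 'I_6 => - wdeg k + 0 + 1 + 0)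
   (fun k : 'I_6 => - wdeg k)
   (wt_mulmx W _ _ (fun k : 'I_6 => - wdeg k + 0 + 1) (fun=> 0)
    (wt_mulmx W _ _ (fun k : 'I_6 => - wdeg k + 0) (fun=> 1)
     (wt_mulmx W (fun=> v^T) _ (fun k : 'I_6 => - wdeg k) (fun=> 0) wvt wMit) wS) wMi) wv i j) _.
  by ring.
Qed.

Lemma wt_christoffel (k i j : 'I_6) :
  wt W (wdeg i + wdeg j - wdeg k - 1) (christoffel (g_bryant f) k i j).
Proof.
apply/wt_scale/wt_sum => l.
have wd (a b c : 'I_6) : wt W (wdeg a + wdeg b + wdeg c - 2%:R)
    (partial a (fun q => g_bryant f q b c)).
  by apply: wt_deg (wt_partial _ _ _ a W_open (wt_g_bryant b c)) _; ring.
apply: wt_deg (wt_mul _ _ (wdeg i + wdeg j + wdeg l - 2%:R) _ _ (wt_invmx k l) _) _; last by ring.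
apply: wt_sub; first apply: wt_add.
- by apply: wt_deg (wd i l j) _; ring.
- by apply: wt_deg (wd j l i) _; ring.
- by apply: wt_deg (wd l i j) _; ring.
Qed.

Lemma wt_riemann (l k i j : 'I_6) :
  wt W (wdeg i + wdeg j + wdeg k - wdeg l - 2%:R) (riemann (g_bryant f) l k i j).
Proof.
apply: wt_add; first apply: wt_sub.
- by apply: wt_deg (wt_partial _ _ _ i W_open (wt_christoffel l j k)) _; ring.
- by apply: wt_deg (wt_partial _ _ _ j W_open (wt_christoffel l i k)) _; ring.
- apply: wt_sum => m; apply: wt_sub.
    by apply: wt_deg (wt_mul _ _ _ _ _ (wt_christoffel l i m) (wt_christoffel m j k)) _; ring.
  by apply: wt_deg (wt_mul _ _ _ _ _ (wt_christoffel l j m) (wt_christoffel m i k)) _; ring.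
Qed.

Lemma wt_ricci (k j : 'I_6) :
  wt W (wdeg k + wdeg j - 2%:R) (fun p => ricci (g_bryant f) p k j).
Proof.
apply: (@wt_ext _ _ _ (fun p => \sum_i riemann (g_bryant f) i k i j p)) => [|p _].
  by apply: wt_sum => i; apply: wt_deg (wt_riemann i k i j) _; ring.
by rewrite mxE.
Qed.

Lemma scal_g_bryant p : W (x13 p) -> scal (g_bryant f) p = 0.
Proof.
move=> Wp; have wsc : wt W (-1) (scal (g_bryant f)).
  apply: (@wt_ext _ _ _ (fun p => \sum_i \sum_k
      invmx (g_bryant f p) i k * ricci (g_bryant f) p k i)) => [|q _].
    apply: wt_sum => i; apply: wt_sum => k.
    by apply: wt_deg (wt_mul _ _ _ _ _ (wt_invmx i k) (wt_ricci k i)) _; ring.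
  by apply: eq_bigr => i _; rewrite mxE.
exact: (wt_neg _ _ _ wsc).
Qed.

Lemma schouten6E p : W (x13 p) ->
  schouten6 (g_bryant f) p = 4%:R^-1 *: ricci (g_bryant f) p.
Proof. by move=> Wp; rewrite /schouten6 scal_g_bryant// mul0r scale0r subr0. Qed.

Lemma wt_schouten (i j : 'I_6) :
  wt W (wdeg i + wdeg j - 2%:R) (fun p => schouten6 (g_bryant f) p i j).
Proof.
apply: (wt_ext _ _ _ _ (wt_scale _ _ _ 4%:R^-1 (wt_ricci i j))) => p Wp.
by rewrite schouten6E// [RHS]mxE.
Qed.

Lemma christoffel_g_bryant_sym (k i j : 'I_6) :
  christoffel (g_bryant f) k i j = christoffel (g_bryant f) k j i.
Proof.
apply: funext => p; rewrite /christoffel; congr (_ * _); apply: eq_bigr => l _; congr (_ * _).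
rewrite [in LHS](addrC (partial i _ p)).
rewrite (_ : (fun q => g_bryant f q i j) = (fun q => g_bryant f q j i))//.
by apply: funext => q; rewrite -[in LHS]g_bryant_sym [LHS]mxE.
Qed.

(** The sum is half the trace of g^-1 d_k g, the logarithmic derivative of the square root of |det
    g|; this root is the absolute value of the determinant 27/8 f_3^5 of the mixed block. *)
Lemma sum_christoffel_g_bryant (k : 'I_6) p : W (x13 p) ->
  \sum_i christoffel (g_bryant f) i i k p =
  5%:R * partial k (fun q => pd3 f (x13 q)) p * (pd3 f (x13 p))^-1.
Proof.
move=> Wp; pose g := g_bryant f; pose H := invmx (g p).
pose D : 'M[R]_6 := \matrix_(i, j) partial k (fun q => g q i j) p.
have Hsym : H^T = H by rewrite /H trmx_inv g_bryant_sym.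
have psym a b c : partial a (fun q => g q b c) p = partial a (fun q => g q c b) p.
  congr (partial a _ p); apply: funext => q.
  by rewrite /g -[in LHS]g_bryant_sym [LHS]mxE.
have HD : \sum_i christoffel g i i k p = 2%:R^-1 * \tr (H *m D).
  rewrite /christoffel -big_distrr/=; congr (_ * _).
  have trE : \tr (H *m D) = \sum_i \sum_l H i l * partial k (fun q => g q l i) p.
    by apply: eq_bigr => i _; rewrite mxE; apply: eq_bigr => l _; rewrite mxE.
  (* The symmetric H is contracted with an expression antisymmetric in i and l, so only the
     derivative along k survives. *)
  have anti : \sum_i \sum_l H i l * (partial i (fun q => g q l k) p
      - partial l (fun q => g q i k) p) = 0.
    have -> (A B : 'I_6 -> 'I_6 -> R) : \sum_i \sum_l H i l * (A i l - B i l) =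
        \sum_i \sum_l H i l * A i l - \sum_i \sum_l H i l * B i l.
      rewrite -sumrB; apply: eq_bigr => i _; rewrite -sumrB; apply: eq_bigr => l _.
      by rewrite mulrBr.
    apply/eqP; rewrite subr_eq0 [X in _ == X]exchange_big/=; apply/eqP.
    by apply: eq_bigr => i _; apply: eq_bigr => l _; rewrite -{1}Hsym mxE.
  apply: etrans (etrans (congr1 (+%R (\tr (H *m D))) anti) (addr0 _)); rewrite trE.
  rewrite -big_split/=; apply: eq_bigr => i _.
  rewrite -big_split/=; apply: eq_bigr => l _; rewrite -mulrDr; congr (_ * _).
  by rewrite -/g; ring.
rewrite HD; pose n : 'M[R]_(3, 6) := rowsub ev6 1%:M; pose v : 'M[R]_(3, 6) := rowsub od6 1%:M.
have Wx := open_x13 _ W_open.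
have vDv : v *m D *m v^T = 0.
  rewrite rowsub_sandwich; apply/matrixP => i j; rewrite mxE [LHS]mxE [RHS]mxE.
  rewrite (partial_near _ _ (fun=> 0) _ _ Wx Wp) ?partial_cst// => q Wq.
  have := odd_g_bryant q Wq; rewrite rowsub_sandwich => /matrixP/(_ i j).
  by rewrite mxE [RHS]mxE.
have dcoef a : smooth_on W a ->
    is_derive p (dvec k) (fun q => a (x13 q)) (partial k (fun q => a (x13 q)) p).
  move=> sa; apply: derivableP; apply: diff_derivable.
  exact: differentiable_comp_x13 sa Wp.
have [dM vDn trM] : exists2 dM, v *m D *m n^T = dM & \tr (mixed_inv (x13 p) *m dM) =
    5%:R * partial k (fun q => pd3 f (x13 q)) p * (pd3 f (x13 p))^-1.
  pose d a := partial k (fun q => a (x13 q)) p.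
  exists (dmixed_mx (x13 p ord0 0) (f (x13 p)) (pd3 f (x13 p)) (pd3 (pd1 f) (x13 p))
    (pd3 (pd3 f) (x13 p)) (d (fun w => w ord0 0)) (d f) (d (pd3 f)) (d (pd3 (pd1 f)))
    (d (pd3 (pd3 f)))); last exact: tr_mixed_inv_dmixed (f3_neq0 _ Wp).
  rewrite rowsub_sandwich; apply/matrixP => i j; rewrite mxE [LHS]mxE.
  have -> : (fun q => g q (od6 i) (ev6 j)) = (fun q => mixed (x13 q) i j).
    by apply: funext => q; exact: g_bryant_mixed.
  apply: derive_val.
  exact: (is_derive_mixed _ _ _ _ _ _ _ _ _ _ _ _ (dcoef _ (smooth_on_coord _ ord0))
    (dcoef _ f_smooth) (dcoef _ f3_smooth) (dcoef _ f13_smooth) (dcoef _ f33_smooth)).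
have Dsym : D^T = D by apply/matrixP => i j; rewrite !mxE psym.
rewrite /H (null_splitting_inverse n v _ _ splitting6 (g_bryant_sym _)
    (odd_g_bryant _ Wp) (g_bryant_mixed_inv _ Wp)).
(* The two mixed blocks of the inverse contribute equal traces, which absorbs the factor 1/2; the
   remaining term meets only the odd-odd block of D, which is 0. *)
rewrite mulmxBl mulmxDl linearB/= linearD/= -trM -vDn.
have -> : \tr (n^T *m mixed_inv (x13 p) *m v *m D) = \tr (mixed_inv (x13 p) *m (v *m D *m n^T)).
  by rewrite -!mulmxA mxtrace_mulC !mulmxA.
have -> : \tr (v^T *m (mixed_inv (x13 p))^T *m n *m D) = \tr (mixed_inv (x13 p) *m (v *m D *m n^T)).
  rewrite -[LHS]mxtrace_tr !trmx_mul !trmxK Dsym !mulmxA -[X in \tr X = _]mulmxA.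
  by rewrite [LHS]mxtrace_mulC !mulmxA.
have -> A : \tr (v^T *m (mixed_inv (x13 p))^T *m A *m mixed_inv (x13 p) *m v *m D) = 0.
  by rewrite -!mulmxA mxtrace_mulC -!mulmxA (mulmxA v) vDv !mulmx0 mxtrace0.
by rewrite subr0; move: (\tr _) => t; field.
Qed.

(** As the connection is torsion-free, the divergence term and the first quadratic term are
    symmetric, and the second quadratic term is so after exchanging i and m. What remains is the
    derivative of the trace of the connection, the Hessian of 5 log |f_3|. *)
Lemma ricci_g_bryant_sym p : W (x13 p) ->
  (ricci (g_bryant f) p)^T = ricci (g_bryant f) p.
Proof.
move=> Wp; apply/matrixP => j k; rewrite mxE [LHS]mxE [RHS]mxE.
have Wx := open_x13 _ W_open.
have ratio (u v w y : R) : (0 * v + 5%:R * u) * y + (5%:R * v) * - (w * (y * y)) =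
    5%:R * (u * y - v * w * (y * y)) by ring.
have dT a b : \sum_i partial a (christoffel (g_bryant f) i i b) p =
    5%:R * (partial a (partial b (fun q => pd3 f (x13 q))) p * (pd3 f (x13 p))^-1
      - partial b (fun q => pd3 f (x13 q)) p * partial a (fun q => pd3 f (x13 q)) p
        * ((pd3 f (x13 p))^-1 * (pd3 f (x13 p))^-1)).
  have wF : wt W 0 (fun q => pd3 f (x13 q)) by exact: coef0.
  have wdF := wt_partial _ _ _ b W_open wF.
  have dchr i : is_derive p (dvec a) (christoffel (g_bryant f) i i b)
      (partial a (christoffel (g_bryant f) i i b) p).
    apply: derivableP; apply: diff_derivable.
    exact: wt_differentiable W_open (wt_christoffel i i b) _ Wp.
  have dsum := is_derive_bigsum (index_enum 'I_6) predT _ _ _ _ dchr.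
  rewrite -(@derive_val _ _ _ _ _ _ _ dsum) -/(partial a _ p).
  rewrite (partial_near _ _ _ _ _ Wx Wp (fun q Wq => sum_christoffel_g_bryant b q Wq)).
  have dF q : W (x13 q) -> differentiable (fun q => pd3 f (x13 q)) q.
    by move=> Wq; exact: wt_differentiable W_open wF _ Wq.
  have ddF := wt_differentiable _ _ _ W_open wdF _ Wp.
  have dc : differentiable (fun=> 5%:R : R) p by exact: differentiable_cst.
  have dcF := differentiableM dc ddF.
  have dV := differentiableV (dF _ Wp) (f3_neq0 _ Wp).
  rewrite (partialM _ _ _ _ dcF dV) (partialM _ _ _ _ dc ddF) partial_cst.
  rewrite (partialV _ _ _ (dF _ Wp) (f3_neq0 _ Wp)).
  exact: ratio.
have S a b : \sum_i riemann (g_bryant f) i a i b p =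
    \sum_i partial i (christoffel (g_bryant f) i b a) p
    - \sum_i partial b (christoffel (g_bryant f) i i a) p
    + \sum_i \sum_m (christoffel (g_bryant f) i i m p * christoffel (g_bryant f) m b a p
       - christoffel (g_bryant f) i b m p * christoffel (g_bryant f) m i a p).
  by rewrite -sumrB -big_split.
apply: (etrans (S k j)); apply: (etrans _ (esym (S j k))).
have abc (a a' b b' c c' : R) : a = a' -> b = b' -> c = c' -> a - b + c = a' - b' + c'.
  by move=> -> -> ->.
have comm (c x u v y z : R) : c * (x * y - u * v * z) = c * (x * y - v * u * z) by ring.
apply: abc.
- by apply: eq_bigr => i _; rewrite christoffel_g_bryant_sym.
- apply: (etrans (dT _ _)); apply: (etrans _ (esym (dT _ _))).
  rewrite (wt_schwarz _ 0 _ _ _ _ W_open (coef0 _ f3_smooth) Wp).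
  exact: comm.
- have split_sum (A B : 'I_6 -> 'I_6 -> R) : \sum_i \sum_m (A i m - B i m) =
      \sum_i \sum_m A i m - \sum_i \sum_m B i m.
    by rewrite -sumrB; apply: eq_bigr => i _; rewrite sumrB.
  apply: (etrans (split_sum _ _)); apply: (etrans _ (esym (split_sum _ _))).
  apply: congr2.
    by apply: eq_bigr => i _; apply: eq_bigr => m _; rewrite (christoffel_g_bryant_sym m).
  rewrite exchange_big/=; congr (- _); apply: eq_bigr => i _; apply: eq_bigr => m _.
  by rewrite mulrC (christoffel_g_bryant_sym m) (christoffel_g_bryant_sym i).
Qed.
End bryant.

(** * The ambient metric *)

Lemma ord31_ind (P : 'I_(3 + 1) -> Prop) :
  (forall a : 'I_3, P (lshift 1 a)) -> P (rshift 3 ord0) -> forall i, P i.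
Proof.
move=> Pl Pr i; rewrite -[i](@fintype.splitK 3 1).
case: (fintype.split i) => [a|a] /=; first exact: Pl.
by rewrite (ord1 a).
Qed.

(** The size is kept as 3 + 1 so that the splitting into base directions and the direction of t (for
    [od8], of rho) matches block matrices. *)
Definition ev8 (i : 'I_(3 + 1)) : 'I_(6 + 2) :=
  if fintype.split i is inl a then base (ev6 a) else it.
Definition od8 (i : 'I_(3 + 1)) : 'I_(6 + 2) :=
  if fintype.split i is inl a then base (od6 a) else irho.

Lemma ev8l a : ev8 (lshift 1 a) = base (ev6 a).
Proof. by rewrite /ev8 (fintype.unsplitK (inl _ a)). Qed.
Lemma ev8r : ev8 (rshift 3 ord0) = it.
Proof. by rewrite /ev8 (fintype.unsplitK (inr _ ord0)). Qed.
Lemma od8l a : od8 (lshift 1 a) = base (od6 a).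
Proof. by rewrite /od8 (fintype.unsplitK (inl _ a)). Qed.
Lemma od8r : od8 (rshift 3 ord0) = irho.
Proof. by rewrite /od8 (fintype.unsplitK (inr _ ord0)). Qed.

Lemma base_inj : injective base.
Proof. exact: lshift_inj. Qed.

Lemma base_it i : (base i == it) = false.
Proof. by apply/negP => /eqP/(congr1 val)/= E; case: i E => i /= i6 E; rewrite E in i6. Qed.

Lemma base_irho i : (base i == irho) = false.
Proof. by apply/negP => /eqP/(congr1 val)/= E; case: i E => i /= i6 E; rewrite E in i6. Qed.

Lemma ord8_ind (P : 'I_(6 + 2) -> Prop) :
  (forall a, P (base a)) -> P it -> P irho -> forall i, P i.
Proof.
move=> Pb Pt Pr i; rewrite -[i](@fintype.splitK 6 2).
case: (fintype.split i) => [a|a] /=; first exact: Pb.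
case: a => [[|[|//]] a2].
- by rewrite (_ : Ordinal a2 = ord0)//; exact: val_inj.
- by rewrite (_ : Ordinal a2 = ord_max)//; exact: val_inj.
Qed.

Lemma ev6_inj : injective ev6.
Proof. by apply: ord3_ind; apply: ord3_ind. Qed.
Lemma od6_inj : injective od6.
Proof. by apply: ord3_ind; apply: ord3_ind. Qed.
Lemma ev6_od6 a b : ev6 a != od6 b.
Proof. by move: a b; apply: ord3_ind; apply: ord3_ind. Qed.

Lemma cover8 (i : 'I_(6 + 2)) : (exists a, i = ev8 a) \/ (exists b, i = od8 b).
Proof.
move: i; apply: ord8_ind => [i||].
- case: (cover6 i) => -[a ->]; [left|right]; exists (lshift 1 a).
    by rewrite ev8l.
  by rewrite od8l.
- by left; exists (rshift 3 ord0); rewrite ev8r.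
- by right; exists (rshift 3 ord0); rewrite od8r.
Qed.

Lemma splitting8 {R : realType} :
  splitting (rowsub ev8 1%:M : 'M[R]_(3 + 1, 6 + 2)) (rowsub od8 1%:M).
Proof.
apply: splitting_rowsub; last exact: cover8.
- apply: ord31_ind => [a|]; apply: ord31_ind => [b|]; rewrite ?ev8l ?ev8r//.
  + by move=> /base_inj/ev6_inj ->.
  + by move=> /eqP; rewrite base_it.
  + by move=> /eqP; rewrite eq_sym base_it.
- apply: ord31_ind => [a|]; apply: ord31_ind => [b|]; rewrite ?od8l ?od8r//.
  + by move=> /base_inj/od6_inj ->.
  + by move=> /eqP; rewrite base_irho.
  + by move=> /eqP; rewrite eq_sym base_irho.
- apply: ord31_ind => [a|]; apply: ord31_ind => [b|]; rewrite ?ev8l ?ev8r ?od8l ?od8r.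
  + by rewrite (inj_eq base_inj) ev6_od6.
  + by rewrite base_irho.
  + by rewrite eq_sym base_it.
  + by [].
Qed.

Lemma pr6_affine {R : realType} (p v : 'cV[R]_(6 + 2)) (h : R) :
  pr6 (h *: v + p) = h *: pr6 v + pr6 p.
Proof. by apply/matrixP => i j; rewrite !mxE. Qed.

Lemma differentiable_pr6 {R : realType} (p : 'cV[R]_(6 + 2)) : differentiable (@pr6 R) p.
Proof.
apply: differentiable_cV => i.
rewrite (_ : (fun q => _) = (fun q : 'cV[R]_(6 + 2) => q (base i) 0)).
  exact: differentiable_coord_fun.
by apply: funext => q; rewrite mxE.
Qed.

Lemma differentiable_comp_pr6 {R : realType} (F : 'cV[R]_6 -> R) p :
  differentiable F (pr6 p) -> differentiable (fun q => F (pr6 q)) p.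
Proof.
by move=> dF; apply: (differentiable_comp (f := @pr6 R)); first exact: differentiable_pr6.
Qed.

Lemma partial_pr6 {R : realType} (F : 'cV[R]_6 -> R) p i :
  partial (base i) (fun q => F (pr6 q)) p = partial i F (pr6 p).
Proof.
rewrite /partial (derive_comp_affine (@pr6 R) F p _ (pr6 (dvec (base i)))); last first.
  by move=> h; exact: pr6_affine.
congr ('D__ F _); apply/matrixP => k j; rewrite (ord1 j) !mxE.
by rewrite (inj_eq base_inj).
Qed.

Lemma partial_pr6_0 {R : realType} (F : 'cV[R]_6 -> R) p k :
  k = it \/ k = irho -> partial k (fun q => F (pr6 q)) p = 0.
Proof.
move=> kE; rewrite /partial (derive_comp_affine (@pr6 R) F p _ (pr6 (dvec k))); last first.
  by move=> h; exact: pr6_affine.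
have -> : pr6 (dvec k : 'cV[R]_(6 + 2)) = 0.
  apply/matrixP => i j; rewrite (ord1 j) !mxE -/(base i).
  by case: kE => ->; rewrite ?base_it ?base_irho.
exact: derive0.
Qed.

Section ambient.
Context {R : realType} (W : set 'cV[R]_2) (f : 'cV[R]_2 -> R) (Q : 'cV[R]_6 -> 'M[R]_6).
Hypotheses (W_open : open W) (f_smooth : smooth_on W f)
  (f3_neq0 : forall w, W w -> pd3 f w != 0) (Q_span : in_spanA W f Q).

Lemma wt_Q (i j : 'I_6) : wt W (wdeg i + wdeg j - 2%:R) (fun p => Q p i j).
Proof.
have [q [qs QE]] := Q_span.
have wth (a : 'I_3) (k : 'I_6) : wt W (wdeg k - 1) (fun p => theta246 f a p 0 k).
  elim/ord3_ind: a => /=.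
  - exact: (wt_theta2 W f f_smooth).
  - exact: (wt_theta4 W f f_smooth).
  - exact: (wt_theta6 W f f_smooth).
apply: (@wt_ext _ _ _ (fun p => \sum_(a < 3) \sum_(b < 3)
    q a b (x13 p) * sprod (theta246 f a p) (theta246 f b p) i j)).
  apply: wt_sum => a; apply: wt_sum => b; rewrite -[_ - 2%:R]add0r; apply: wt_mul.
    exact: (wt_coef _ _ (q a b)).
  apply: wt_deg (wt_sprod W 1 1 (theta246 f a) (theta246 f b) _ _ i j) _ => //.
move=> p Wp; rewrite QE// summxE; apply: eq_bigr => a _; rewrite summxE.
by apply: eq_bigr => b _; rewrite [RHS]mxE.
Qed.

Lemma Q_sym p : W (x13 p) -> (Q p)^T = Q p.
Proof.
have [q [_ QE]] := Q_span => Wp; rewrite QE// linear_sum; apply: eq_bigr => a _.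
by rewrite linear_sum; apply: eq_bigr => b _; rewrite linearZ/= sprod_sym.
Qed.

Lemma schouten_sym p : W (x13 p) ->
  (schouten6 (g_bryant f) p)^T = schouten6 (g_bryant f) p.
Proof.
move=> Wp; rewrite (schouten6E W)// linearZ/=.
by rewrite (ricci_g_bryant_sym W).
Qed.

Let g := g_ambient f Q.
Let dom : set 'cV[R]_(6 + 2) := [set p | W (x13 (pr6 p))].

Lemma open_dom : open dom.
Proof.
apply: (open_comp (f := @pr6 R)) (open_x13 _ W_open) => p _.
exact/differentiable_continuous/differentiable_pr6.
Qed.

Lemma dfun_rho_t (p : 'cV[R]_(6 + 2)) k :
  dfun (fun q => rhoc q * tc q) p 0 k = (irho == k)%:R * tc p + rhoc p * (it == k)%:R.
Proof.
rewrite mxE partialM; [|exact: differentiable_coord_fun..].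
by rewrite (partial_coord k irho) (partial_coord k it).
Qed.

Lemma g_ambientE p i j : g p i j =
  dfun (fun q => rhoc q * tc q) p 0 i * (j == it)%:R
  + (i == it)%:R * dfun (fun q => rhoc q * tc q) p 0 j
  + tc p ^+ 2 * pull_sym (g_bryant f (pr6 p)
      + (2%:R * rhoc p) *: schouten6 (g_bryant f) (pr6 p) + rhoc p ^+ 3 *: Q (pr6 p)) i j.
Proof.
have addZ (c : R) (A B : 'M[R]_(6 + 2)) : (2%:R *: A + c *: B) i j = 2%:R * A i j + c * B i j.
  by rewrite !mxE.
rewrite /g /g_ambient addZ; congr (_ + _).
rewrite /sprod mxE mulrA mulfV ?pnatr_eq0// mul1r.
move: (dfun _ _) => d; rewrite !mxE !big_ord1 !mxE eqxx/=.
by congr (_ + _).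
Qed.

Lemma g_ambient_bb p i j : g p (base i) (base j) =
  tc p ^+ 2 * (g_bryant f (pr6 p) i j + 2%:R * rhoc p * schouten6 (g_bryant f) (pr6 p) i j
    + rhoc p ^+ 3 * Q (pr6 p) i j).
Proof.
rewrite g_ambientE !base_it mulr0 mul0r !add0r; congr (_ * _).
have addZ (A B C : 'M[R]_6) (c d : R) :
    (A + c *: B + d *: C) i j = A i j + c * B i j + d * C i j by rewrite !mxE.
by rewrite /pull_sym block_mxEul addZ.
Qed.

Lemma g_ambient_br p i k : k = it \/ k = irho -> g p (base i) k = 0.
Proof.
move=> kE; rewrite g_ambientE base_it mul0r addr0 dfun_rho_t.
have -> : (irho == base i) = false by rewrite eq_sym base_irho.
have -> : (it == base i) = false by rewrite eq_sym base_it.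
rewrite mul0r mulr0 addr0 mul0r add0r.
have [r ->] : exists r, k = rshift 6 r by case: kE => ->; [exists ord0|exists ord_max].
by rewrite /pull_sym block_mxEur mxE mulr0.
Qed.

Lemma g_ambient_rr p r s : g p (rshift 6 r) (rshift 6 s) =
  ((irho == rshift 6 r)%:R * tc p + rhoc p * (it == rshift 6 r)%:R) * (rshift 6 s == it)%:R
  + (rshift 6 r == it)%:R * ((irho == rshift 6 s)%:R * tc p + rhoc p * (it == rshift 6 s)%:R).
Proof.
by rewrite g_ambientE !dfun_rho_t /pull_sym block_mxEdr mxE mulr0 addr0.
Qed.

Lemma g_ambient_tt p : g p it it = 2%:R * rhoc p.
Proof.
have := g_ambient_rr p ord0 ord0; rewrite -/it eqxx (_ : (irho == it) = false)// => ->; rewrite /=.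
by ring.
Qed.

Lemma g_ambient_rt p : g p irho it = tc p.
Proof.
have := g_ambient_rr p ord_max ord0; rewrite -/it -/irho !eqxx.
by rewrite (_ : (irho == it) = false)// (_ : (it == irho) = false)// => -> /=; ring.
Qed.

Lemma g_ambient_irho p : g p irho irho = 0.
Proof.
have := g_ambient_rr p ord_max ord_max; rewrite -/irho !eqxx.
by rewrite (_ : (irho == it) = false)// => -> /=; ring.
Qed.

Lemma pull_sym_sym (h : 'M[R]_6) : h^T = h -> (pull_sym h)^T = pull_sym h.
Proof. by move=> hs; rewrite /pull_sym tr_block_mx !trmx0 hs. Qed.

Lemma g_ambient_sym p : dom p -> (g p)^T = g p.
Proof.
move=> Wp; have trD (m : nat) (A B : 'M[R]_m) (c : R) : A^T = A -> B^T = B ->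
    (A + c *: B)^T = A + c *: B.
  by move=> sA sB; rewrite linearD linearZ/= sA sB.
apply: (trD _ _ _ _); first by rewrite linearZ/= sprod_sym.
apply/pull_sym_sym/(trD _ _ _ _); last exact: Q_sym.
by apply: (trD _ _ _ _); [exact: g_bryant_sym|exact: schouten_sym].
Qed.

Lemma odd_g_ambient p i j : dom p -> g p (od8 i) (od8 j) = 0.
Proof.
move=> Wp; move: i j; apply: ord31_ind => [a|]; apply: ord31_ind => [b|];
  rewrite ?od8l ?od8r.
- have odd0 (F : 'cV[R]_6 -> R) (d : int) : d < 0 ->
      wt W (wdeg (od6 a) + wdeg (od6 b) + d) F -> F (pr6 p) = 0.
    by move=> d0 wF; apply: (wt_neg _ _ _ wF) => //; rewrite !od6_deg !add0r.
  rewrite g_ambient_bb (odd0 _ _ _ (wt_g_bryant W f f_smooth _ _))//.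
  rewrite (odd0 _ _ _ (wt_schouten W f W_open f_smooth f3_neq0 _ _))//.
  by rewrite (odd0 _ _ _ (wt_Q _ _))// !mulr0 !addr0 mulr0.
- by rewrite g_ambient_br//; right.
- have := g_ambient_sym p Wp => /matrixP/(_ irho (base (od6 b))).
  by rewrite mxE => <-; rewrite g_ambient_br//; right.
- exact: g_ambient_irho.
Qed.

(** P and Q have degree -1 on a pair of an odd and an even base direction, so only Bryant's metric
    contributes to the base block. *)
Lemma g_ambient_mixed p i j : dom p -> g p (od8 i) (ev8 j) =
  (block_mx (tc p ^+ 2 *: mixed f (x13 (pr6 p))) 0 0 (tc p)%:M : 'M[R]_(3 + 1)) i j.
Proof.
move=> Wp; move: i j; apply: ord31_ind => [a|]; apply: ord31_ind => [b|];
  rewrite ?od8l ?od8r ?ev8l ?ev8r.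
- have odd0 (F : 'cV[R]_6 -> R) (d : int) : d < - 1 ->
      wt W (wdeg (od6 a) + wdeg (ev6 b) + d) F -> F (pr6 p) = 0.
    move=> d0 wF; apply: (wt_neg _ _ _ wF) => //; rewrite od6_deg ev6_deg add0r.
    by rewrite -ltrBrDl sub0r.
  rewrite g_ambient_bb (odd0 _ _ _ (wt_schouten W f W_open f_smooth f3_neq0 _ _))//.
  rewrite (odd0 _ _ _ (wt_Q _ _))// !mulr0 !addr0 block_mxEul [RHS]mxE.
  by rewrite g_bryant_mixed.
- by rewrite g_ambient_br ?block_mxEur ?[RHS]mxE//; left.
- have := g_ambient_sym p Wp => /matrixP/(_ irho (base (ev6 b))).
  by rewrite mxE => <-; rewrite g_ambient_br ?block_mxEdl ?[RHS]mxE//; right.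
- by rewrite g_ambient_rt block_mxEdr mxE eqxx mulr1n.
Qed.

Lemma differentiable_g_ambient p i j : dom p -> differentiable (fun q => g q i j) p.
Proof.
move=> Wp; have Wdom := open_dom.
have dt : differentiable (fun q : 'cV[R]_(6 + 2) => tc q) p by exact: differentiable_coord_fun.
have dr : differentiable (fun q : 'cV[R]_(6 + 2) => rhoc q) p by exact: differentiable_coord_fun.
have dc (c : R) : differentiable (fun _ : 'cV[R]_(6 + 2) => c) p by exact: differentiable_cst.
have dX (F : 'cV[R]_(6 + 2) -> R) n : differentiable F p -> differentiable (fun q => F q ^+ n.+1) p.
  move=> dF; have -> : (fun q => F q ^+ n.+1) = F ^+ n.+1 by apply: funext => q; rewrite exprfctE.
  exact: (@differentiableX _ _ F n p dF).
have dpr F d : wt W d F -> differentiable (fun q => F (pr6 q)) p.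
  by move=> wF; apply: differentiable_comp_pr6; exact: wt_differentiable W_open wF _ Wp.
have sym a b : (forall p, dom p -> g p a b = g p b a).
  by move=> q Wq; rewrite -[in LHS](g_ambient_sym q Wq) mxE.
have base_case a k : differentiable (fun q => g q (base a) k) p.
  move: k; apply: ord8_ind => [b||].
  - rewrite (_ : (fun q => _) = (fun q => tc q ^+ 2 * (g_bryant f (pr6 q) a b
      + 2%:R * rhoc q * schouten6 (g_bryant f) (pr6 q) a b + rhoc q ^+ 3 * Q (pr6 q) a b))).
      have dg := dpr _ _ (wt_g_bryant W f f_smooth a b).
      have ds := dpr _ _ (wt_schouten W f W_open f_smooth f3_neq0 a b).
      have dq := dpr _ _ (wt_Q a b).
      apply: differentiableM; first exact: dX.
      apply: differentiableD; last by apply: differentiableM => //; exact: dX.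
      apply: differentiableD => //; apply: differentiableM => //.
      by apply: differentiableM.
    by apply: funext => q; exact: g_ambient_bb.
  - rewrite (_ : (fun q => _) = fun=> 0)//.
    by apply: funext => q; apply: g_ambient_br; left.
  - rewrite (_ : (fun q => _) = fun=> 0)//.
    by apply: funext => q; apply: g_ambient_br; right.
have base_r (k : 'I_(6 + 2)) b : differentiable (fun q => g q k (base b)) p.
  by apply: (differentiable_near _ _ _ _ Wdom Wp (sym (base b) k)); exact: base_case.
move: i; apply: ord8_ind => [a||]; first exact: base_case.
- move: j; apply: ord8_ind => [b||]; first exact: base_r.
  + rewrite (_ : (fun q => _) = fun q => 2%:R * rhoc q); first exact: differentiableM.
    by apply: funext => q; exact: g_ambient_tt.
  + apply: (differentiable_near _ _ _ _ Wdom Wp (sym irho it)).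
    rewrite (_ : (fun q => _) = fun q => tc q)//.
    by apply: funext => q; exact: g_ambient_rt.
- move: j; apply: ord8_ind => [b||]; first exact: base_r.
  + rewrite (_ : (fun q => _) = fun q => tc q)//.
    by apply: funext => q; exact: g_ambient_rt.
  + rewrite (_ : (fun q => _) = fun=> 0)//.
    by apply: funext => q; exact: g_ambient_irho.
Qed.

Let ev_mx : 'M[R]_(3 + 1, 6 + 2) := rowsub ev8 1%:M.
Let od_mx : 'M[R]_(3 + 1, 6 + 2) := rowsub od8 1%:M.
Let mixed8_inv (p : 'cV[R]_(6 + 2)) : 'M[R]_(3 + 1) :=
  block_mx ((tc p ^+ 2)^-1 *: mixed_inv f (x13 (pr6 p))) 0 0 (tc p)^-1%:M.

Lemma odd_sandwich p : dom p -> od_mx *m g p *m od_mx^T = 0.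
Proof.
move=> Wp; rewrite rowsub_sandwich; apply/matrixP => i j; rewrite mxE [RHS]mxE.
exact: odd_g_ambient.
Qed.

Lemma g_ambient_mixed_inv p : dom p -> 0 < tc p ->
  od_mx *m g p *m ev_mx^T *m mixed8_inv p = 1%:M.
Proof.
move=> Wp t0; rewrite rowsub_sandwich.
rewrite (_ : mxsub _ _ _ = block_mx (tc p ^+ 2 *: mixed f (x13 (pr6 p))) 0 0 (tc p)%:M); last first.
  by apply/matrixP => i j; rewrite [LHS]mxE; exact: g_ambient_mixed.
rewrite /mixed8_inv mulmx_block !mul0mx !mulmx0 !addr0 add0r -scalemxAl -scalemxAr scalerA.
rewrite mulfV ?expf_neq0 ?gt_eqF// scale1r mixed_mx_inv; last exact: f3_neq0.
by rewrite -scalar_mxM mulfV ?gt_eqF// -scalar_mx_block.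
Qed.

Lemma g_ambient_unit p : dom p -> 0 < tc p -> g p \in unitmx.
Proof.
move=> Wp t0; exact: (null_splitting_inverse ev_mx od_mx _ _ splitting8
  (g_ambient_sym p Wp) (odd_sandwich p Wp) (g_ambient_mixed_inv p Wp t0)).1.
Qed.

Lemma even_mul_inv p : dom p -> 0 < tc p -> ev_mx *m invmx (g p) = mixed8_inv p *m od_mx.
Proof.
move=> Wp t0; exact: (null_splitting_mul_inv ev_mx od_mx _ _ splitting8
  (g_ambient_sym p Wp) (odd_sandwich p Wp) (g_ambient_mixed_inv p Wp t0)).
Qed.

Lemma partial_g_sym p k i j : dom p ->
  partial k (fun q => g q i j) p = partial k (fun q => g q j i) p.
Proof.
move=> Wp; apply: (partial_near dom) => //; first exact: open_dom.
by move=> q Wq; rewrite -[in LHS](g_ambient_sym q Wq) [LHS]mxE.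
Qed.

Lemma partial_g_odd p k i j : dom p -> partial k (fun q => g q (od8 i) (od8 j)) p = 0.
Proof.
move=> Wp; rewrite (partial_near _ _ (fun=> 0) _ _ open_dom Wp) ?partial_cst//.
by move=> q Wq; exact: odd_g_ambient.
Qed.

(** * First derivatives of the ambient metric and the trace of the even block *)

Let F1 p := pd1 f (x13 (pr6 p)).
Let F3 p := pd3 f (x13 (pr6 p)).
Let F13 p := pd3 (pd1 f) (x13 (pr6 p)).
Let F33 p := pd3 (pd3 f) (x13 (pr6 p)).

(** Differentiating [pd3 f] along x^1 yields the opposite order to the one in theta^6; all mixed
    derivatives are normalised to [pd3] outermost. *)
Lemma pd1_pd3 h w : smooth_on W h -> W w -> pd1 (pd3 h) w = pd3 (pd1 h) w.
Proof. by move=> sh Ww; exact: (smooth_schwarz W). Qed.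

Lemma pd1_pd33 w : W w -> pd1 (pd3 (pd3 f)) w = pd3 (pd3 (pd1 f)) w.
Proof.
move=> Ww; apply: (etrans (pd1_pd3 _ _ (smooth_on_partial _ _ _ f_smooth) Ww)).
exact: (partial_near _ _ _ _ _ W_open Ww (fun q Wq => pd1_pd3 _ _ f_smooth Wq)).
Qed.

Let dmixed p m := mixed_partial (x13 (pr6 p) ord0 0) (f (x13 (pr6 p)))
  (F3 p) (F13 p) (F33 p) (F1 p) (pd1 (pd3 (pd1 f)) (x13 (pr6 p)))
  (pd3 (pd3 (pd1 f)) (x13 (pr6 p))) (pd3 (pd3 (pd3 f)) (x13 (pr6 p))) m.

Lemma partial_mixed (p : 'cV[R]_6) k i j : W (x13 p) ->
  partial k (fun q => mixed f (x13 q) i j) p =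
  dmixed_mx (x13 p ord0 0) (f (x13 p)) (pd3 f (x13 p)) (pd3 (pd1 f) (x13 p))
    (pd3 (pd3 f) (x13 p))
    (partial k (fun q => x13 q ord0 0) p) (partial k (fun q => f (x13 q)) p)
    (partial k (fun q => pd3 f (x13 q)) p) (partial k (fun q => pd3 (pd1 f) (x13 q)) p)
    (partial k (fun q => pd3 (pd3 f) (x13 q)) p) i j.
Proof.
move=> Wp; have dcoef a : smooth_on W a ->
    is_derive p (dvec k) (fun q => a (x13 q)) (partial k (fun q => a (x13 q)) p).
  by move=> sa; apply: derivableP; apply: diff_derivable; exact: differentiable_comp_x13 sa Wp.
have f3s : smooth_on W (pd3 f) by exact: smooth_on_partial.
have f1s : smooth_on W (pd1 f) by exact: smooth_on_partial.
apply: derive_val; exact: (is_derive_mixed _ _ _ _ _ _ _ _ _ _ _ _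
  (dcoef _ (smooth_on_coord _ ord0)) (dcoef _ f_smooth) (dcoef _ f3s)
  (dcoef _ (smooth_on_partial _ _ _ f1s)) (dcoef _ (smooth_on_partial _ _ _ f3s)) i j).
Qed.

Lemma eq_dmixed_mx (x a b b1 b3 dx da db db1 db3 dx' da' db' db1' db3' : R) i j :
  dx = dx' -> da = da' -> db = db' -> db1 = db1' -> db3 = db3' ->
  dmixed_mx x a b b1 b3 dx da db db1 db3 i j = dmixed_mx x a b b1 b3 dx' da' db' db1' db3' i j.
Proof. by move=> -> -> -> -> ->. Qed.

Lemma partial_mixed_even p m i j : dom p ->
  partial (ev6 m) (fun q => mixed f (x13 q) i j) (pr6 p) = dmixed p m i j.
Proof.
move=> Wp; apply: (etrans (partial_mixed _ _ _ _ Wp)).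
pose d a := [:: pd1 a (x13 (pr6 p)); pd3 a (x13 (pr6 p)); 0]`_m.
have px a : partial (ev6 m) (fun q => a (x13 q)) (pr6 p) = d a.
  by rewrite partial_x13 /d; elim/ord3_ind: m {d}.
apply: (etrans (eq_dmixed_mx _ _ _ _ _ _ _ _ _ _ _ _ _ _ _ _ _
  (px (fun w => w ord0 0)) (px f) (px (pd3 f)) (px (pd3 (pd1 f))) (px (pd3 (pd3 f))))).
rewrite /dmixed /d {px d}; elim/ord3_ind: m => /=.
- exact: (eq_dmixed_mx _ _ _ _ _ _ _ _ _ _ _ _ _ _ _ _ _ (partial_coord _ _ _) erefl
    (pd1_pd3 _ _ f_smooth Wp) erefl (pd1_pd33 _ Wp)).
- exact: (eq_dmixed_mx _ _ _ _ _ _ _ _ _ _ _ _ _ _ _ _ _ (partial_coord _ _ _) erefl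
    erefl erefl erefl).
rewrite [RHS]mxE; move: (x13 _ _ _) (f _) (pd3 f _) (pd3 (pd1 f) _) (pd3 (pd3 f) _).
move=> x a' b' b1' b3'.
by move: i j; apply: ord3_ind; apply: ord3_ind; rewrite !mxE/=; ring.
Qed.

Lemma partial_mixed_odd p m i j : dom p ->
  partial (od6 m) (fun q => mixed f (x13 q) i j) (pr6 p) = 0.
Proof.
move=> Wp; apply: (etrans (partial_mixed _ _ _ _ Wp)).
have px a : partial (od6 m) (fun q => a (x13 q)) (pr6 p) = 0.
  by rewrite partial_x13; elim/ord3_ind: m.
apply: (etrans (eq_dmixed_mx _ _ _ _ _ _ _ _ _ _ _ _ _ _ _ _ _
  (px (fun w => w ord0 0)) (px f) (px (pd3 f)) (px (pd3 (pd1 f))) (px (pd3 (pd3 f))))).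
move: (x13 _ _ _) (f _) (pd3 f _) (pd3 (pd1 f) _) (pd3 (pd3 f) _) => x a' b' b1' b3'.
by move: i j; apply: ord3_ind; apply: ord3_ind; rewrite !mxE/=; ring.
Qed.

Lemma partial_tc (p : 'cV[R]_(6 + 2)) k : partial k tc p = (it == k)%:R.
Proof. exact: partial_coord. Qed.

Lemma differentiable_tc (p : 'cV[R]_(6 + 2)) : differentiable (@tc R) p.
Proof. exact: differentiable_coord_fun. Qed.

Lemma differentiable_rhoc (p : 'cV[R]_(6 + 2)) : differentiable (@rhoc R) p.
Proof. exact: differentiable_coord_fun. Qed.

Lemma differentiable_mixed p i j : dom p ->
  differentiable (fun q => mixed f (x13 (pr6 q)) i j) p.
Proof.
move=> Wp; have wg := wt_g_bryant W f f_smooth (od6 i) (ev6 j).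
apply: (differentiable_comp_pr6 (fun q => mixed f (x13 q) i j)).
rewrite (_ : (fun q => _) = (fun q => g_bryant f q (od6 i) (ev6 j))).
  exact: wt_differentiable W_open wg _ Wp.
by apply: funext => q; rewrite g_bryant_mixed.
Qed.

Lemma partial_g_ll p k i j : dom p ->
  partial k (fun q => g q (od8 (lshift 1 i)) (ev8 (lshift 1 j))) p =
  2%:R * tc p * (it == k)%:R * mixed f (x13 (pr6 p)) i j
  + tc p ^+ 2 * partial k (fun q => mixed f (x13 (pr6 q)) i j) p.
Proof.
move=> Wp; have E q : dom q -> g q (od8 (lshift 1 i)) (ev8 (lshift 1 j)) =
    (tc q * tc q) * mixed f (x13 (pr6 q)) i j.
  by move=> Wq; rewrite g_ambient_mixed// block_mxEul [LHS]mxE expr2.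
rewrite (partial_near _ _ _ _ _ open_dom Wp E).
have dt := differentiable_tc p.
rewrite (partialM _ _ _ _ (differentiableM dt dt) (differentiable_mixed _ _ _ Wp)).
rewrite (partialM _ _ _ _ dt dt) partial_tc.
have alg (u v t c : R) : (c * t + t * c) * v + t * t * u = 2%:R * t * c * v + t ^+ 2 * u by ring.
exact: alg.
Qed.

Lemma partial_g_rr p k : partial k (fun q => g q irho it) p = (it == k)%:R.
Proof.
rewrite -(partial_tc p); congr (partial k _ p); apply: funext => q.
exact: g_ambient_rt.
Qed.

Lemma partial_g_lr p k a s : dom p -> s = it \/ s = irho ->
  partial k (fun q => g q (base a) s) p = 0.
Proof.
move=> Wp sE; rewrite (_ : (fun q => _) = fun=> 0) ?partial_cst//.
by apply: funext => q; exact: g_ambient_br.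
Qed.

Lemma partial_g_mixed_odd p l i j : dom p ->
  partial (od8 l) (fun q => g q (od8 i) (ev8 j)) p = 0.
Proof.
move=> Wp; move: i j; apply: ord31_ind => [a|]; apply: ord31_ind => [b|].
- rewrite partial_g_ll//; move: l; apply: ord31_ind => [l|].
    rewrite od8l eq_sym base_it (partial_pr6 (fun q => mixed f (x13 q) a b)).
    by rewrite partial_mixed_odd// mulr0 mulr0 mul0r addr0.
  rewrite od8r (partial_pr6_0 (fun q => mixed f (x13 q) a b)); last by right.
  by rewrite (_ : (it == irho) = false)// mulr0 mul0r mulr0 addr0.
- by rewrite od8l ev8r partial_g_lr//; left.
- by rewrite od8r ev8l partial_g_sym// partial_g_lr//; right.
- rewrite od8r ev8r partial_g_rr; move: l; apply: ord31_ind => [l|].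
    by rewrite od8l eq_sym base_it.
  by rewrite od8r.
Qed.

(** Each of the three derivatives vanishes: the odd-odd block is 0, and the mixed block is constant
    along odd directions. This is what makes V parallel. *)
Lemma odd_first_kind p X : dom p -> od_mx *m first_kind g p X *m od_mx^T = 0.
Proof.
move=> Wp; rewrite rowsub_sandwich; apply/matrixP => i j; rewrite mxE [RHS]mxE mxE.
rewrite big1 ?mulr0// => k _.
have odd0 a c : partial (od8 a) (fun q => g q (od8 c) k) p = 0.
  by case: (cover8 k) => -[d ->]; [exact: partial_g_mixed_odd|exact: partial_g_odd].
by rewrite partial_g_odd// odd0 (partial_g_sym _ _ k)// odd0 addr0 subrr mulr0.
Qed.

(** On even directions P and Q have degree 0, so they do not depend on x^2, y^1, y^3, and only the
    factor x^2 of Bryant's metric is differentiated. *)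
Lemma partial_g_even p i m j : dom p ->
  partial (base (od6 i)) (fun q => g q (base (ev6 m)) (base (ev6 j))) p =
  tc p ^+ 2 * ((i == o3_0)%:R * even_mx (f (x13 (pr6 p))) (F3 p) (F33 p) m j).
Proof.
move=> Wp; pose S := schouten6 (g_bryant f).
pose e (w : 'cV[R]_2) := even_mx (f w) (pd3 f w) (pd3 (pd3 f) w) m j.
have zero F : wt W (wdeg (ev6 m) + wdeg (ev6 j) - 2%:R) F ->
    is_derive p (dvec (base (od6 i))) (fun q => F (pr6 q)) 0.
  move=> wF; have dF := wt_differentiable _ _ _ W_open wF _ Wp.
  have <- : partial (base (od6 i)) (fun q => F (pr6 q)) p = 0.
    rewrite partial_pr6; apply: (wt_neg _ _ _ (wt_partial _ _ _ _ W_open wF)) => //.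
    by rewrite !ev6_deg od6_deg.
  by apply: derivableP; apply: diff_derivable; exact: differentiable_comp_pr6.
have dS := zero _ (wt_schouten W f W_open f_smooth f3_neq0 (ev6 m) (ev6 j)).
have dQ := zero _ (wt_Q (ev6 m) (ev6 j)).
have coord k : is_derive p (dvec (base (od6 i))) (fun q : 'cV[R]_(6 + 2) => q k 0)
    (k == base (od6 i))%:R.
  rewrite -(partial_coord _ k p); apply: derivableP; apply: diff_derivable.
  exact: differentiable_coord_fun.
have dt : is_derive p (dvec (base (od6 i))) (fun q : 'cV[R]_(6 + 2) => tc q) 0.
  by have := coord it; rewrite eq_sym base_it.
have dr : is_derive p (dvec (base (od6 i))) (fun q : 'cV[R]_(6 + 2) => rhoc q) 0.
  by have := coord irho; rewrite eq_sym base_irho.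
have de : is_derive p (dvec (base (od6 i))) (fun q => e (x13 (pr6 q))) 0.
  have aff (h : R) : x13 (pr6 (h *: dvec (base (od6 i)) + p)) = h *: 0 + x13 (pr6 p).
    rewrite pr6_affine x13_affine (_ : x13 (pr6 (dvec (base (od6 i)))) = 0)//.
    apply/matrixP => r s; rewrite (ord1 s) !mxE.
    by elim/ord3_ind: i {zero dS dQ coord dt dr}; case: r => [[|[|//]] r2].
  have [e1 e2] := derive_comp_affine (fun q => x13 (pr6 q)) e p _ _ aff.
  by apply: DeriveDef; [rewrite e2; exact: derivable0|rewrite e1 derive0].
have dx := coord (base ix2); rewrite (inj_eq base_inj) in dx.
have dg : is_derive p (dvec (base (od6 i)))
    (fun q => g_bryant f (pr6 q) (ev6 m) (ev6 j)) ((i == o3_0)%:R * e (x13 (pr6 p))).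
  rewrite (_ : (fun q => _) = fun q : 'cV[R]_(6 + 2) => q (base ix2) 0 * e (x13 (pr6 q))).
    apply: is_derive_eq (is_deriveM_fun _ _ _ _ _ _ dx de) _.
    rewrite mulr0 addr0; congr (_%:R * _).
    by elim/ord3_ind: i {zero dS dQ coord dt dr dx de}.
  apply: funext => q; rewrite g_bryant_even; congr (_ * _).
  by rewrite mxE.
rewrite (_ : (fun q => _) = fun q => (tc q * tc q) * (g_bryant f (pr6 q) (ev6 m) (ev6 j)
      + 2%:R * rhoc q * S (pr6 q) (ev6 m) (ev6 j)
      + rhoc q * (rhoc q * rhoc q) * Q (pr6 q) (ev6 m) (ev6 j))); last first.
  by apply: funext => q; rewrite g_ambient_bb expr2 exprS expr2.
have dc := is_derive_cst_fun 2%:R p (dvec (base (od6 i))).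
have M := is_deriveM_fun; have D := is_deriveD_fun.
have := M _ _ _ _ _ _ _ _ (M _ _ _ _ _ _ _ _ dt dt)
  (D _ _ _ _ _ _ _ _ (D _ _ _ _ _ _ _ _ dg (M _ _ _ _ _ _ _ _ (M _ _ _ _ _ _ _ _ dc dr) dS))
    (M _ _ _ _ _ _ _ _ (M _ _ _ _ _ _ _ _ dr (M _ _ _ _ _ _ _ _ dr dr)) dQ)).
move=> /@derive_val; rewrite -/(partial _ _ p) => ->.
have alg (u v w x y z : R) : (0 * y + y * 0) * (u + 2%:R * z * v + z * (z * z) * w)
    + y * y * (x + ((0 * z + 2%:R * 0) * v + 2%:R * z * 0)
       + ((0 * (z * z) + z * (0 * z + z * 0)) * w + z * (z * z) * 0)) = y ^+ 2 * x by ring.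
exact: alg.
Qed.

(** The odd-even block of the Christoffel symbols of the first kind along the k-th coordinate
    direction. *)
Let fk (p : 'cV[R]_(6 + 2)) k : 'M[R]_(3 + 1) := \matrix_(i, j) (2%:R^-1 *
  (partial k (fun q => g q (od8 i) (ev8 j)) p
   + partial (ev8 j) (fun q => g q (od8 i) k) p
   - partial (od8 i) (fun q => g q k (ev8 j)) p)).

Lemma od_first_kind_ev p X :
  od_mx *m first_kind g p X *m ev_mx^T = \sum_k X k 0 *: fk p k.
Proof.
rewrite rowsub_sandwich; apply/matrixP => i j; rewrite mxE [LHS]mxE summxE big_distrr/=.
by apply: eq_bigr => k _; rewrite [RHS]mxE [fk _ _ _ _]mxE mulrCA.
Qed.

(** Applied with E = [fk p k], it discards the entries in the row of rho and the columns of the base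
    directions, the only place where the rho-derivative of the even-even block, hence P
    undifferentiated, would appear. *)
Lemma tr_block_diag (A : 'M[R]_3) (d : R) (E : 'M[R]_(3 + 1)) :
  \tr (block_mx A 0 0 d%:M *m E) = \tr (A *m ulsubmx E) + d * E (rshift 3 ord0) (rshift 3 ord0).
Proof.
rewrite -[E in LHS]submxK mulmx_block !mul0mx addr0 add0r mxtrace_block; congr (_ + _).
by rewrite mul_scalar_mx [LHS]big_ord1 !mxE add0r.
Qed.

Lemma fk_odd p l : dom p -> fk p (od8 l) = 0.
Proof.
move=> Wp; apply/matrixP => i j; rewrite mxE [RHS]mxE.
by rewrite !partial_g_mixed_odd// partial_g_odd// addr0 subrr mulr0.
Qed.

(** This is the logarithmic derivative of t^3: each of the three even base directions contributes
    1/t. In the entry of rho and t, the two derivatives of g(d_rho, d_t) = t cancel that of g(d_t,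
    d_t) = 2 rho. *)
Lemma tr_fk_it p : dom p -> 0 < tc p ->
  \tr (mixed8_inv p *m fk p it) = 3%:R / tc p.
Proof.
move=> Wp t0; rewrite tr_block_diag -ev8r.
have -> : fk p (ev8 (rshift 3 ord0)) (rshift 3 ord0) (rshift 3 ord0) = 0.
  rewrite mxE od8r ev8r partial_g_rr eqxx.
  have -> : partial irho (fun q => g q it it) p = 2%:R.
    rewrite (_ : (fun q => _) = fun q => 2%:R * rhoc q); last first.
      by apply: funext => q; exact: g_ambient_tt.
    have dc : differentiable (fun=> 2%:R : R) p by exact: differentiable_cst.
    rewrite (partialM _ _ _ _ dc (differentiable_rhoc p)) partial_cst.
    by rewrite (partial_coord irho irho) eqxx mul0r add0r mulr1.
  by rewrite (_ : 1 + 1 = 2%:R :> R)// subrr mulr0.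
rewrite mulr0 addr0.
have -> : ulsubmx (fk p (ev8 (rshift 3 ord0))) = tc p *: mixed f (x13 (pr6 p)).
  apply/matrixP => i j; rewrite mxE mxE mxE partial_g_ll//.
  rewrite ev8r ev8l od8l eqxx partial_g_lr//; last by left.
  rewrite (partial_g_sym _ _ it)// partial_g_lr//; last by left.
  rewrite (partial_pr6_0 (fun q => mixed f (x13 q) i j)); last by left.
  rewrite [RHS]mxE /=; move: (mixed f _ i j) (tc p) => u t.
  by field.
rewrite -scalemxAl -scalemxAr !mxtraceZ mulmx1C ?mixed_mx_inv//; last exact: f3_neq0.
rewrite mxtrace1; have := gt_eqF t0; move: (tc p) => t t0'.
by field; rewrite t0'.
Qed.

Lemma tr_fk_base p m : dom p -> 0 < tc p ->
  \tr (mixed8_inv p *m fk p (base (ev6 m))) =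
  11%:R / 3%:R * [:: F13 p; F33 p; 0]`_m * (F3 p)^-1.
Proof.
move=> Wp t0; rewrite tr_block_diag.
have -> : fk p (base (ev6 m)) (rshift 3 ord0) (rshift 3 ord0) = 0.
  rewrite mxE od8r ev8r partial_g_rr eq_sym base_it.
  rewrite (partial_g_sym _ _ irho)// !partial_g_lr//; [|by left|by right].
  by rewrite addr0 subrr mulr0.
rewrite mulr0 addr0 -(tr_mixed_inv_first_kind (x13 (pr6 p) ord0 0) (f (x13 (pr6 p))) (F3 p)
  (F13 p) (F33 p) (F1 p) (pd1 (pd3 (pd1 f)) (x13 (pr6 p)))
  (pd3 (pd3 (pd1 f)) (x13 (pr6 p))) (pd3 (pd3 (pd3 f)) (x13 (pr6 p)))); last exact: f3_neq0.
have -> : ulsubmx (fk p (base (ev6 m))) = tc p ^+ 2 *: \matrix_(i, j) (2%:R^-1 *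
    (dmixed p m i j + dmixed p j i m -
      (i == o3_0)%:R * even_mx (f (x13 (pr6 p))) (F3 p) (F33 p) m j)).
  apply/matrixP => i j; rewrite mxE mxE mxE [RHS]mxE [X in _ = _ * X]mxE.
  rewrite -{2}ev8l !partial_g_ll// ev8l od8l [it == _]eq_sym base_it.
  rewrite [it == _]eq_sym base_it.
  rewrite (partial_pr6 (fun q => mixed f (x13 q) i j)) (partial_pr6 (fun q => mixed f (x13 q) i m)).
  rewrite !partial_mixed_even// partial_g_even//.
  have alg (u v w x y t : R) : 2%:R^-1 * (2%:R * t * 0 * x + t ^+ 2 * u
      + (2%:R * t * 0 * y + t ^+ 2 * v) - t ^+ 2 * w)
      = t ^+ 2 * (2%:R^-1 * (u + v - w)) by ring.
  exact: alg.
rewrite -scalemxAl -scalemxAr scalerA mulVf ?scale1r// expf_neq0// gt_eqF//.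
Qed.

(* The coefficient of kappa_tilde on dx^1, dx^3, dy^2, dt: the definition
   contributes -(2/9) t^3 f_3^(-1/3) and [det_kappa_mx] the factor -(9/4) f_3^4. *)
Definition weight (p : 'cV[R]_(6 + 2)) : R :=
  2%:R^-1 * (tc p * (tc p * tc p)) *
    (pd3 f (x13 (pr6 p)) ^+ 4 * (cbrt (pd3 f (x13 (pr6 p))))^-1).

Lemma is_derive_weight p k : dom p -> 0 < tc p ->
  is_derive p (dvec k) weight (weight p * \tr (mixed8_inv p *m fk p k)) /\
  differentiable weight p.
Proof.
move=> Wp t0; have f30 := f3_neq0 _ Wp.
pose G (q : 'cV[R]_(6 + 2)) := pd3 f (x13 (pr6 q)).
have f3s : smooth_on W (pd3 f) by exact: smooth_on_partial.
have dG : differentiable G p.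
  apply: (differentiable_comp_pr6 (fun q => pd3 f (x13 q))).
  exact: differentiable_comp_x13 f3s Wp.
have [dphi dphi'] := is_derive_comp1 _ G p (dvec k) _ (is_derive_quartic_cbrt _ f30) dG.
have dt : is_derive p (dvec k) (@tc R) (it == k)%:R.
  by rewrite -(partial_tc p k); apply: derivableP; exact: diff_derivable (differentiable_tc p).
split; last first.
  apply: differentiableM; last exact: dphi'.
  have dtc := differentiable_tc p.
  apply: differentiableM; first exact: differentiable_cst.
  by apply: differentiableM; [exact: dtc|apply: differentiableM; exact: dtc].
have dc := is_derive_cst_fun 2%:R^-1 p (dvec k).
have M := is_deriveM_fun.
apply: is_derive_eq (M _ _ _ _ _ _ _ _ (M _ _ _ _ _ _ _ _ dc
  (M _ _ _ _ _ _ _ _ dt (M _ _ _ _ _ _ _ _ dt dt))) dphi) _.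
rewrite /weight -/(G p).
suff -> : \tr (mixed8_inv p *m fk p k) =
    3%:R * (it == k)%:R / tc p + 11%:R / 3%:R * partial k G p * (G p)^-1.
  have t0' : tc p != 0 by rewrite gt_eqF.
  move: f30 t0'; rewrite -/(G p) /partial.
  move: (G p) ('D_ _ _ _) (tc p) ((it == k)%:R) => b db t c b0 t0'.
  move: (cbrt b)^-1 => y.
  by field; rewrite b0 t0'.
have Gb := partial_pr6 (fun q => pd3 f (x13 q)) p.
have G0 := partial_pr6_0 (fun q => pd3 f (x13 q)) p.
move: k {dphi dt dc}; apply: ord8_ind => [a||].
- rewrite eq_sym base_it mulr0 mul0r add0r Gb partial_x13.
  case: (cover6 a) => -[m ->].
    rewrite tr_fk_base//; congr (_ * _ * _).
    elim/ord3_ind: m; [exact: (esym (pd1_pd3 _ _ f_smooth Wp))|reflexivity|reflexivity].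
  rewrite -od8l fk_odd// mulmx0 mxtrace0.
  by elim/ord3_ind: m => /=; rewrite mulr0 mul0r.
- rewrite tr_fk_it// eqxx mulr1 G0; last by left.
  by rewrite mulr0 mul0r addr0.
- rewrite -od8r fk_odd// mulmx0 mxtrace0 od8r G0; last by right.
  by rewrite (_ : (it == irho) = false)// !mulr0 !mul0r addr0.
Qed.

(** Even rows of the inverse metric see only the odd rows of the first-kind symbols, whose odd
    columns vanish; what is left is A'. Its trace is linear in X, so coordinate directions
    suffice. *)
Lemma conn_mx_even p X : dom p -> 0 < tc p ->
  exists2 A', ev_mx *m conn_mx g p X = A' *m ev_mx & 'D_X weight p = weight p * \tr A'.
Proof.
move=> Wp t0; have [_ _ _ nvE] := @splitting8 R.
have nG : ev_mx *m conn_mx g p X = mixed8_inv p *m od_mx *m first_kind g p X.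
  by rewrite conn_mxE mulmxA even_mul_inv.
exists (mixed8_inv p *m (od_mx *m first_kind g p X *m ev_mx^T)).
  have odd0 : mixed8_inv p *m od_mx *m first_kind g p X *m od_mx^T = 0.
    by rewrite -!(mulmxA (mixed8_inv p)) odd_first_kind// mulmx0.
  by rewrite nG -[LHS]mulmx1 -nvE mulmxDr !mulmxA odd0 mul0mx addr0.
rewrite od_first_kind_ev mulmx_sumr linear_sum/=.
(* The direction [it] is a placeholder: the differentiability part does not involve it. *)
have [_ dw] := is_derive_weight p it Wp t0.
rewrite derive_partial// mulr_sumr; apply: eq_bigr => k _.
have [[_ dk] _] := is_derive_weight p k Wp t0.
by rewrite -scalemxAr linearZ/= /partial dk mulrCA.
Qed.
End ambient.

(** * The form kappa_tilde *)

Lemma pull_wedge1 {R : realType} {k : nat} (a : 'rV[R]_6) (w : kform R 6 k) :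
  pull_form (wedge1 a w) = wedge1 (pull_cov a) (pull_form w).
Proof.
apply: funext => v; apply: eq_bigr => i _; congr (_ * _ * _).
by rewrite /pull_cov -[v i in RHS]vsubmxK mul_row_col mul0mx addr0.
Qed.

Lemma wedge1_scale {R : realType} {n k : nat} (a : 'rV[R]_n) (c : R) (w : kform R n k) :
  wedge1 a (scale_form c w) = scale_form c (wedge1 a w).
Proof.
apply: funext => v; rewrite /scale_form /wedge1 big_distrr/=.
by apply: eq_bigr => i _; rewrite mulrCA.
Qed.

Lemma kappa_tildeE {R : realType} (f : 'cV[R]_2 -> R) p :
  kappa_tilde f p =
  scale_form (- (2%:R * tc p ^+ 3 / (9%:R * cbrt (pd3 f (x13 (pr6 p))))))
    (wedges [:: dcov it; pull_cov (theta2 f (pr6 p));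
                pull_cov (theta4 f (pr6 p)); pull_cov (theta6 f (pr6 p))]).
Proof.
rewrite /kappa_tilde /kappa.
have -> (c : R) (w : kform R 6 3) : pull_form (scale_form c w) = scale_form c (pull_form w) by [].
rewrite wedge1_scale !pull_wedge1; apply: funext => v.
have mulN (x y z w : R) : - (x / y) * (z^-1 * w) = - (x / (y * z)) * w.
  by rewrite invfM !mulNr !mulrA.
exact: mulN.
Qed.

(* The coefficients of dt, theta^2, theta^4, theta^6 with respect to
   dx^1, dx^3, dy^2, dt. *)
Definition kappa_mx {R : realType} (a b b1 : R) : 'M[R]_(3 + 1) :=
  \matrix_(i, j) nth 0 (nth [::]
    [:: [:: 0; 0; 0; 1];
        [:: a; 0; 1; 0];
        [:: 3%:R / 2%:R * b ^+ 2; 0; 0; 0];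
        [:: 2%:R^-1 * b1 * a; 3%:R / 2%:R * b ^+ 2; 2%:R^-1 * b1; 0]] i) j.

Lemma det_kappa_mx {R : realType} (a b b1 : R) :
  \det (kappa_mx a b b1) = - (9%:R / 4%:R * b ^+ 4).
Proof.
rewrite (expand_det_row _ ord0) !big_ord_recl big_ord0 !mxE/= !mul0r !add0r mul1r addr0.
(* Once the row of dt is deleted, the row with index 1 is that of theta^4, which has a single
   nonzero entry. *)
rewrite /cofactor (expand_det_row _ (@Ordinal 3 1 isT)) !big_ord_recl big_ord0 !mxE/=.
rewrite !mul0r !addr0 /cofactor !(expand_det_row _ ord0) !big_ord_recl !big_ord0.
rewrite /cofactor !det_mx11 !mxE/=.
transitivity ((-1) ^+ 3 * (3%:R / 2%:R * b ^+ 2 * ((-1) ^+ 1 *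
    (0 * ((-1) ^+ 0 * (2%:R^-1 * b1)) + (1 * ((-1) ^+ 1 * (3%:R / 2%:R * b ^+ 2)) + 0))))).
  by [].
by field.
Qed.

Lemma kappa_mx_mul {R : realType} (a b b1 : R) :
  let t2 := dcov iy2 + a *: dcov ix1 in
  let t4 := (3%:R / 2%:R * b ^+ 2) *: dcov ix1 in
  let t6 := (3%:R / 2%:R * b ^+ 2) *: dcov ix3 + (2%:R^-1 * b1) *: t2 in
  \matrix_(i < 4) nth 0 [:: dcov it; pull_cov t2; pull_cov t4; pull_cov t6] i =
  kappa_mx a b b1 *m (rowsub ev8 1%:M : 'M[R]_(3 + 1, 6 + 2)).
Proof.
move=> t2 t4 t6; apply/matrixP => i j; rewrite mxE [RHS]mxE (@big_split_ord _ _ _ 3 1)/=.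
rewrite big_ord3 big_ord1 !mxE !ev8l ev8r.
have e0 : ev6 o3_0 = ix1 by []. have e1 : ev6 o3_1 = ix3 by []. have e2 : ev6 o3_2 = iy2 by [].
rewrite {}e0 {}e1 {}e2; have r0 (t : 'rV[R]_6) k : k = it \/ k = irho -> pull_cov t 0 k = 0.
  by case=> ->; rewrite /pull_cov row_mxEr mxE.
have rl (t : 'rV[R]_6) j' : pull_cov t 0 (base j') = t 0 j' by rewrite /pull_cov row_mxEl.
move: j; apply: ord8_ind => [j||].
- rewrite !(inj_eq base_inj) [it == _]eq_sym base_it !mulr0 addr0 !(eq_sym _ j).
  case: i => [[|[|[|[|//]]]] i4] /=; rewrite ?rl ?mxE ?base_it/= ?mxE/=; ring.
- rewrite !base_it eqxx; case: i => [[|[|[|[|//]]]] i4] /=; rewrite ?r0 ?mxE/=; try (by left); ring.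
- rewrite !base_irho (_ : (it == irho) = false)//.
  by case: i => [[|[|[|[|//]]]] i4] /=; rewrite ?r0 ?mxE/=; try (by right); ring.
Qed.

Lemma kappa_tilde_weight {R : realType} (f : 'cV[R]_2 -> R) p :
  kappa_tilde f p = scale_form (weight f p)
    (det_form (rowsub ev8 1%:M : 'M[R]_(3 + 1, 6 + 2))).
Proof.
rewrite kappa_tildeE; apply: funext => v; rewrite /scale_form wedges_det.
have -> : det_form (\matrix_(i < 4) nth 0 [:: dcov it; pull_cov (theta2 f (pr6 p));
    pull_cov (theta4 f (pr6 p)); pull_cov (theta6 f (pr6 p))] i) v =
    - (9%:R / 4%:R * pd3 f (x13 (pr6 p)) ^+ 4) *
    det_form (rowsub ev8 1%:M : 'M[R]_(3 + 1, 6 + 2)) v.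
  rewrite -(det_kappa_mx (f (x13 (pr6 p))) _ (pd3 (pd1 f) (x13 (pr6 p)))) -det_form_mull.
  by congr (det_form _ v); exact: kappa_mx_mul.
have alg (d c b t : R) : - (2%:R * t ^+ 3 / (9%:R * c)) * (- (9%:R / 4%:R * b ^+ 4) * d) =
    2%:R^-1 * (t * (t * t)) * (b ^+ 4 * c^-1) * d.
  (* Since the inverse of 0 is 0, both sides vanish when the cube root does, and the formula holds
     at every point. *)
  have [->|c0] := eqVneq c 0; first by rewrite mulr0 invr0 !mulr0 oppr0 !mul0r.
  by field.
exact: alg.
Qed.

Lemma weight_neq0 {R : realType} (f : 'cV[R]_2 -> R) p :
  0 < tc p -> pd3 f (x13 (pr6 p)) != 0 -> weight f p != 0.
Proof.
rewrite /weight; move: (tc p) (pd3 f _) => t b t0 b0.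
have cb0 : cbrt b != 0.
  by rewrite /cbrt mulf_neq0 ?sgr_eq0// gt_eqF// powR_gt0// normr_gt0.
have t0' : t != 0 by rewrite gt_eqF.
apply: mulf_neq0; last by rewrite mulf_neq0 ?invr_eq0 ?expf_neq0.
by rewrite mulf_neq0 ?invr_eq0 ?pnatr_eq0 ?mulf_neq0.
Qed.

Lemma stab_of_scale {R : realType} {n k : nat} (c : R) (w : kform R n k) :
  c != 0 -> stab_of (scale_form c w) = stab_of w.
Proof.
move=> c0; rewrite eqEsubset /stab_of /scale_form; split=> A /= stA v.
  by apply: (mulfI c0); rewrite mulr0 big_distrr/= stA.
by rewrite -big_distrr/= stA mulr0.
Qed.

Lemma V_tildeE {R : realType} (f : 'cV[R]_2 -> R) p X :
  0 < tc p -> pd3 f (x13 (pr6 p)) != 0 ->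
  V_tilde f p X <-> (rowsub ev8 1%:M : 'M[R]_(3 + 1, 6 + 2)) *m X = 0.
Proof.
move=> t0 b0; have w0 := weight_neq0 f p t0 b0.
have [nn _ _ _] := @splitting8 R.
rewrite /V_tilde/= kappa_tilde_weight; apply: iff_trans (interior_det_form _ X nn).
split=> H v; last by rewrite /Defs.interior /scale_form [X in _ * X]H mulr0.
by apply: (mulfI w0); rewrite mulr0; exact: H.
Qed.

(** The kernel of a coordinate projection is spanned by the omitted coordinate vectors, which are
    the columns of the transpose of the odd projection. *)
Lemma mem_span_odd {R : realType} (X : 'cV[R]_(6 + 2)) :
  (rowsub ev8 1%:M : 'M[R]_(3 + 1, 6 + 2)) *m X = 0 <->
  X \in <<[:: dvec (base ix2); dvec (base iy1); dvec (base iy3); dvec irho]>>%VS.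
Proof.
have [_ _ nv nvE] := @splitting8 R.
pose n : 'M[R]_(3 + 1, 6 + 2) := rowsub ev8 1%:M; pose v : 'M[R]_(3 + 1, 6 + 2) := rowsub od8 1%:M.
have vcol b : v^T *m delta_mx b 0 = dvec (od8 b).
  rewrite -colE; apply/matrixP => i j; rewrite (ord1 j) !mxE eqxx andbT eq_sym.
  by [].
split=> [nX|].
  have -> : X = \sum_b (v *m X) b 0 *: dvec (od8 b).
    rewrite -[LHS]mul1mx -nvE mulmxDl -!mulmxA nX mulmx0 add0r -/v.
    rewrite [v *m X in LHS]matrix_sum_delta mulmx_sumr; apply: eq_bigr => b _.
    by rewrite big_ord1 -scalemxAr vcol.
  apply: rpred_sum => b _; apply: rpredZ; apply: memv_span.
  move: b; apply: ord31_ind => [b|]; rewrite ?od8r ?od8l ?inE ?eqxx ?orbT//.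
  by elim/ord3_ind: b; rewrite eqxx ?orbT.
have nd b : n *m dvec (od8 b) = 0 by rewrite -vcol mulmxA nv mul0mx.
move=> /(@coord_span _ _ _ (in_tuple _)) ->; rewrite mulmx_sumr big1// => i _.
rewrite -scalemxAr (_ : n *m _ = 0) ?scaler0//.
case: i => [[|[|[|[|//]]]] i4] /=.
- by rewrite -(nd (lshift 1 o3_0)) od8l.
- by rewrite -(nd (lshift 1 o3_1)) od8l.
- by rewrite -(nd (lshift 1 o3_2)) od8l.
- by rewrite -(nd (rshift 3 ord0)) od8r.
Qed.

(** * The Lie algebra sl_4 and its Abelian ideal Lambda_4 *)

Lemma sl4_Lambda4_so {R : realType} : @sl4_Lambda4 R `<=` so_of J44.
Proof.
move=> _ [X [Z [_ ZZ ->]]]; rewrite /so_of/J44/= tr_block_mx !mulmx_block.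
rewrite !mul0mx !mulmx0 !mulmx1 !mul1mx !addr0 !add0r add_block_mx -[RHS]block_mx0.
have ZZ' : Z^T + Z = 0 by rewrite addrC.
by rewrite trmx0 addr0 subrr ZZ' linearN/= trmxK addNr.
Qed.

Lemma lie_emb_sl {R : realType} (X Y : 'M[R]_4) :
  sl4 (lie X Y) /\ lie (emb_sl X) (emb_sl Y) = emb_sl (lie X Y).
Proof.
split; first by rewrite /sl4/lie/= linearB/= mxtrace_mulC subrr.
rewrite /lie /emb_sl !mulmx_block !mul0mx !mulmx0 !addr0 !add0r opp_block_mx add_block_mx.
rewrite !subr0 !mulNmx !mulmxN !opprK linearB/= !trmx_mul opprB.
by congr block_mx; rewrite addrC.
Qed.

Lemma lie_emb_Lambda {R : realType} (Z Z' : 'M[R]_4) :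
  lie (emb_Lambda Z) (emb_Lambda Z') = 0.
Proof.
rewrite /lie /emb_Lambda !mulmx_block !mul0mx !mulmx0 !addr0.
by rewrite subrr.
Qed.

Lemma lie_emb_sl_Lambda {R : realType} (X Z : 'M[R]_4) : Lambda4 Z ->
  Lambda4 (X *m Z - (X *m Z)^T) /\
  lie (emb_sl X) (emb_Lambda Z) = emb_Lambda (X *m Z - (X *m Z)^T).
Proof.
rewrite /Lambda4/= => ZZ; split.
  by rewrite linearB/= trmxK addrA subrK subrr.
have Zt : Z^T = - Z by apply/eqP; rewrite -addr_eq0 addrC ZZ.
rewrite /lie /emb_sl /emb_Lambda !mulmx_block !mul0mx !mulmx0 !addr0 !add0r.
rewrite opp_block_mx add_block_mx !oppr0 !addr0 trmx_mul Zt mulNmx opprK.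
by rewrite mulmxN opprK.
Qed.

Theorem proposition4p2 (R : realType) (W : set 'cV[R]_2) (f : 'cV[R]_2 -> R)
  (Q : 'cV[R]_6 -> 'M[R]_6) (U : set 'cV[R]_(6 + 2))
  (W_open : open W) (f_smooth : smooth_on W f)
  (f3_neq0 : forall w, W w -> pd3 f w != 0)
  (Q_span : in_spanA W f Q)
  (U_open : open U)
  (U_dom : forall p, U p -> W (x13 (pr6 p)) /\ 0 < tc p) :
  ((forall p, U p ->
      kappa_tilde f p =
      scale_form (- (2%:R * tc p ^+ 3 / (9%:R * cbrt (pd3 f (x13 (pr6 p))))))
        (wedges [:: dcov it; pull_cov (theta2 f (pr6 p));
                    pull_cov (theta4 f (pr6 p)); pull_cov (theta6 f (pr6 p))]))
   /\ parallel_form (g_ambient f Q) U (kappa_tilde f))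
  /\ [/\ forall p, U p -> forall X Y, V_tilde f p X -> V_tilde f p Y ->
           (X^T *m g_ambient f Q p *m Y) 0 0 = 0,
         forall p, U p -> forall X, V_tilde f p X <->
           X \in <<[:: dvec (base ix2); dvec (base iy1);
                       dvec (base iy3); dvec irho]>>%VS
       & parallel_distribution (g_ambient f Q) U (V_tilde f)]
  /\ ((forall p, U p ->
         [/\ holonomy_algebra (g_ambient f Q) U p `<=`
               so_of (g_ambient f Q p) `&` stab_of (kappa_tilde f p),
             exists B, adapted_basis (g_ambient f Q p) (V_tilde f p) B
           & forall B, adapted_basis (g_ambient f Q p) (V_tilde f p) B ->
               in_basis B (holonomy_algebra (g_ambient f Q) U p) `<=` sl4_Lambda4
               /\ in_basis B (so_of (g_ambient f Q p) `&`
                              stab_of (kappa_tilde f p)) = sl4_Lambda4])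
      /\ (@sl4_Lambda4 R `<=` so_of J44)
      /\ [/\ forall X Y : 'M[R]_4, sl4 X -> sl4 Y ->
               sl4 (lie X Y) /\ lie (emb_sl X) (emb_sl Y) = emb_sl (lie X Y),
             forall Z Z' : 'M[R]_4, Lambda4 Z -> Lambda4 Z' ->
               lie (emb_Lambda Z) (emb_Lambda Z') = 0
           & forall X Z : 'M[R]_4, sl4 X -> Lambda4 Z ->
               Lambda4 (X *m Z - (X *m Z)^T) /\
               lie (emb_sl X) (emb_Lambda Z) = emb_Lambda (X *m Z - (X *m Z)^T)]).
Proof.
have dom_t p : U p -> [/\ W (x13 (pr6 p)), 0 < tc p & pd3 f (x13 (pr6 p)) != 0].
  by move=> /U_dom[Wp t0]; split=> //; exact: f3_neq0.
pose n : 'M[R]_(3 + 1, 6 + 2) := rowsub ev8 1%:M.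
pose v : 'M[R]_(3 + 1, 6 + 2) := rowsub od8 1%:M.
have [nn vv nv nvE] := @splitting8 R.
(* Parts (i), (ii) and the inclusion of the holonomy algebra in (iii) are all drawn from this
   relation. *)
have nconn p X : U p -> exists2 A', n *m conn_mx (g_ambient f Q) p X = A' *m n &
    'D_X (weight f) p = weight f p * \tr A'.
  by move=> /dom_t[Wp t0 _]; exact: (conn_mx_even W f Q W_open f_smooth f3_neq0 Q_span).
have dw p : U p -> differentiable (weight f) p.
  move=> /dom_t[Wp t0 _].
  exact: (is_derive_weight W f Q W_open f_smooth f3_neq0 Q_span p it Wp t0).2.
have VE p X : U p -> V_tilde f p X <-> n *m X = 0.
  by move=> /dom_t[_ t0 b0]; exact: V_tildeE.
have gsym p : U p -> (g_ambient f Q p)^T = g_ambient f Q p.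
  by move=> /dom_t[Wp _ _]; exact: (g_ambient_sym W f Q W_open f_smooth f3_neq0 Q_span).
have gunit p : U p -> g_ambient f Q p \in unitmx.
  by move=> /dom_t[Wp t0 _]; exact: (g_ambient_unit W f Q W_open f_smooth f3_neq0 Q_span).
have vgv p : U p -> v *m g_ambient f Q p *m v^T = 0.
  by move=> /dom_t[Wp _ _]; exact: (odd_sandwich W f Q W_open f_smooth f3_neq0 Q_span).
have stabE p : U p -> stab_of (kappa_tilde f p) = stab_of (det_form n).
  move=> /dom_t[_ t0 b0]; rewrite kappa_tilde_weight; exact: stab_of_scale (weight_neq0 f p t0 b0).
have hol p : U p -> holonomy_algebra (g_ambient f Q) U p `<=`
    so_of (g_ambient f Q p) `&` stab_of (kappa_tilde f p).
  move=> Up; have [_ t0 b0] := dom_t p Up; rewrite (stabE p Up).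
  apply: (holonomy_algebra_sub _ _ _ (weight f)) => //.
    move=> q i j /dom_t[Wq _ _].
    exact: (differentiable_g_ambient W f Q W_open f_smooth f3_neq0 Q_span).
  exact: weight_neq0.
split; [split|split; [split|split; [|split; [|split]]]].
- by move=> p _; exact: kappa_tildeE.
- apply: (parallel_det_form _ _ n (weight f)) => // p _.
  exact: kappa_tilde_weight.
- move=> p Up X Y /(VE _ _ Up) nX /(VE _ _ Up) nY.
  have odd (Z : 'cV[R]_(6 + 2)) : n *m Z = 0 -> Z = v^T *m (v *m Z).
    by move=> nZ; rewrite -[LHS]mul1mx -nvE mulmxDl -!mulmxA nZ mulmx0 add0r.
  have -> : X^T *m g_ambient f Q p *m Y =
      (v *m X)^T *m (v *m g_ambient f Q p *m v^T) *m (v *m Y).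
    by rewrite [in LHS](odd X nX) [in LHS](odd Y nY) [in LHS]trmx_mul trmxK !mulmxA.
  by rewrite (vgv p Up) mulmx0 mul0mx mxE.
- by move=> p Up X; apply: (iff_trans (VE p X Up)); exact: mem_span_odd.
- apply: (parallel_kernel _ _ n) => // p X Up.
  by have [A' nA' _] := nconn p X Up; exists A'.
- move=> p Up; have [Wp t0 b0] := dom_t p Up; split.
  + exact: hol.
  + apply: (adapted_basis_exists n v) (splitting8) (gsym p Up) (vgv p Up) _ (VE p ^~ Up).
    exact: (g_ambient_mixed_inv W f Q W_open f_smooth f3_neq0 Q_span p Wp t0).
  + move=> B adB; have eqB : in_basis B (so_of (g_ambient f Q p) `&`
        stab_of (kappa_tilde f p)) = sl4_Lambda4.
      by rewrite (stabE p Up); exact: (in_adapted_basis n v _ _ _ splitting8 (VE p ^~ Up) adB).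
    split=> //; rewrite -eqB => M [A hA AB]; exists A => //; exact: hol.
- exact: sl4_Lambda4_so.
- by move=> X Y _ _; exact: lie_emb_sl.
- by move=> Z Z' _ _; exact: lie_emb_Lambda.
- by move=> X Z _; exact: lie_emb_sl_Lambda.
Qed.
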